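(* Let $\mathcal{A}$ be a semi-simple rigid pseudo-abelian $K$-category of integral type, and let $F\in\operatorname{Aut}^\otimes(Id_{\mathcal{A}})$. Then the following conditions are equivalent: (i) Given a simple object $S\in\mathcal{A}$, $F_S=1_S$ implies $S\simeq\mathbf{1}$. (ii) For any $M\in\mathcal{A}$, $\operatorname{ord}_{t=1}Z_F(M,t)=-\dim_K\mathcal{A}(\mathbf{1},M)$. (iii) For $S,T\in\mathcal{A}$ simple, $P_S=P_T\Rightarrow S\simeq T$. (iv) For $M,N\in\mathcal{A}$, $Z_F(M,t)=Z_F(N,t)\Rightarrow M\simeq N$. (v) $(\mathcal{A},F)$ verifies the Tate conjecture, i.e. for any $M\in\mathcal{A}$, $K[F_M]$ is the centre of $\operatorname{End}_{\mathcal{A}}(M)$. Moreover, these conditions imply: (vi) For any simple $S$, $|\mu(S)|=1$ and $K[F_S]$ is the centre of the algebra $\operatorname{End}_{\mathcal{A}}(S)$.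
   Context: $K$ is a field of characteristic $0$. A rigid $K$-category is an additive $K$-linear symmetric monoidal category with $K$-bilinear tensor product, in which every object has a dual, and such that $\operatorname{End}(\mathbf{1})=K$. $\operatorname{tr}(f)\in K$ denotes the categorical trace. $\mathcal{A}(M,N)$ denotes Hom. The category is semi-simple if all rings $\operatorname{End}(M)$ are semi-simple (they are then finite-dimensional semi-simple $K$-algebras), and pseudo-abelian if idempotents split. For a finite-dimensional simple $K$-algebra $A$, $\operatorname{Trd}_A=\operatorname{Tr}_{Z(A)/K}\circ\operatorname{Trd}_{A/Z(A)}$; for $A=\prod A_i$ semi-simple, $\operatorname{Trd}_A=\sum_i\operatorname{Trd}_{A_i}$. For $M\in\mathcal{A}$ with $\operatorname{End}(M)=\prod_iA_i$ and corresponding central idempotents $e_i$, there is a unique $\mu(M)\in\operatorname{End}(M)$ with $\operatorname{tr}(f)=\operatorname{Trd}_{\operatorname{End}(M)}(\mu(M)f)$ for all $f$; it is central and invertible and $\mu(M)=\sum_i\mu_i(M)e_i$ with $\mu_i(M)\in Z(A_i)$. $\mathcal{A}$ is of integral type if all $\mu_i(M)$ are in $\mathbf{Z}$ for all $M$. For $S$ simple, $\mu(S)$ is its single multiplicity. $\operatorname{Aut}^\otimes(Id_{\mathcal{A}})$ is the group of $\otimes$-automorphisms of the identity functor: families of automorphisms $F_M\in\operatorname{End}(M)$, natural in $M$, with $F_{M\otimes N}=F_M\otimes F_N$ (and $F_{\mathbf{1}}=1$). The zeta function of $M$ relative to $F$ is $Z_F(M,t)=\exp\left(\sum_{n\ge1}\operatorname{tr}(F_M^n)\frac{t^n}{n}\right)\in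 K[[t]]$; for $\mathcal{A}$ semi-simple of integral type it is in $K(t)$, and $\operatorname{ord}_{t=1}$ is the order of vanishing at $t=1$. For $S$ simple, $P_S(t)$ is the inverse minimum polynomial of $F_S$ over $K$, i.e. $P_S(t)=t^{m}p(t^{-1})$ with $p$ the monic minimal polynomial of $F_S$ over $K$ and $m=\deg p$. *)

(* Defs.v *)
From HB Require Import structures.
From mathcomp Require Import all_boot all_order all_algebra all_field.

Set Implicit Arguments.
Unset Strict Implicit.
Unset Printing Implicit Defensive.

Import GRing.Theory.
Local Open Scope ring_scope.

Declare Scope cat_scope.
Delimit Scope cat_scope with cat.
Local Open Scope cat_scope.

Reserved Notation "g ∘ f" (at level 40, left associativity).
Reserved Notation "M ⊗ N" (at level 30, right associativity).
Reserved Notation "f ⊠ g" (at level 30, right associativity).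

Record klin_category (K : fieldType) := KLinCategory {
  cat_obj :> Type;
  mor : cat_obj -> cat_obj -> lmodType K;
  idm : forall M, mor M M;
  mcomp : forall L M N, mor M N -> mor L M -> mor L N;
  compA : forall L M N P (h : mor N P) (g : mor M N) (f : mor L M),
    mcomp h (mcomp g f) = mcomp (mcomp h g) f;
  comp1m : forall M N (f : mor M N), mcomp (idm N) f = f;
  compm1 : forall M N (f : mor M N), mcomp f (idm M) = f;
  comp_linearl : forall L M N (f : mor L M),
    linear (fun g : mor M N => mcomp g f);
  comp_linearr : forall L M N (g : mor M N),
    linear (fun f : mor L M => mcomp g f)
}.

Arguments mor {K k} M N : rename.
Arguments idm {K k} M : rename.
Arguments mcomp {K k} {L M N} g f : rename.

Notation "g ∘ f" := (mcomp g f) : cat_scope.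

Record iso (K : fieldType) (C : klin_category K) (M N : C) := Iso {
  fwd :> mor M N;
  bwd : mor N M;
  bwdK : bwd ∘ fwd = idm M;
  fwdK : fwd ∘ bwd = idm N
}.

Definition isomorphic (K : fieldType) (C : klin_category K) (M N : C) : Prop :=
  inhabited (iso M N).

Definition is_iso (K : fieldType) (C : klin_category K) (M N : C)
    (f : mor M N) : Prop :=
  exists g : mor N M, g ∘ f = idm M /\ f ∘ g = idm N.

Definition is_mono (K : fieldType) (C : klin_category K) (M N : C)
    (f : mor M N) : Prop :=
  forall (L : C) (g h : mor L M), f ∘ g = f ∘ h -> g = h.

Definition zero_object (K : fieldType) (C : klin_category K) (Z : C) : Prop :=
  forall M : C, (forall f : mor Z M, f = 0) /\ (forall f : mor M Z, f = 0).

Definition biproduct (K : fieldType) (C : klin_category K) (M N B : C) : Prop :=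
  exists (i1 : mor M B) (i2 : mor N B) (p1 : mor B M) (p2 : mor B N),
    [/\ p1 ∘ i1 = idm M, p2 ∘ i2 = idm N, p1 ∘ i2 = 0, p2 ∘ i1 = 0
      & i1 ∘ p1 + i2 ∘ p2 = idm B].

Definition additive_category (K : fieldType) (C : klin_category K) : Prop :=
  (exists Z : C, zero_object Z) /\
  (forall M N : C, exists B : C, biproduct M N B).

Definition pseudo_abelian (K : fieldType) (C : klin_category K) : Prop :=
  forall (M : C) (e : mor M M), e ∘ e = e ->
    exists (N : C) (i : mor N M) (p : mor M N), p ∘ i = idm N /\ i ∘ p = e.

Definition simple_object (K : fieldType) (C : klin_category K) (S : C) : Prop :=
  idm S <> 0 /\
  forall (N : C) (i : mor N S), is_mono i -> i = 0 \/ is_iso i.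

Definition endo (K : fieldType) (C : klin_category K) (M : C) : Type :=
  mor M M.

(* [End(M)] is the zero ring when [M = 0], hence only a [pzRingType]; together
   with its [lmodType] structure this makes it a [K]-algebra, but not an
   [algType] of the library, which is nonzero by definition. *)
HB.instance Definition _ (K : fieldType) (C : klin_category K) (M : C) :=
  GRing.Lmodule.copy (endo M) (mor M M).

Lemma endo_compDl (K : fieldType) (C : klin_category K) (M : C) :
  left_distributive (fun g f : endo M => g ∘ f : endo M) +%R.
Proof.
move=> g h f; have := comp_linearl (f : mor M M) 1 g h.
by rewrite !scale1r.
Qed.

Lemma endo_compDr (K : fieldType) (C : klin_category K) (M : C) :
  right_distributive (fun g f : endo M => g ∘ f : endo M) +%R.
Proof.
move=> g f h; have := comp_linearr (g : mor M M) 1 f h.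
by rewrite !scale1r.
Qed.

HB.instance Definition _ (K : fieldType) (C : klin_category K) (M : C) :=
  GRing.Zmodule_isPzRing.Build (endo M)
    (fun h g f => compA (h : mor M M) g f)
    (fun f => comp1m (f : mor M M)) (fun f => compm1 (f : mor M M))
    (@endo_compDl K C M) (@endo_compDr K C M).

Definition left_ideal (R : pzRingType) (I : R -> Prop) : Prop :=
  [/\ I 0, (forall x y, I x -> I y -> I (x + y))
    & (forall a x, I x -> I (a * x))].

(* [R] is semi-simple as a left module over itself. *)
Definition semisimple_ring (R : pzRingType) : Prop :=
  forall I : R -> Prop, left_ideal I ->
    exists J : R -> Prop,
      [/\ left_ideal J, (forall x, I x -> J x -> x = 0)
        & (forall x, exists y z, [/\ I y, J z & x = y + z])].

Definition semisimple_category (K : fieldType) (C : klin_category K) : Prop :=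
  forall M : C, semisimple_ring (endo M).

Definition central (R : pzRingType) (z : R) : Prop :=
  forall x : R, z * x = x * z.

Record sym_monoidal_category (K : fieldType) := SymMonoidalCategory {
  mcat :> klin_category K;
  one_obj : mcat;
  tens : mcat -> mcat -> mcat
    where "M ⊗ N" := (tens M N);
  tensm : forall M M' N N' : mcat,
    mor M M' -> mor N N' -> mor (M ⊗ N) (M' ⊗ N')
    where "f ⊠ g" := (tensm f g);
  tensm1 : forall M N : mcat, idm M ⊠ idm N = idm (M ⊗ N);
  tensm_comp : forall (M M' M'' N N' N'' : mcat)
    (f' : mor M' M'') (f : mor M M') (g' : mor N' N'') (g : mor N N'),
    (f' ∘ f) ⊠ (g' ∘ g) = (f' ⊠ g') ∘ (f ⊠ g);
  tensm_linearl : forall (M M' N N' : mcat) (g : mor N N'),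
    linear (fun f : mor M M' => f ⊠ g);
  tensm_linearr : forall (M M' N N' : mcat) (f : mor M M'),
    linear (fun g : mor N N' => f ⊠ g);
  assoc : forall L M N : mcat, iso ((L ⊗ M) ⊗ N) (L ⊗ (M ⊗ N));
  assoc_nat : forall (L L' M M' N N' : mcat)
    (f : mor L L') (g : mor M M') (h : mor N N'),
    assoc L' M' N' ∘ ((f ⊠ g) ⊠ h) = (f ⊠ (g ⊠ h)) ∘ assoc L M N;
  lunit : forall M : mcat, iso (one_obj ⊗ M) M;
  lunit_nat : forall (M N : mcat) (f : mor M N),
    lunit N ∘ (idm one_obj ⊠ f) = f ∘ lunit M;
  runit : forall M : mcat, iso (M ⊗ one_obj) M;
  runit_nat : forall (M N : mcat) (f : mor M N),
    runit N ∘ (f ⊠ idm one_obj) = f ∘ runit M;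
  pentagon : forall L M N P : mcat,
    assoc L M (N ⊗ P) ∘ assoc (L ⊗ M) N P
    = (idm L ⊠ assoc M N P) ∘ assoc L (M ⊗ N) P ∘ (assoc L M N ⊠ idm P);
  triangle : forall M N : mcat,
    (idm M ⊠ lunit N) ∘ assoc M one_obj N = runit M ⊠ idm N;
  braid : forall M N : mcat, mor (M ⊗ N) (N ⊗ M);
  braid_nat : forall (M M' N N' : mcat) (f : mor M M') (g : mor N N'),
    braid M' N' ∘ (f ⊠ g) = (g ⊠ f) ∘ braid M N;
  braidK : forall M N : mcat, braid N M ∘ braid M N = idm (M ⊗ N);
  hexagon : forall L M N : mcat,
    assoc M N L ∘ braid L (M ⊗ N) ∘ assoc L M N
    = (idm M ⊠ braid L N) ∘ assoc M L N ∘ (braid L M ⊠ idm N)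
}.

Arguments one_obj {K} s.
Arguments tens {K s} M N.
Arguments tensm {K s M M' N N'} f g.
Arguments assoc {K s} L M N.
Arguments lunit {K s} M.
Arguments runit {K s} M.
Arguments braid {K s} M N.

Notation "M ⊗ N" := (tens M N) : cat_scope.
Notation "f ⊠ g" := (tensm f g) : cat_scope.

Record rigid_category (K : fieldType) := RigidCategory {
  rcat :> sym_monoidal_category K;
  rcat_additive : additive_category rcat;
  dual_obj : rcat -> rcat;
  ev : forall M : rcat, mor (dual_obj M ⊗ M) (one_obj rcat);
  coev : forall M : rcat, mor (one_obj rcat) (M ⊗ dual_obj M);
  zigzagl : forall M : rcat,
    runit M ∘ (idm M ⊠ ev M) ∘ assoc M (dual_obj M) M ∘ (coev M ⊠ idm M)
    = lunit M;
  zigzagr : forall M : rcat,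
    lunit (dual_obj M) ∘ (ev M ⊠ idm (dual_obj M)) ∘ bwd (assoc (dual_obj M) M (dual_obj M))
      ∘ (idm (dual_obj M) ⊠ coev M)
    = runit (dual_obj M);
  (* [End(1) = K]: the map [c |-> c *: id] is bijective, with this inverse. *)
  one_scalar : mor (one_obj rcat) (one_obj rcat) -> K;
  one_scalarK : cancel one_scalar (fun c => c *: idm (one_obj rcat));
  scale_oneK : cancel (fun c => c *: idm (one_obj rcat)) one_scalar
}.

Arguments dual_obj {K r} M : rename.
Arguments ev {K r} M : rename.
Arguments coev {K r} M : rename.
Arguments one_scalar {K r} f : rename.

Definition ctrace (K : fieldType) (C : rigid_category K) (M : C)
    (f : endo M) : K :=
  one_scalar (ev M ∘ braid M (dual_obj M) ∘ (f ⊠ idm (dual_obj M)) ∘ coev M).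

Definition simple_algebra (K : fieldType) (A : falgType K) : Prop :=
  forall I : {vspace A},
    ({:A} * I <= I)%VS -> (I * {:A} <= I)%VS -> I = 0%VS \/ I = {:A}%VS.

Definition center_alg (K : fieldType) (A : falgType K) : falgType K :=
  subvs_of (center_aspace {:A}%AS).

(* For [A] simple: an isomorphism [A ⊗_Z L ≅ M_n(L)] of [L]-algebras, where [L]
   is an extension of the field [Z = Z(A)]; it is given by the homomorphism
   [spl_rep : A -> M_n(L)] extending the inclusion of [Z] into [L].  The induced
   map on [A ⊗_Z L] is onto by [spl_span], and both sides have dimension
   [n ^ 2] over [L] by [spl_degree]. *)
Record splitting (K : fieldType) (A : falgType K) := Splitting {
  spl_field : fieldType;
  spl_incl : {rmorphism center_alg A -> spl_field};
  spl_deg : nat;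
  spl_rep : {rmorphism A -> 'M[spl_field]_spl_deg};
  spl_center : forall z : center_alg A,
    spl_rep (vsval z) = (spl_incl z)%:M;
  spl_degree : \dim {:A} = (spl_deg ^ 2 * \dim {:center_alg A})%N;
  spl_span : forall X : 'M[spl_field]_spl_deg,
    exists s : seq (spl_field * A), X = \sum_(x <- s) x.1 *: spl_rep x.2
}.

(* [t] is [Trd_{A/Z(A)}] *)
Definition is_central_Trd (K : fieldType) (A : falgType K)
    (t : A -> center_alg A) : Prop :=
  exists s : splitting A, forall a, spl_incl s (t a) = \tr (spl_rep s a).

(* [Tr_{B/K}]: the trace of the multiplication by [b]; below [B] is
   commutative. *)
Definition alg_trace (K : fieldType) (B : falgType K) (b : B) : K :=
  \tr (passmx.mxof (vbasis {:B}) (vbasis {:B}) (amull b)).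

(* [T] is [Trd_A = Tr_{Z(A)/K} \o Trd_{A/Z(A)}], for [A] simple *)
Definition is_Trd (K : fieldType) (A : falgType K) (T : A -> K) : Prop :=
  exists t : A -> center_alg A,
    is_central_Trd t /\ forall a, T a = alg_trace (t a).

(* An isomorphism of [K]-algebras from [End(M)] to a finite product of
   finite-dimensional simple [K]-algebras [A_i], given by its components. *)
Record wedderburn (K : fieldType) (C : klin_category K) (M : C) := Wedderburn {
  wed_num : nat;
  wed_alg : 'I_wed_num -> falgType K;
  wed_simple : forall i, simple_algebra (wed_alg i);
  wed_proj : forall i, {rmorphism endo M -> wed_alg i};
  wed_scal : forall i, scalable (wed_proj i);
  wed_inj : forall f : endo M, (forall i, wed_proj i f = 0) -> f = 0;
  wed_surj : forall a : (forall i, wed_alg i),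
    exists f : endo M, forall i, wed_proj i f = a i
}.

Arguments wed_alg {K C M} w i.
Arguments wed_proj {K C M} w i.

(* [tr(f) = Trd(mu f)] for all [f], where [Trd] is the sum of the [Trd_{A_i}] *)
Definition is_multiplicity (K : fieldType) (C : rigid_category K) (M : C)
    (w : wedderburn M) (mu : endo M) : Prop :=
  exists T : forall i, wed_alg w i -> K,
    (forall i, is_Trd (T i)) /\
    forall f : endo M, ctrace f = \sum_i T i (wed_proj w i (mu * f)).

(* The component [mu_i(M)] of [mu(M)] is the projection of [mu(M)] to [A_i]. *)
Definition integral_type (K : fieldType) (C : rigid_category K) : Prop :=
  forall M : C, exists (w : wedderburn M) (mu : endo M),
    is_multiplicity w mu /\
    forall i, exists m : int, wed_proj w i mu = m%:~R.

(* [mu(S) = m] *)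
Definition has_multiplicity (K : fieldType) (C : rigid_category K) (S : C)
    (m : int) : Prop :=
  exists w : wedderburn S, is_multiplicity w (m%:~R : endo S).

Record tensor_aut (K : fieldType) (C : sym_monoidal_category K) := TensorAut {
  taut :> forall M : C, endo M;
  taut_iso : forall M : C, is_iso (taut M);
  taut_nat : forall (M N : C) (f : mor M N), taut N ∘ f = f ∘ taut M;
  taut_tens : forall M N : C, taut (M ⊗ N) = taut M ⊠ taut N;
  taut_one : taut (one_obj C) = idm (one_obj C)
}.

(* Power series are given by their coefficients.  If [u 0 = 0], the coefficient
   of [t ^ n] in [exp(u) = \sum_k u ^ k / k!] involves only the terms with
   [k <= n] and the truncation of [u] to degree [n]. *)
Definition series_exp (K : fieldType) (u : nat -> K) (n : nat) : K :=
  (\sum_(k < n.+1) (k`!%:R)^-1 *: (\poly_(i < n.+1) u i) ^+ k)`_n.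

Definition zeta (K : fieldType) (C : rigid_category K) (F : tensor_aut C)
    (M : C) : nat -> K :=
  series_exp (fun n => if n == 0%N then 0 else ctrace (F M ^+ n) / n%:R).

(* The power series [u] is a nonzero rational function [p / q], with order [m]
   at [t = 1]. *)
Definition ord_at_one (K : fieldType) (u : nat -> K) (m : int) : Prop :=
  exists p q : {poly K},
    [/\ p != 0, q != 0,
        (forall n, \sum_(i < n.+1) q`_i * u (n - i)%N = p`_n)
      & m = (mup 1 p)%:Z - (mup 1 q)%:Z].

Definition has_dim (K : fieldType) (V : lmodType K) (d : nat) : Prop :=
  exists b : 'I_d -> V,
    forall v : V, exists! c : {ffun 'I_d -> K}, v = \sum_i c i *: b i.

Definition endo_horner (K : fieldType) (C : klin_category K) (M : C)
    (p : {poly K}) (f : endo M) : endo M :=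
  \sum_(i < size p) p`_i *: f ^+ i.

Definition generates_center (K : fieldType) (C : klin_category K) (M : C)
    (f : endo M) : Prop :=
  forall g : endo M, central g <-> exists p : {poly K}, g = endo_horner p f.

Definition is_min_poly (K : fieldType) (C : klin_category K) (M : C)
    (f : endo M) (p : {poly K}) : Prop :=
  [/\ p \is monic, endo_horner p f = 0
    & forall q : {poly K}, q != 0 -> endo_horner q f = 0 ->
        (size p <= size q)%N].

Definition reverse_poly (K : fieldType) (p : {poly K}) : {poly K} :=
  \poly_(i < size p) p`_((size p).-1 - i).

Definition is_inv_min_poly (K : fieldType) (C : klin_category K) (M : C)
    (f : endo M) (P : {poly K}) : Prop :=
  exists p : {poly K}, is_min_poly f p /\ P = reverse_poly p.

(* Main.v *)
Require Import Defs.
From HB Require Import structures.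
From Stdlib Require Import Classical ClassicalEpsilon.
From Stdlib Require List.
From mathcomp Require Import all_boot all_order all_algebra all_field.
From mathcomp Require Import ring.

Set Implicit Arguments.
Unset Strict Implicit.
Unset Printing Implicit Defensive.

Import GRing.Theory.
Local Open Scope ring_scope.
Local Open Scope cat_scope.
Local Notation compA := Defs.compA.

(** Everything rests on the trace of polynomials in [F] on a simple object [S].
    Let [p] be the minimal polynomial of [F S]; it is irreducible. As the category is
    of integral type, [tr(h(F S))] is a nonzero integer [c] times the sum of the
    values of [h] at the roots of [p] ([simple_data]). Therefore
    [Z(S, t) = P_S(t) ^ (-c)], and the order at [t = 1] only sees the simple objects
    on which [F] is the identity: this relates the first two conditions
    ([zeta_order_hom], [order_fixes_only_one]).

    Assume that [F] is the identity on no simple object but [1], and let [F S] and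
    [F T] have the same minimal polynomial [p]. The part of [S ⊗ D T] where [F = 1] is
    the image of an idempotent, obtained from the separability idempotent of
    [K[x] / (p)] by acting with [F S] on one factor and with the transpose of [F T] on
    the other ([invariant_projector]). Its trace is [cS cT deg p] because traces are
    multiplicative; its image is a sum of copies of [1], in number the dimension of
    [Hom(T, S)] ([hom_dim]). As this is not [0], [S] and [T] are isomorphic. If [T = S]
    and [c = m d r], with [m] the multiplicity, [d ^ 2] the dimension of [End(S)] over
    its centre and [r] the degree of the centre over [K[F S]], the identity becomes
    [m ^ 2 r = 1]: the multiplicity is [1] or [-1], and [K[F S]] is the centre
    ([simple_multiplicity]).

    Once minimal polynomials separate the simple objects, polynomials in [F] cut out
    the isotypic components by interpolation. So the traces of the powers of [F], that
    is the zeta function, determine the multiplicity of each simple object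
    ([same_traces_isomorphic]), and the centre of [End(M)], which acts on each
    isotypic component through the centre of a simple [End(S)], is generated by [F]
    ([fixes_only_one_tate]). Conversely, a fixed simple object is compared with [1] by
    means of zeta functions ([zeta_fixes_only_one]) or of the centre of
    [End(S ⊕ 1)] ([tate_fixes_only_one]).

    The trace identities used above are derived from the axioms of a rigid symmetric
    monoidal category in the first parts. *)

(** * Linear categories *)

Section Linear.
Variables (K : fieldType) (C : klin_category K).
Implicit Types L M N P : C.

Lemma compDl L M N (g h : mor M N) (f : mor L M) :
  (g + h) ∘ f = g ∘ f + h ∘ f.
Proof. by have := comp_linearl f 1 g h; rewrite !scale1r. Qed.

Lemma compDr L M N (g : mor M N) (f h : mor L M) :
  g ∘ (f + h) = g ∘ f + g ∘ h.
Proof. by have := comp_linearr g 1 f h; rewrite !scale1r. Qed.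

Lemma comp0m L M N (f : mor L M) : (0 : mor M N) ∘ f = 0.
Proof. by apply: (addrI (0 ∘ f)); rewrite -compDl !addr0. Qed.

Lemma compm0 L M N (g : mor M N) : g ∘ (0 : mor L M) = 0.
Proof. by apply: (addrI (g ∘ 0)); rewrite -compDr !addr0. Qed.

Lemma compZl L M N a (g : mor M N) (f : mor L M) :
  (a *: g) ∘ f = a *: (g ∘ f).
Proof. by have := comp_linearl f a g 0; rewrite comp0m !addr0. Qed.

Lemma compZr L M N a (g : mor M N) (f : mor L M) :
  g ∘ (a *: f) = a *: (g ∘ f).
Proof. by have := comp_linearr g a f 0; rewrite compm0 !addr0. Qed.

Lemma compNl L M N (g : mor M N) (f : mor L M) : (- g) ∘ f = - (g ∘ f).
Proof. by rewrite -scaleN1r compZl scaleN1r. Qed.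

Lemma compNr L M N (g : mor M N) (f : mor L M) : g ∘ (- f) = - (g ∘ f).
Proof. by rewrite -scaleN1r compZr scaleN1r. Qed.

Lemma comp_suml L M N (I : finType) (A : pred I) (g : I -> mor M N) (f : mor L M) :
  (\sum_(i | A i) g i) ∘ f = \sum_(i | A i) (g i ∘ f).
Proof.
exact: (big_morph (fun g => g ∘ f) (fun g h => compDl g h f) (comp0m _ f)).
Qed.

Lemma comp_sumr L M N (I : finType) (A : pred I) (g : mor M N) (f : I -> mor L M) :
  g ∘ (\sum_(i | A i) f i) = \sum_(i | A i) (g ∘ f i).
Proof.
exact: (big_morph (fun f => g ∘ f) (fun f h => compDr g f h) (compm0 _ g)).
Qed.

(** Composites are kept associated to the right; in this form an equation
    between composites rewrites inside a longer one. *)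
Lemma reassoc L M N P (a : mor N P) (b : mor M N) (c : mor M P)
  (e : a ∘ b = c) (x : mor L M) : a ∘ (b ∘ x) = c ∘ x.
Proof. by rewrite compA e. Qed.

Lemma reassoc2 L M M' N P (a : mor N P) (b : mor M N) (c : mor M' P) (d : mor M M')
  (e : a ∘ b = c ∘ d) (x : mor L M) : a ∘ (b ∘ x) = c ∘ (d ∘ x).
Proof. by rewrite compA e -compA. Qed.

Lemma iso_epi L M N (i : iso L M) (f g : mor M N) : f ∘ i = g ∘ i -> f = g.
Proof.
by move=> e; rewrite -[f]compm1 -[g]compm1 -(fwdK i) !compA e.
Qed.

Lemma iso_mono L M N (i : iso M N) (f g : mor L M) : i ∘ f = i ∘ g -> f = g.
Proof.
by move=> e; rewrite -[f]comp1m -[g]comp1m -(bwdK i) -!compA e.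
Qed.

Definition iso_sym M N (i : iso M N) : iso N M := Iso (fwdK i) (bwdK i).

Lemma iso_transl L M N (i : iso M N) (f : mor L M) (g : mor L N) :
  i ∘ f = g -> f = bwd i ∘ g.
Proof. by move<-; rewrite compA bwdK comp1m. Qed.

Lemma iso_transr L M N (i : iso M N) (f : mor N L) (g : mor M L) :
  f ∘ i = g -> f = g ∘ bwd i.
Proof. by move<-; rewrite -compA fwdK compm1. Qed.

Lemma isomorphic_sym M N : isomorphic M N -> isomorphic N M.
Proof. by case=> i; exists; apply: iso_sym. Qed.

Lemma isomorphic_trans M N P : isomorphic M N -> isomorphic N P -> isomorphic M P.
Proof.
move=> [i] [j]; exists; exists (j ∘ i) (bwd i ∘ bwd j).
  by rewrite -compA (reassoc (bwdK j)) comp1m bwdK.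
by rewrite -compA (reassoc (fwdK i)) comp1m fwdK.
Qed.

End Linear.

(** * Coherence of the units *)

Section Monoidal.
Variables (K : fieldType) (C : sym_monoidal_category K).
Implicit Types L M N P X Y : C.
Local Notation U := (one_obj C).
Local Notation id := idm.

Lemma tensm_l M M' M'' N (f' : mor M' M'') (f : mor M M') :
  (f' ∘ f) ⊠ id N = (f' ⊠ id N) ∘ (f ⊠ id N).
Proof. by rewrite -tensm_comp comp1m. Qed.

Lemma tensm_r M N N' N'' (f' : mor N' N'') (f : mor N N') :
  id M ⊠ (f' ∘ f) = (id M ⊠ f') ∘ (id M ⊠ f).
Proof. by rewrite -tensm_comp comp1m. Qed.

Lemma tensm_lr M M' N N' (f : mor M M') (g : mor N N') :
  (f ⊠ id N') ∘ (id M ⊠ g) = f ⊠ g.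
Proof. by rewrite -tensm_comp comp1m compm1. Qed.

Lemma tensm_rl M M' N N' (f : mor M M') (g : mor N N') :
  (id M' ⊠ g) ∘ (f ⊠ id N) = f ⊠ g.
Proof. by rewrite -tensm_comp comp1m compm1. Qed.

Lemma tensm_swap M M' N N' (f : mor M M') (g : mor N N') :
  (f ⊠ id N') ∘ (id M ⊠ g) = (id M' ⊠ g) ∘ (f ⊠ id N).
Proof. by rewrite tensm_lr tensm_rl. Qed.

Lemma tensDl M M' N N' (f f' : mor M M') (g : mor N N') :
  (f + f') ⊠ g = f ⊠ g + f' ⊠ g.
Proof. by have := tensm_linearl g 1 f f'; rewrite !scale1r. Qed.

Lemma tens0l M M' N N' (g : mor N N') : (0 : mor M M') ⊠ g = 0.
Proof. by apply: (addrI (0 ⊠ g)); rewrite -tensDl !addr0. Qed.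

Lemma tensZl M M' N N' a (f : mor M M') (g : mor N N') :
  (a *: f) ⊠ g = a *: (f ⊠ g).
Proof. by have := tensm_linearl g a f 0; rewrite tens0l !addr0. Qed.

Lemma tensDr M M' N N' (f : mor M M') (g g' : mor N N') :
  f ⊠ (g + g') = f ⊠ g + f ⊠ g'.
Proof. by have := tensm_linearr f 1 g g'; rewrite !scale1r. Qed.

Lemma tens0r M M' N N' (f : mor M M') : f ⊠ (0 : mor N N') = 0.
Proof. by apply: (addrI (f ⊠ 0)); rewrite -tensDr !addr0. Qed.

Lemma tensZr M M' N N' a (f : mor M M') (g : mor N N') :
  f ⊠ (a *: g) = a *: (f ⊠ g).
Proof. by have := tensm_linearr f a g 0; rewrite tens0r !addr0. Qed.

Lemma lunit_inj M N (f g : mor M N) : id U ⊠ f = id U ⊠ g -> f = g.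
Proof.
by move=> e; apply: (@iso_epi _ _ _ _ _ (lunit M)); rewrite -!lunit_nat e.
Qed.

Lemma runit_inj M N (f g : mor M N) : f ⊠ id U = g ⊠ id U -> f = g.
Proof.
by move=> e; apply: (@iso_epi _ _ _ _ _ (runit M)); rewrite -!runit_nat e.
Qed.

Lemma lunitV_nat M N (f : mor M N) :
  bwd (lunit N) ∘ f = (id U ⊠ f) ∘ bwd (lunit M).
Proof.
apply: esym; apply: iso_transl; rewrite compA lunit_nat -compA fwdK compm1 //.
Qed.

Lemma runitV_nat M N (f : mor M N) :
  bwd (runit N) ∘ f = (f ⊠ id U) ∘ bwd (runit M).
Proof.
apply: esym; apply: iso_transl; rewrite compA runit_nat -compA fwdK compm1 //.
Qed.

Lemma assocV_nat L L' M M' N N' (f : mor L L') (g : mor M M') (h : mor N N') :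
  bwd (assoc L' M' N') ∘ (f ⊠ (g ⊠ h)) = ((f ⊠ g) ⊠ h) ∘ bwd (assoc L M N).
Proof.
apply: esym; apply: iso_transl; rewrite compA assoc_nat -compA fwdK compm1 //.
Qed.

Definition tens_iso M M' N N' (i : iso M M') (j : iso N N') : iso (M ⊗ N) (M' ⊗ N').
Proof.
exists (i ⊠ j) (bwd i ⊠ bwd j); by rewrite -tensm_comp ?bwdK ?fwdK tensm1.
Defined.

Definition id_iso M : iso M M := Iso (comp1m (id M)) (comp1m (id M)).

(** Kelly's derivation of the unit triangles from the middle one: after
    tensoring on the left with the unit, both sides are read off the pentagon. *)
Lemma lunit_tens M N : lunit (M ⊗ N) ∘ assoc U M N = lunit M ⊠ id N.
Proof.
have pent := pentagon U U M N; rewrite -!compA in pent.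
apply: lunit_inj; rewrite tensm_r.
apply: (@iso_epi _ _ _ _ _ (assoc U (U ⊗ M) N)).
apply: (@iso_epi _ _ _ _ _ (tens_iso (assoc U U M) (id_iso N))) => /=.
rewrite -!compA -pent (reassoc (triangle _ _)). rewrite (reassoc2 (esym (assoc_nat _ _ _))).
by rewrite -tensm_l triangle assoc_nat tensm1.
Qed.

Lemma runit_tens M N : (id M ⊠ runit N) ∘ assoc M N U = runit (M ⊗ N).
Proof.
have pent := pentagon M N U U; rewrite -!compA in pent.
apply: runit_inj; rewrite tensm_l.
apply: (@iso_mono _ _ _ _ _ (assoc M N U)).
rewrite (reassoc2 (assoc_nat _ _ _)) -[in LHS]triangle tensm_r -!compA -pent.
by rewrite (reassoc2 (esym (assoc_nat _ _ _))) tensm1 triangle.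
Qed.

Lemma lunit_runit1 : lunit U = runit U :> mor _ _.
Proof.
have e : lunit (U ⊗ U) = id U ⊠ lunit U :> mor _ _.
  by apply: (@iso_mono _ _ _ _ _ (lunit U)); rewrite lunit_nat.
apply: runit_inj; rewrite -lunit_tens e triangle //.
Qed.

Lemma lunitV_runitV1 : bwd (lunit U) = bwd (runit U).
Proof.
rewrite -[bwd (runit _)]comp1m -(bwdK (lunit U)) -compA.
by rewrite lunit_runit1 fwdK compm1.
Qed.

(** With [θ] defined by [lunit ∘ braid = θ ∘ runit], the hexagon on [M], [1], [1]
    says that [braid ∘ (runit ⊠ id)] is unchanged by [id ⊠ θ], so [θ] is trivial. *)
Lemma lunit_braid M : lunit M ∘ braid M U = runit M.
Proof.
pose th := lunit M ∘ braid M U ∘ bwd (runit M).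
have thE : lunit M ∘ braid M U = th ∘ runit M.
  by rewrite /th -!compA bwdK compm1.
rewrite thE; suff -> : th = id M by rewrite comp1m.
apply: lunit_inj; rewrite tensm1.
have h := hexagon M U U.
have [biso bisoE] : exists i : iso (M ⊗ U) (U ⊗ M), fwd i = braid M U.
  by exists (Iso (braidK M U) (braidK U M)).
apply: (@iso_epi _ _ _ _ _ biso).
apply: (@iso_epi _ _ _ _ _ (tens_iso (runit M) (id_iso U))) => /=.
rewrite bisoE comp1m -!compA.
have rE : runit (M ⊗ U) = runit M ⊠ id U :> mor _ _.
  apply: (@iso_mono _ _ _ _ _ (runit M)); rewrite runit_nat //.
have s1 : braid M U ∘ (runit M ⊠ id U)
          = (id U ⊠ runit M) ∘ assoc U M U ∘ (braid M U ⊠ id U).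
  by rewrite runit_tens runit_nat rE.
rewrite [in LHS]s1 !compA -tensm_r -thE tensm_r.
rewrite -!compA [X in _ ∘ X]compA -h.
rewrite !compA triangle.
rewrite (_ : runit U ⊠ id M = lunit U ⊠ id M); last by rewrite lunit_runit1.
by rewrite -braid_nat -compA triangle.
Qed.

Lemma runit_braid M : runit M ∘ braid U M = lunit M.
Proof. by rewrite -lunit_braid -compA braidK compm1. Qed.

End Monoidal.

Section PentagonVariants.
Variables (K : fieldType) (C : sym_monoidal_category K).
Local Notation id := idm.
Implicit Types L M N P : C.

(** The three rearrangements of the pentagon met when straightening a zigzag. *)
Lemma pentagon_r L M N P :
  (id L ⊠ assoc M N P) ∘ assoc L (M ⊗ N) P
  = assoc L M (N ⊗ P) ∘ (assoc (L ⊗ M) N P ∘ (bwd (assoc L M N) ⊠ id P)).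
Proof.
apply: (@iso_epi _ _ _ _ _ (tens_iso (assoc L M N) (id_iso P))) => /=.
rewrite -pentagon -!compA -tensm_l bwdK tensm1 compm1 //.
Qed.

Lemma pentagon_l L M N P :
  (assoc L M N ⊠ id P) ∘ bwd (assoc (L ⊗ M) N P)
  = bwd (assoc L (M ⊗ N) P) ∘ ((id L ⊠ bwd (assoc M N P)) ∘ assoc L M (N ⊗ P)).
Proof.
apply: (@iso_mono _ _ _ _ _ (assoc L (M ⊗ N) P)).
apply: (@iso_mono _ _ _ _ _ (tens_iso (id_iso L) (assoc M N P))) => /=.
apply: (@iso_epi _ _ _ _ _ (assoc (L ⊗ M) N P)).
rewrite -!compA bwdK compm1 (reassoc (fwdK _)) comp1m.
by rewrite [RHS]compA -tensm_r fwdK tensm1 comp1m compA -pentagon.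
Qed.

Lemma pentagon_c L M N P :
  (id L ⊠ bwd (assoc M N P)) ∘ assoc L M (N ⊗ P)
  = assoc L (M ⊗ N) P ∘ ((assoc L M N ⊠ id P) ∘ bwd (assoc (L ⊗ M) N P)).
Proof. by rewrite pentagon_l (reassoc (fwdK _)) comp1m. Qed.

End PentagonVariants.

(** * Duality and the trace *)

Section Duality.
Variables (K : fieldType) (C : rigid_category K).
Local Notation U := (one_obj C).
Local Notation id := idm.
Local Notation D := dual_obj.
Implicit Types L M N P S T X Y : C.

Lemma zigl M : runit M ∘ ((id M ⊠ ev M) ∘ (assoc M (D M) M ∘ (coev M ⊠ id M)))
  = lunit M.
Proof. by rewrite -zigzagl -!compA. Qed.

Lemma zigr M : lunit (D M) ∘ ((ev M ⊠ id (D M)) ∘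
    (bwd (assoc (D M) M (D M)) ∘ (id (D M) ⊠ coev M))) = runit (D M).
Proof. by rewrite -zigzagr -!compA. Qed.

Lemma zigl_id M : runit M ∘ ((id M ⊠ ev M) ∘ (assoc M (D M) M ∘
    ((coev M ⊠ id M) ∘ bwd (lunit M)))) = id M.
Proof. by apply: esym; rewrite -[LHS](fwdK (lunit M)) -zigl -!compA. Qed.

Lemma zigr_id M : lunit (D M) ∘ ((ev M ⊠ id (D M)) ∘
    (bwd (assoc (D M) M (D M)) ∘ ((id (D M) ⊠ coev M) ∘ bwd (runit (D M))))) = id (D M).
Proof. by apply: esym; rewrite -[LHS](fwdK (runit (D M))) -zigr -!compA. Qed.

Definition unbend S T (u : mor U (S ⊗ D T)) : mor T S :=
  runit S ∘ ((id S ⊠ ev T) ∘ (assoc S (D T) T ∘ ((u ⊠ id T) ∘ bwd (lunit T)))).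

(** Sliding the coevaluation of [T] past [u], the pentagon and the unit
    triangles bring out [id S ⊠ zigzag]. *)
Lemma unbendK S T (u : mor U (S ⊗ D T)) : (unbend u ⊠ id (D T)) ∘ coev T = u.
Proof.
rewrite /unbend !tensm_l -!compA.
have -> : (bwd (lunit T) ⊠ id (D T)) ∘ coev T
   = bwd (assoc U T (D T)) ∘ ((id U ⊠ coev T) ∘ bwd (lunit U)).
  apply: (@iso_mono _ _ _ _ _ (tens_iso (lunit T) (id_iso (D T)))) => /=.
  rewrite compA -tensm_l fwdK tensm1 comp1m.
  rewrite -lunit_tens -!compA (reassoc (fwdK _)) comp1m.
  by rewrite (reassoc2 (lunit_nat _)) fwdK compm1.
rewrite (reassoc2 (esym (assocV_nat _ _ _))) tensm1 (reassoc2 (tensm_swap _ _)).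
rewrite lunitV_runitV1 -runitV_nat (reassoc2 (pentagon_l _ _ _ _)).
rewrite -!compA (reassoc2 (esym (assocV_nat _ _ _))).
have -> : forall X (x : mor X _), (runit S ⊠ id (D T)) ∘ (bwd (assoc S U (D T)) ∘ x)
    = (id S ⊠ lunit (D T)) ∘ x.
  by move=> X x; rewrite -triangle -!compA (reassoc (fwdK _)) comp1m.
rewrite -(tensm1 S (D T)) (reassoc2 (assoc_nat _ _ _)).
have -> : forall X (x : mor X _),
  assoc S (D T) U ∘ (bwd (runit (S ⊗ D T)) ∘ x) = (id S ⊠ bwd (runit (D T))) ∘ x.
  move=> X x; apply: (@iso_mono _ _ _ _ _ (tens_iso (id_iso S) (runit (D T)))) => /=.
  by rewrite (reassoc (runit_tens _ _)) (reassoc (fwdK _)) compA -tensm_r fwdK tensm1.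
rewrite !compA -!tensm_r -!compA.
by rewrite zigr_id tensm1 comp1m.
Qed.

(** Same argument for morphisms into [1]; the preimage is [w] with its first
    input bent up. *)
Lemma ev_onto S T (w : mor (D T ⊗ S) U) : exists g : mor S T, ev T ∘ (id (D T) ⊠ g) = w.
Proof.
exists (runit T ∘ ((id T ⊠ w) ∘ (assoc T (D T) S ∘ ((coev T ⊠ id S) ∘ bwd (lunit S))))).
rewrite !tensm_r.
have -> : id (D T) ⊠ bwd (lunit S) = assoc (D T) U S ∘ (bwd (runit (D T)) ⊠ id S).
  apply: (@iso_mono _ _ _ _ _ (tens_iso (id_iso (D T)) (lunit S))) => /=.
  rewrite -tensm_r fwdK tensm1 compA triangle -tensm_l fwdK tensm1 //.
rewrite (reassoc2 (esym (assoc_nat _ _ _))) (reassoc2 (pentagon_r _ _ _ _)).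
rewrite -!compA (reassoc2 (esym (assoc_nat _ _ _))) (reassoc (runit_tens _ _)).
rewrite (reassoc2 (esym (runit_nat _))).
rewrite tensm1 (reassoc2 (tensm_swap _ _)).
rewrite -(tensm1 (D T) S) (reassoc2 (esym (assoc_nat _ _ _))).
rewrite -lunit_runit1 (reassoc2 (lunit_nat _)) (reassoc (lunit_tens _ _)).
rewrite -!tensm_l.
by rewrite zigr_id tensm1 compm1.
Qed.

Lemma coev_onto N Y (u : mor U (N ⊗ Y)) : exists k : mor (D N) Y, (id N ⊠ k) ∘ coev N = u.
Proof.
exists (lunit Y ∘ ((ev N ⊠ id Y) ∘ (bwd (assoc (D N) N Y) ∘ ((id (D N) ⊠ u) ∘ bwd (runit (D N)))))).
rewrite !tensm_r -!compA.
have -> : (id N ⊠ bwd (runit (D N))) ∘ coev N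
    = assoc N (D N) U ∘ ((coev N ⊠ id U) ∘ bwd (runit U)).
  apply: (@iso_mono _ _ _ _ _ (tens_iso (id_iso N) (runit (D N)))) => /=.
  rewrite compA -tensm_r fwdK tensm1 comp1m.
  by rewrite (reassoc (runit_tens _ _)) (reassoc2 (runit_nat _)) fwdK compm1.
rewrite (reassoc2 (esym (assoc_nat _ _ _))) tensm1 (reassoc2 (esym (tensm_swap _ _))).
rewrite -lunitV_runitV1 -lunitV_nat (reassoc2 (pentagon_c _ _ _ _)) -!compA.
rewrite -(tensm1 N Y) (reassoc2 (assocV_nat _ _ _)).
rewrite (reassoc2 (esym (assoc_nat _ _ _))) (reassoc (triangle _ _)).
have -> : forall X (x : mor X _), bwd (assoc U N Y) ∘ (bwd (lunit (N ⊗ Y)) ∘ x)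
   = (bwd (lunit N) ⊠ id Y) ∘ x.
  move=> X x; apply: (@iso_mono _ _ _ _ _ (tens_iso (lunit N) (id_iso Y))) => /=.
  rewrite [RHS]compA -tensm_l fwdK tensm1 comp1m -lunit_tens -!compA.
  by rewrite (reassoc (fwdK _)) comp1m (reassoc (fwdK _)) comp1m.
rewrite !compA -!tensm_l -!compA.
by rewrite zigl_id tensm1 comp1m.
Qed.

Lemma unbend_coev S T (f : mor T S) : unbend ((f ⊠ id (D T)) ∘ coev T) = f.
Proof.
rewrite /unbend tensm_l -!compA (reassoc2 (assoc_nat _ _ _)) tensm1.
rewrite (reassoc2 (esym (tensm_swap _ _))) (reassoc2 (runit_nat _)).
by rewrite zigl_id compm1.
Qed.

(** The transpose is defined by its compatibility with coevaluations; the one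
    with evaluations follows, because both sides bend to [f]. *)
Lemma transpose_exists M N (f : mor M N) : exists k : mor (D N) (D M),
  (id N ⊠ k) ∘ coev N = (f ⊠ id (D M)) ∘ coev M /\
  ev M ∘ (k ⊠ id M) = ev N ∘ (id (D N) ⊠ f).
Proof.
have [k kE] := coev_onto ((f ⊠ id (D M)) ∘ coev M); exists k; split=> //.
have [g gE] := ev_onto (ev M ∘ (k ⊠ id M)).
suff <- : g = f by rewrite gE.
have := congr1 (@unbend N M) kE; rewrite unbend_coev => <-.
rewrite /unbend tensm_l -!compA (reassoc2 (assoc_nat _ _ _)).
rewrite [in RHS](compA (id N ⊠ ev M)) -tensm_r -gE tensm_r -!compA.
rewrite -(reassoc2 (assoc_nat _ _ _)) tensm1 (reassoc2 (esym (tensm_swap _ _))).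
rewrite -lunitV_nat.
by apply: esym; have := congr1 (fun x => x ∘ g) (zigl_id N); rewrite comp1m -!compA.
Qed.

Lemma scale_id_inj : injective (fun c => c *: id U).
Proof. exact: can_inj (@scale_oneK _ C). Qed.

Lemma one_scalarE (f : mor U U) : one_scalar f *: id U = f.
Proof. exact: one_scalarK. Qed.

Lemma one_scalarZ c : one_scalar (c *: id U) = c.
Proof. exact: (@scale_oneK _ C). Qed.

Lemma ctraceE M (f : endo M) :
  ev M ∘ (braid M (D M) ∘ ((f ⊠ id (D M)) ∘ coev M)) = ctrace f *: id U.
Proof. by rewrite one_scalarE -!compA. Qed.

Lemma ctrace_eq M (f : endo M) c :
  ev M ∘ (braid M (D M) ∘ ((f ⊠ id (D M)) ∘ coev M)) = c *: id U -> ctrace f = c.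
Proof. by rewrite ctraceE => /scale_id_inj. Qed.

Lemma ctraceD M (f g : endo M) : ctrace (f + g) = ctrace f + ctrace g.
Proof.
by apply: ctrace_eq; rewrite tensDl compDl !compDr !ctraceE scalerDl.
Qed.

Lemma ctraceZ M c (f : endo M) : ctrace (c *: f) = c * ctrace f.
Proof. by apply: ctrace_eq; rewrite tensZl compZl !compZr !ctraceE scalerA. Qed.

Lemma ctrace0 M : ctrace (0 : endo M) = 0.
Proof. by rewrite -[0 in LHS](scale0r (0 : endo M)) ctraceZ mul0r. Qed.

Lemma ctrace_sum M (I : Type) (r : seq I) (A : pred I) (f : I -> endo M) :
  ctrace (\sum_(i <- r | A i) f i) = \sum_(i <- r | A i) ctrace (f i).
Proof. exact: (big_morph _ (@ctraceD M) (@ctrace0 M)). Qed.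

Lemma ctraceC M N (f : mor M N) (g : mor N M) :
  ctrace (g ∘ f : endo M) = ctrace (f ∘ g : endo N).
Proof.
have [k [kc ke]] := transpose_exists f.
apply: ctrace_eq; rewrite tensm_l -!compA -kc (reassoc2 (tensm_swap _ _)).
rewrite (reassoc2 (braid_nat _ _)) (reassoc ke) -!compA.
rewrite -(reassoc2 (braid_nat _ _)) (compA (f ⊠ _)) -tensm_l ctraceE //.
Qed.

(** The zigzag identity for [1], whose dual need not be [1], reduces to the
    composite [1 -> D 1 -> 1] whose value is the trace. *)
Lemma ctrace_one : ctrace (id U : endo U) = 1.
Proof.
apply: ctrace_eq; rewrite tensm1 comp1m scale1r.
have -> : coev U = bwd (lunit (D U)) ∘ (lunit (D U) ∘ coev U).
  by rewrite compA bwdK comp1m.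
rewrite -{1}(compm1 (ev U)) -(bwdK (runit (D U))) -!compA.
rewrite (reassoc (runit_braid _)) (reassoc (fwdK _)) comp1m.
set c := lunit (D U) ∘ coev U.
set e := ev U ∘ bwd (runit (D U)).
have eE : ev U = e ∘ runit (D U) by rewrite /e -compA bwdK compm1.
have cE : coev U = bwd (lunit (D U)) ∘ c by rewrite /c compA bwdK comp1m.
have := zigl_id U; rewrite eE cE tensm_r tensm_l -!compA.
rewrite (reassoc (runit_tens _ _)).
rewrite (reassoc2 (runit_nat _)) (reassoc2 (runit_nat _)).
rewrite (reassoc2 (esym (lunitV_nat _))) -lunit_runit1 fwdK compm1.
by rewrite !(reassoc (fwdK _)) !comp1m /e -compA.
Qed.

(** [D S] is also a dual of [S] on the other side, through the symmetry: the
    hexagon, used twice, carries the strand [S] across the pair and turns this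
    identity into the given zigzag. *)
Lemma braided_zigzag S : lunit S ∘ (((ev S ∘ braid S (D S)) ⊠ id S) ∘
   (bwd (assoc S (D S) S) ∘ ((id S ⊠ (braid S (D S) ∘ coev S)) ∘ bwd (runit S)))) = id S.
Proof.
have hex1 := hexagon S (D S) S;
have e1 : (braid S (D S) ⊠ id S) ∘ bwd (assoc S (D S) S) =
  bwd (assoc (D S) S S) ∘ ((id (D S) ⊠ braid S S) ∘ (assoc (D S) S S ∘ braid S (D S ⊗ S))).
  apply: esym; apply: iso_transr; rewrite -compA; apply: esym; apply: iso_transl.
  apply: (@iso_mono _ _ _ _ _ (tens_iso (id_iso (D S)) (Iso (braidK S S) (braidK S S)))) => /=.
  rewrite -!compA in hex1 *.
  by rewrite -hex1 [RHS]compA -tensm_r braidK tensm1 comp1m.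
rewrite tensm_l -!compA (reassoc2 e1) -!compA.
rewrite (reassoc2 (braid_nat _ _)) tensm_l -!compA.
have hex2 : forall X (x : mor X _), (id (D S) ⊠ braid S S) ∘ (assoc (D S) S S ∘
    ((braid S (D S) ⊠ id S) ∘ x)) = assoc (D S) S S ∘ (braid S (D S ⊗ S) ∘
    (assoc S (D S) S ∘ x)).
  by move=> X x; rewrite !compA hex1.
rewrite hex2 (reassoc (bwdK _)) comp1m -(reassoc2 (braid_nat _ _)).
rewrite (reassoc (lunit_braid _)).
transitivity (lunit S ∘ (braid S U ∘ bwd (runit S))).
  by rewrite -zigl -!compA.
by rewrite (reassoc (lunit_braid _)) fwdK.
Qed.

(** The partial trace, which closes the strand [D T]. *)
Definition ptr S T (h : endo (S ⊗ D T)) : endo S :=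
  runit S ∘ ((id S ⊠ ev T) ∘ (assoc S (D T) T ∘ ((h ⊠ id T) ∘
  (bwd (assoc S (D T) T) ∘ ((id S ⊠ (braid T (D T) ∘ coev T)) ∘ bwd (runit S)))))).

Lemma ptrD S T (h h' : endo (S ⊗ D T)) : ptr (h + h') = ptr h + ptr h'.
Proof. by rewrite /ptr tensDl compDl !compDr. Qed.

Lemma ptrZ S T c (h : endo (S ⊗ D T)) : ptr (c *: h) = c *: ptr h.
Proof. by rewrite /ptr tensZl compZl !compZr. Qed.

Lemma ptr_tens S T (a : endo S) (b : endo T) (k : endo (D T)) :
  ev T ∘ (k ⊠ id T) = ev T ∘ (id (D T) ⊠ b) ->
  ptr (a ⊠ k) = ctrace b *: a.
Proof.
move=> kE; rewrite /ptr (reassoc2 (assoc_nat _ _ _)) (reassoc (fwdK _)) comp1m.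
rewrite -[a ⊠ (k ⊠ id T)]tensm_lr -!compA (reassoc2 (esym (tensm_swap _ _))).
rewrite (reassoc2 (runit_nat _)).
have -> : (id S ⊠ ev T) ∘ ((id S ⊠ (k ⊠ id T)) ∘ ((id S ⊠ (braid T (D T) ∘ coev T)) ∘
  bwd (runit S))) = ctrace b *: bwd (runit S).
  rewrite !compA -!tensm_r kE -!compA -(reassoc2 (braid_nat _ _)) ctraceE.
  by rewrite tensZr tensm1 compZl comp1m.
by rewrite !compZr fwdK compm1.
Qed.

(** The diagram straightens by one zigzag and one braided zigzag. *)
Lemma ptr_rank1 S T (f : mor T S) (g : mor S T) :
  ptr (((f ⊠ id (D T)) ∘ coev T) ∘ (ev T ∘ (braid T (D T) ∘ (g ⊠ id (D T))))) = f ∘ g.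
Proof.
rewrite /ptr (compA (ev T)) !tensm_l -!compA.
rewrite -(reassoc2 (assocV_nat _ _ _)) tensm1 (reassoc2 (tensm_swap _ _)) -runitV_nat.
rewrite (reassoc2 (assoc_nat _ _ _)) tensm1 (reassoc2 (esym (tensm_swap _ _))).
rewrite (reassoc2 (runit_nat _)) (compA (braid T (D T) ⊠ id T)).
have -> : forall X (x : mor X _), runit T ∘ ((id T ⊠ ev T) ∘ (assoc T (D T) T ∘
  ((coev T ⊠ id T) ∘ x))) = lunit T ∘ x by move=> X x; rewrite -zigl -!compA.
have := congr1 (fun x => x ∘ g) (braided_zigzag T).
by rewrite tensm_l comp1m -!compA => ->.
Qed.

(** The trace of [S ⊗ D T], computed strand by strand: it is multiplicative by
    construction, and does not involve the dual chosen for [S ⊗ D T]. *)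
Definition tau S T (h : endo (S ⊗ D T)) : K := ctrace (ptr h).

Lemma tau_tens S T (a : endo S) (b : endo T) (k : endo (D T)) :
  ev T ∘ (k ⊠ id T) = ev T ∘ (id (D T) ⊠ b) ->
  tau (a ⊠ k) = ctrace a * ctrace b.
Proof. by move=> kE; rewrite /tau (ptr_tens a kE) ctraceZ mulrC. Qed.

Lemma tauD S T (h h' : endo (S ⊗ D T)) : tau (h + h') = tau h + tau h'.
Proof. by rewrite /tau ptrD ctraceD. Qed.

Lemma tauZ S T c (h : endo (S ⊗ D T)) : tau (c *: h) = c * tau h.
Proof. by rewrite /tau ptrZ ctraceZ. Qed.

Lemma tau0 S T : tau (0 : endo (S ⊗ D T)) = 0.
Proof. by rewrite -[0 in LHS](scale0r (0 : endo _)) tauZ mul0r. Qed.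

Lemma tau_sum S T (I : Type) (r : seq I) (A : pred I) (h : I -> endo (S ⊗ D T)) :
  tau (\sum_(i <- r | A i) h i) = \sum_(i <- r | A i) tau (h i).
Proof. exact: (big_morph _ (@tauD S T) (@tau0 S T)). Qed.

Lemma form_onto S T (v : mor (S ⊗ D T) U) :
  exists g : mor S T, ev T ∘ (braid T (D T) ∘ (g ⊠ id (D T))) = v.
Proof.
have [g gE] := ev_onto (v ∘ braid (D T) S); exists g.
by rewrite braid_nat compA gE -compA braidK compm1.
Qed.

(** So [tau] counts the copies of [1] in the image of an idempotent. *)
Lemma tau_rank1 S T (u : mor U (S ⊗ D T)) (v : mor (S ⊗ D T) U) :
  tau (u ∘ v) = one_scalar (v ∘ u).
Proof.
have [g <-] := form_onto v; rewrite -(unbendK u) /tau ptr_rank1.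
rewrite (ctraceC g (unbend u)); apply: scale_id_inj => /=.
by rewrite !one_scalarE tensm_l -!compA.
Qed.

End Duality.

(** * Semi-simple categories *)

(** Decompose [1] along [R = R a + J]; the component in [R a] is [r a]. *)
Lemma semisimple_regular (R : pzRingType) : semisimple_ring R ->
  forall a : R, exists r, a * r * a = a.
Proof.
move=> ss a.
have [|J [[_ JD JM] IJ0 sp]] := ss (fun x => exists r, x = r * a).
  split=> [|x y [r ->] [r' ->]|b x [r ->]]; first by exists 0; rewrite mul0r.
    by exists (r + r'); rewrite mulrDl.
  by exists (b * r); rewrite mulrA.
have [_ [z [[r ->] Jz e]]] := sp 1.
exists r; apply/eqP; rewrite -subr_eq0 -mulrA; apply/eqP; apply: oppr_inj.
rewrite oppr0 opprB -{1}[a]mulr1 -mulrBr e addrAC subrr add0r.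
apply: IJ0; last exact: JM.
have -> : z = 1 - r * a by rewrite e addrAC subrr add0r.
by exists (1 - a * r); rewrite mulrBr mulrBl mulr1 mul1r mulrA.
Qed.

Section Semisimple.
Variables (K : fieldType) (C : klin_category K).
Hypotheses (C_add : additive_category C) (C_ss : semisimple_category C).
Hypothesis C_psab : pseudo_abelian C.
Implicit Types L M N P S T : C.

Lemma biproduct_sym M N B : @biproduct K C M N B -> biproduct N M B.
Proof.
by move=> [i] [j] [p] [q] [? ? ? ? e]; exists j, i, q, p; split; rewrite // addrC.
Qed.

(** Von Neumann regularity of [End(M ⊕ N)], read on one corner. It makes every
    monomorphism and every epimorphism split. *)
Lemma mor_regular M N (f : mor M N) : exists g, f ∘ g ∘ f = f.
Proof.
have [B [i [j [p [q [pi qj _ _ _]]]]]] := C_add.2 M N.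
have [r rE] := semisimple_regular (@C_ss B) (j ∘ f ∘ p : endo B).
exists (p ∘ r ∘ j).
have {}rE : (j ∘ f ∘ p) ∘ r ∘ (j ∘ f ∘ p) = j ∘ f ∘ p by [].
have := congr1 (fun x => q ∘ x ∘ i) rE; rewrite !compA qj !comp1m.
by rewrite -!compA pi !compm1 !compA.
Qed.

Lemma complement S N (i : mor S N) (p : mor N S) : p ∘ i = idm S ->
  exists N' (j : mor N' N) (q : mor N N'),
    [/\ q ∘ j = idm N', p ∘ j = 0, q ∘ i = 0 & i ∘ p + j ∘ q = idm N].
Proof.
move=> pi; have [|N' [j [q [qj jq]]]] := C_psab (e := idm N - i ∘ p).
  rewrite compDl !compDr !comp1m compm1 !compNl !compNr.
  by rewrite -!compA (reassoc pi) comp1m opprK addNr addr0.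
exists N', j, q; split=> //; last by rewrite jq addrC subrK.
  rewrite -[j]compm1 -qj !compA -(compA p) jq compDr compm1 compNr.
  by rewrite (reassoc pi) comp1m subrr comp0m.
rewrite -[q]comp1m -qj -compA -compA (reassoc jq) compDl comp1m compNl.
by rewrite -compA pi compm1 subrr compm0.
Qed.

Lemma complement_biproduct S N (i : mor S N) (p : mor N S) : p ∘ i = idm S ->
  exists N', biproduct S N' N.
Proof.
by move=> pi; have [N' [j [q [? ? ? ?]]]] := complement pi; exists N', i, j, p, q.
Qed.

Lemma simple_idem S (e : mor S S) : simple_object S -> e ∘ e = e ->
  e = 0 \/ e = idm S.
Proof.
move=> [_ Ss] /C_psab [N [i [p [pi <-]]]].
have [|->|[r [ri ir]]] := Ss N i.
- by move=> L g h e1; rewrite -[g]comp1m -[h]comp1m -pi -!compA e1.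
- by left; rewrite comp0m.
right; rewrite -[RHS]ir; congr (_ ∘ _).
by rewrite -[p]compm1 -ir compA pi comp1m.
Qed.

Lemma indecomposable_simple S : idm S <> 0 ->
  (forall e : mor S S, e ∘ e = e -> e = 0 \/ e = idm S) -> simple_object S.
Proof.
move=> S0 Se; split=> // N i i_mono.
have [j ij] := mor_regular i.
have ji : j ∘ i = idm N by apply: i_mono; rewrite compm1 compA.
case: (Se (i ∘ j)) => [|e|e]; first by rewrite compA ij.
  by left; rewrite -ij e comp0m.
by right; exists j.
Qed.

Lemma simple_mono S M (f : mor S M) : simple_object S -> f <> 0 ->
  exists g, g ∘ f = idm S.
Proof.
move=> Ss f0; have [g fgf] := mor_regular f; exists g.
have [|e|//] := simple_idem Ss (e := g ∘ f); first by rewrite -compA (compA f) fgf.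
by case: f0; rewrite -fgf -compA e compm0.
Qed.

Lemma simple_epi S M (f : mor M S) : simple_object S -> f <> 0 ->
  exists g, f ∘ g = idm S.
Proof.
move=> Ss f0; have [g fgf] := mor_regular f; exists g.
have [|e|//] := simple_idem Ss (e := f ∘ g); first by rewrite compA fgf.
by case: f0; rewrite -fgf e comp0m.
Qed.

Lemma schur S T (f : mor S T) : simple_object S -> simple_object T -> f <> 0 ->
  exists i : iso S T, fwd i = f.
Proof.
move=> Ss Ts f0; have [g gf] := simple_mono Ss f0; have [h fh] := simple_epi Ts f0.
have e : g = h by rewrite -[g]compm1 -fh compA gf comp1m.
by rewrite -e in fh; exists (Iso gf fh).
Qed.

Lemma schur_iso S T (f : mor S T) : simple_object S -> simple_object T -> f <> 0 ->
  isomorphic S T.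
Proof. by move=> Ss Ts /(schur Ss Ts) [i _]; exists. Qed.

Lemma iso_neq0 S T (i : iso S T) : idm S <> 0 -> fwd i <> 0.
Proof. by move=> S0 e; case: S0; rewrite -(bwdK i) e compm0. Qed.

(** A bound on the length of [M], through the number of its nonzero orthogonal
    idempotents; it needs no decomposition of [M] to be stated. *)
Definition length_lt n M := forall e : 'I_n -> endo M,
  (forall k, e k <> 0) -> (forall k, e k * e k = e k) ->
  (forall k l, k != l -> e k * e l = 0) -> False.

Lemma length_summand n S N' N : biproduct S N' N -> idm S <> 0 ->
  length_lt n.+1 N -> length_lt n N'.
Proof.
move=> [i [j [p [q [pi qj pj qi ijE]]]]] S0 Nn e e0 ee eo.
have ji L (x : mor L S) : q ∘ (i ∘ x) = 0 by rewrite (reassoc qi) comp0m.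
have ij L (x : mor L N') : p ∘ (j ∘ x) = 0 by rewrite (reassoc pj) comp0m.
pose e' (k : 'I_n.+1) : endo N :=
  if unlift ord0 k is Some l then j ∘ (e l ∘ q) else i ∘ p.
have {}ee k : (e k ∘ e k : mor N' N') = e k := ee k.
have {}eo k l (kl : k != l) : (e k ∘ e l : mor N' N') = 0 := eo k l kl.
apply: (Nn e') => [k|k|k l].
- rewrite /e'; case: unliftP => [l _|_] e1.
    case: (e0 l); have := congr1 (fun x => q ∘ x ∘ j) e1.
    by rewrite compm0 comp0m -!compA qj compm1 (reassoc qj) comp1m.
  case: S0; have := congr1 (fun x => p ∘ x ∘ i) e1.
  by rewrite compm0 comp0m -!compA pi compm1 pi.
- rewrite /e' /GRing.mul /=; case: unliftP => [l _|_].
    by rewrite -!compA (reassoc qj) comp1m (compA (e l)) ee.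
  by rewrite -!compA (reassoc pi) comp1m.
rewrite /e' /GRing.mul /=; case: unliftP => [k' ->|->]; case: unliftP => [l' ->|->].
- rewrite (inj_eq lift_inj) => kl.
  rewrite -!compA (reassoc qj) comp1m (compA (e k')) (eo _ _ kl).
  by rewrite comp0m compm0.
- by rewrite -!compA ji !compm0.
- by rewrite -!compA ij compm0.
by rewrite eqxx.
Qed.

(** Finite direct sums of simple objects, as binary trees, so that additive
    properties are proved by induction. *)
Inductive decomposable : C -> Prop :=
| decomposable_zero M of idm M = 0 : decomposable M
| decomposable_simple S of simple_object S : decomposable S
| decomposable_sum M N B of biproduct M N B & decomposable M & decomposable N :
    decomposable B.

(** An object without non trivial idempotents is simple; the others split, and
    the length of both summands is smaller. *)
Lemma length_decomposable n M : length_lt n M -> decomposable M.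
Proof.
elim: n M => [|n IHn] M Mn; first by exfalso; apply: (Mn (fun => 0)) => -[].
have [M0|M0] := classic (idm M = 0); first exact: decomposable_zero.
have [Me|Me] := classic (forall e : mor M M, e ∘ e = e -> e = 0 \/ e = idm M).
  exact/decomposable_simple/indecomposable_simple.
have [e Me'] := not_all_ex_not _ _ Me.
have [ee e01] := imply_to_and _ _ Me'; have [e0 e1] := not_or_and _ _ e01.
have [N [i [p [pi ip]]]] := C_psab ee.
have [N' [j [q [qj pj qi ijE]]]] := complement pi.
have bp : biproduct N N' M by exists i, j, p, q.
apply: (decomposable_sum bp); apply: IHn.
  apply: (length_summand (biproduct_sym bp)) Mn => N'0; apply: e1.
  by rewrite -ijE -[j]compm1 N'0 compm0 comp0m addr0.
by apply: (length_summand bp) Mn => N0; apply: e0; rewrite -ip -[i]compm1 N0 compm0 comp0m.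
Qed.

Lemma simple_summand M : decomposable M -> idm M <> 0 ->
  exists S (i : mor S M) (p : mor M S), simple_object S /\ p ∘ i = idm S.
Proof.
elim=> {M} [M //|S Ss _|M N B [i [j [p [q [pi qj pj qi ijE]]]]] _ IHM _ IHN B0].
  by exists S, (idm S), (idm S); split=> //; rewrite comp1m.
have [M0|M0] := classic (idm M = 0); last first.
  have [S [i' [p' [Ss pi']]]] := IHM M0.
  exists S, (i ∘ i'), (p' ∘ p); split=> //.
  by rewrite -compA (reassoc pi) comp1m.
have [N0|N0] := classic (idm N = 0).
  case: B0; rewrite -ijE -[i]compm1 M0 compm0 comp0m add0r.
  by rewrite -[j]compm1 N0 compm0 comp0m.
have [S [i' [p' [Ss pi']]]] := IHN N0.
exists S, (j ∘ i'), (p' ∘ q); split=> //.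
by rewrite -compA (reassoc qj) comp1m.
Qed.

(** For [s] take the simple summands of [M]. *)
Lemma simple_detect M : decomposable M -> exists s : seq C,
  (forall S, List.In S s -> simple_object S) /\
  forall N (f g : mor M N),
   (forall S (x : mor S M), List.In S s -> f ∘ x = g ∘ x) -> f = g.
Proof.
elim=> {M} [M M0|S Ss|M N B [i [j [p [q [pi qj pj qi ijE]]]]] _ [s [sS sE]] _ [t [tS tE]]].
- exists [::]; split=> // N f g _.
  by rewrite -[f]compm1 -[g]compm1 M0 !compm0.
- exists [:: S]; split=> [T [<-|]//|N f g e].
  by rewrite -[f]compm1 -[g]compm1; apply: e; left.
exists (s ++ t); split=> [S /(@List.in_app_or _ _ _ _) [/sS|/tS]|L f g e] //.
have ei : f ∘ i = g ∘ i.
  apply: sE => S x xs; rewrite -!compA; apply: e.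
  by apply: List.in_or_app; left.
have ej : f ∘ j = g ∘ j.
  apply: tE => S x xs; rewrite -!compA; apply: e.
  by apply: List.in_or_app; right.
by rewrite -[f]compm1 -[g]compm1 -ijE !compDr !compA ei ej.
Qed.

End Semisimple.

Section Length.
Variables (K : fieldType) (C : klin_category K) (M : C).

(** Nonzero orthogonal idempotents are linearly independent. *)
Lemma orthogonal_idem_bound (A : falgType K) n (P : pred 'I_n) (e : 'I_n -> A) :
  (forall k, P k -> e k != 0) -> (forall k, e k * e k = e k) ->
  (forall k l, k != l -> e k * e l = 0) -> (#|P| <= \dim {:A})%N.
Proof.
move=> e0 ee eo; pose X := [tuple of [seq e k | k <- enum P]].
have Xs : size X = #|P| by rewrite size_map -cardE.
suff fX : free X by rewrite -Xs -(eqP fX) dimvS // subvf.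
have Xn (i : 'I_#|P|) : X`_i = e (enum_val i).
  by rewrite (nth_map (enum_default i)) // -cardE.
apply/freeP => c c0 i.
have Pi : P (enum_val i) := enum_valP i.
have := congr1 (fun x => x * e (enum_val i)) c0; rewrite mul0r mulr_suml (bigD1 i) //=.
rewrite big1 => [|j ji].
  rewrite addr0 Xn -scalerAl ee => /eqP; rewrite scaler_eq0 (negPf (e0 _ Pi)) orbF.
  by move/eqP.
by rewrite Xn -scalerAl eo ?scaler0 // (inj_eq enum_val_inj).
Qed.

Lemma wedderburn_length (w : wedderburn M) :
  length_lt (\sum_i \dim {: wed_alg w i}).+1 M.
Proof.
set n := _.+1 => e e0 ee eo.
have eP k : exists i, wed_proj w i (e k) != 0.
  apply/existsP; apply: contra_notT (e0 k); rewrite negb_exists => /forallP h.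
  by apply: (@wed_inj _ _ _ w) => i; apply/eqP; rewrite -[_ == _]negbK.
have le1 : (n <= \sum_i #|[pred k | wed_proj w i (e k) != 0%R]|)%N.
  have nE : (\sum_(k < n) 1 = n)%N by rewrite sum1_card card_ord.
  rewrite -[X in (X <= _)%N]nE.
  under [X in (_ <= X)%N]eq_bigr => i _ do rewrite -sum1_card big_mkcond /=.
  rewrite exchange_big /=; apply: leq_sum => k _.
  by have [i ik] := eP k; rewrite (bigD1 i) //= inE ik.
suff le2 : (\sum_i #|[pred k | wed_proj w i (e k) != 0%R]| <= \sum_i \dim {: wed_alg w i})%N.
  by have := leq_trans le1 le2; rewrite ltnn.
apply: leq_sum => i _; apply: (@orthogonal_idem_bound _ _ _ (fun k => wed_proj w i (e k))).
- by [].
- by move=> k; rewrite -rmorphM ee.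
by move=> k l kl; rewrite -rmorphM eo // rmorph0.
Qed.

End Length.

(** * Irreducible polynomials and traces *)

Section PolyTools.
Variable F : fieldType.
Implicit Types p q h : {poly F}.

Lemma coprime_irreducible p q : irreducible_poly p -> irreducible_poly q ->
  p \is monic -> q \is monic -> p != q -> coprimep p q.
Proof.
move=> [sp pi] [sq qi] pm qm; apply: contraNT => nco.
have dp : gcdp p q %= p by apply: pi (dvdp_gcdl _ _).
have dq : gcdp p q %= q by apply: qi (dvdp_gcdr _ _).
rewrite -eqp_monic //; apply: eqp_trans dq; by rewrite eqp_sym.
Qed.

Lemma irreducible_coprime p q : irreducible_poly p -> ~~ (p %| q) -> coprimep p q.
Proof.
move=> [sp pi]; apply: contraNT => nco.
have dp : gcdp p q %= p by apply: pi (dvdp_gcdl _ _).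
by rewrite -(eqp_dvdl _ dp) dvdp_gcdr.
Qed.

Lemma irreducible_factor p : (1 < size p)%N -> exists2 q, irreducible_poly q & q %| p.
Proof.
have [n] := ubnP (size p); elim: n p => // n IHn p pn p1.
have [pi|npi] := classic (irreducible_poly p); first by exists p.
have [q [q1 qp nqp]] : exists q, [/\ size q != 1%N, q %| p & ~~ (q %= p)].
  apply: NNPP => nq; apply: npi; split=> // q q1 qp.
  by case: (boolP (q %= p)) => // nqp; case: nq; exists q.
have p0 : p != 0 by rewrite -size_poly_gt0; apply: leq_trans p1.
have q0 : q != 0 by apply: contraTneq qp => ->; rewrite dvd0p.
have qlt : (size q < size p)%N.
  rewrite ltn_neqAle (dvdp_leq p0 qp) andbT.
  by apply: contra nqp => e; rewrite -(dvdp_size_eqp qp).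
have [||r ri rq] := IHn q; first exact: leq_trans qlt pn.
  by rewrite ltn_neqAle eq_sym q1 size_poly_gt0.
by exists r => //; apply: dvdp_trans qp.
Qed.

(** Interpolation modulo coprime polynomials. *)
Lemma crt_idempotent p q : coprimep p q -> exists h, (p %| h - 1) && (q %| h).
Proof.
move=> /Bezout_eq1_coprimepP [[u v] /= uv]; exists (v * q).
rewrite dvdp_mull ?dvdpp // andbT -uv opprD addrCA subrr addr0.
by rewrite -mulNr dvdp_mull ?dvdpp.
Qed.

Lemma inverse_mod p q : coprimep p q -> exists h, p %| q * h - 1.
Proof.
move=> /crt_idempotent [h /andP [h1 /dvdpP [v hE]]]; exists v.
by rewrite mulrC -hE.
Qed.

End PolyTools.

(** Adjoin a root of an irreducible factor, divide by the linear factor, and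
    repeat over the larger field. *)
Lemma splitting_exists (F : fieldType) (p : {poly F}) : p != 0 ->
  exists (L : fieldType) (iota : {rmorphism F -> L}) (rs : seq L),
    map_poly iota p %= \prod_(a <- rs) ('X - a%:P).
Proof.
have [n] := ubnP (size p); elim: n F p => // n IHn F p pn p0.
have [p1|p1] := leqP (size p) 1.
  exists F, idfun, [::]; rewrite big_nil map_poly_id // -size_poly_eq1.
  by rewrite eqn_leq p1 size_poly_gt0.
have [q qi qp] := irreducible_factor p1.
have [L _ [z qz _]] := irredp_FAdjoin qi.
have pz : root (map_poly (in_alg L) p) z.
  by move: qz; rewrite -!dvdp_XsubCl => /dvdp_trans; apply; rewrite dvdp_map.
have [r pE] : exists r, map_poly (in_alg L) p = r * ('X - z%:P) by apply/factor_theorem.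
have r0 : r != 0.
  by apply: contra_neq p0 => r0; apply/eqP; rewrite -(map_poly_eq0 (in_alg L)) pE r0 mul0r.
have [|M [j [rs rE]]] := IHn L r _ r0.
  have sE : size (map_poly (in_alg L) p) = size (r * ('X - z%:P)) by rewrite pE.
  by move: sE; rewrite size_map_poly size_Mmonic ?monicXsubC // size_XsubC addn2 /= => <-.
exists M, (j \o in_alg L), (j z :: rs).
rewrite big_cons mulrC map_poly_comp pE rmorphM /= map_polyXsubC.
exact: eqp_mulr.
Qed.

Lemma irreducible_separable (F : fieldType) (p : {poly F}) : [pchar F] =i pred0 ->
  irreducible_poly p -> coprimep p p^`().
Proof.
move=> F0 pi; have p1 := pi.1; apply: irreducible_coprime => //.
have p0 : p != 0 by rewrite -size_poly_gt0; apply: leq_trans p1.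
have d0 : p^`() != 0.
  apply/eqP => /(congr1 (fun q : {poly F} => q`_(size p).-2)).
  rewrite coef_deriv coef0 prednK; last by rewrite -ltnS prednK // ltnW.
  apply/eqP; rewrite -mulr_natr mulf_neq0 //; first by rewrite -/(lead_coef p) lead_coef_eq0.
  by rewrite ((pcharf0P F).1 F0) -lt0n -ltnS prednK // ltnW.
by apply: contraL (lt_size_deriv p0) => /(dvdp_leq d0); rewrite -leqNgt.
Qed.

Lemma irreducible_split (F : fieldType) (p : {poly F}) : [pchar F] =i pred0 ->
  irreducible_poly p -> p \is monic ->
  exists (L : fieldType) (iota : {rmorphism F -> L}) (rs : seq L),
    map_poly iota p = \prod_(a <- rs) ('X - a%:P) /\ uniq rs.
Proof.
move=> F0 pi pm.
have [L [iota [rs]]] := splitting_exists (monic_neq0 pm).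
rewrite eqp_monic ?map_monic ?monic_prod_XsubC // => /eqP pE.
exists L, iota, rs; split=> //.
rewrite -separable_prod_XsubC -pE separable_map separable_poly.unlock.
exact: irreducible_separable.
Qed.

Section MatrixTrace.
Variables (K L : fieldType) (iota : {rmorphism K -> L}).
Variables (p : {poly K}) (rs : seq L).
Hypotheses (p_irr : irreducible_poly p) (p_monic : p \is monic).
Hypotheses (pE : map_poly iota p = \prod_(a <- rs) ('X - a%:P)) (rs_uniq : uniq rs).

Lemma size_roots : size rs = (size p).-1.
Proof. by rewrite -(size_map_poly iota p) pE size_prod_XsubC. Qed.

(** A common root with the irreducible polynomial [p] forces divisibility by
    [p]; divide and repeat. *)
Lemma power_of_irreducible (q : {poly K}) (ds : seq L) : q \is monic ->
  map_poly iota q = \prod_(a <- ds) ('X - a%:P) -> {subset ds <= rs} ->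
  exists r, q = p ^+ r.
Proof.
have [n] := ubnP (size q); elim: n q ds => // n IHn q ds qn qm qE dsr.
case: ds qE dsr => [|d ds] qE dsr.
  exists 0%N; apply: (map_poly_inj iota); rewrite qE big_nil expr0 rmorph1 //.
have pq : p %| q.
  apply: contraT => /(irreducible_coprime p_irr).
  rewrite -(coprimep_map iota) => co.
  have : root (map_poly iota p) d by rewrite pE root_prod_XsubC dsr ?mem_head.
  move/(coprimep_root co).
  by rewrite qE big_cons hornerM hornerXsubC subrr mul0r eqxx.
have [u uE] := dvdpP _ _ pq.
have um : u \is monic by rewrite -(monicMr _ p_monic) -uE.
have pL : map_poly iota q = map_poly iota u * map_poly iota p by rewrite uE rmorphM.
have [es esE] : exists es, map_poly iota u = \prod_(a <- es) ('X - a%:P).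
  have : map_poly iota u %| \prod_(a <- d :: ds) ('X - a%:P) by rewrite -qE pL dvdp_mulr.
  case/dvdp_prod_XsubC => m; rewrite eqp_monic ?map_monic ?monic_prod_XsubC //.
  by move/eqP ->; eexists.
have [|//||r rE] := IHn u es _ _ esE.
- rewrite -ltnS; apply: leq_trans qn; rewrite ltnS uE size_Mmonic ?monic_neq0 //.
  by move: p_irr.1; case: (size p) => [|[|m]] // _; rewrite !addnS ltnS leq_addr.
- move=> x xe; apply: dsr; rewrite -root_prod_XsubC -qE pL rootM esE.
  by rewrite root_prod_XsubC xe.
by exists r.+1; rewrite uE rE exprSr.
Qed.

Lemma horner_mx_sum (R : comNzRingType) n (A : 'M[R]_n.+1) (h : {poly R}) :
  horner_mx A h = \sum_(i < size h) h`_i *: A ^+ i.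
Proof.
rewrite -[h in LHS]coefK poly_def linear_sum; apply: eq_bigr => i _.
by rewrite linearZ /= rmorphXn /= horner_mx_X.
Qed.

Lemma char_poly_conj (F : fieldType) n (P A : 'M[F]_n) : P \in unitmx ->
  char_poly (invmx P *m A *m P) = char_poly A.
Proof.
move=> Pu; rewrite /char_poly.
have -> : char_poly_mx (invmx P *m A *m P)
    = map_mx polyC (invmx P) *m char_poly_mx A *m map_mx polyC P.
  rewrite /char_poly_mx mulmxBr mulmxBl !map_mxM; congr (_ - _).
  by rewrite scalar_mxC -mulmxA -map_mxM mulVmx // map_mx1 mulmx1.
rewrite !det_mulmx mulrAC -det_mulmx -map_mxM mulVmx // map_mx1 det1 mul1r //.
Qed.

(** Over an extension splitting [p] the matrix is diagonalizable, and its
    characteristic polynomial, having its roots among those of [p], is [p ^ r]: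
    all the roots of [p] are eigenvalues with the same multiplicity [r]. *)
Lemma trace_horner_mx n (A : 'M[K]_n.+1) : horner_mx A p = 0 ->
  exists r, (n.+1 = r * (size p).-1)%N /\ forall h,
    iota (\tr (horner_mx A h)) = r%:R * \sum_(a <- rs) (map_poly iota h).[a].
Proof.
move=> Ap; pose B := map_mx iota A.
have Bp : horner_mx B (map_poly iota p) = 0 by rewrite -map_horner_mx Ap map_mx0.
have [P Pu /(diagonalizable_forLR Pu) [d dE]] : diagonalizable B.
  apply/diagonalizableP; exists rs => //; rewrite -pE.
  exact: mxminpoly_min.
have {}dE : B = invmx P *m diag_mx d *m P by rewrite dE mxpoly.conjVmx.
have tr_h h : iota (\tr (horner_mx A h)) = \sum_i (map_poly iota h).[d 0 i].
  rewrite -trace_map_mx map_horner_mx -/B dE horner_mx_uconjC //.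
  rewrite mxtrace_mulC mulmxA mulmxV // mul1mx horner_mx_diag mxtrace_diag.
  by apply: eq_bigr => i _; rewrite mxE.
pose ds := [seq d 0 i | i <- enum 'I_n.+1].
have cE : map_poly iota (char_poly A) = \prod_(a <- ds) ('X - a%:P).
  rewrite map_char_poly -/B dE char_poly_conj // char_poly_trig ?diag_mx_is_trig //.
  rewrite big_map big_enum; apply: eq_bigr => i _.
  by rewrite mxE eqxx.
have dsr : {subset ds <= rs}.
  move=> _ /mapP [i _ ->]; rewrite -root_prod_XsubC -pE /root.
  have /matrixP /(_ i i) : horner_mx (diag_mx d) (map_poly iota p) = 0.
    have := Bp; rewrite dE horner_mx_uconjC // => /(congr1 (fun M => P *m M *m invmx P)).
    by rewrite !mulmxA mulmxV // mul1mx -mulmxA mulmxV // mulmx1 mulmx0 mul0mx.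
  by rewrite horner_mx_diag !mxE eqxx mulr1n => ->.
have [r rE] := power_of_irreducible (char_poly_monic A) cE dsr.
exists r; split.
  by have := congr1 predn (size_char_poly A); rewrite rE size_exp mulnC.
move=> h; rewrite tr_h.
have -> : \sum_i (map_poly iota h).[d 0 i] = \sum_(a <- ds) (map_poly iota h).[a].
  by rewrite big_map big_enum.
have pds : perm_eq ds (flatten (nseq r rs)).
  apply/prod_XsubC_eq; rewrite -cE rE rmorphXn /= pE big_flatten /= big_nseq.
  by rewrite -Monoid.iteropE.
rewrite (perm_big _ pds) /= big_flatten /= big_nseq iter_addr_0.
by rewrite mulr_natl.
Qed.

End MatrixTrace.

(** * Polynomials in an endomorphism *)

Section EndoHorner.
Variables (K : fieldType) (C : klin_category K).
Implicit Types (M N : C) (p q h : {poly K}).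

Lemma endo_scaleAl M a (f g : endo M) : a *: (f * g) = (a *: f) * g.
Proof. exact: esym (compZl a f g). Qed.

Lemma endo_scaleAr M a (f g : endo M) : a *: (f * g) = f * (a *: g).
Proof. exact: esym (compZr a f g). Qed.

Lemma endo_horner_wide M (f : endo M) p n : (size p <= n)%N ->
  endo_horner p f = \sum_(i < n) p`_i *: f ^+ i.
Proof.
move=> pn; rewrite /endo_horner (big_ord_widen n (fun i => p`_i *: f ^+ i) pn).
rewrite big_mkcond; apply: eq_bigr => i _; case: ltnP => // ip.
by rewrite nth_default // scale0r.
Qed.

Lemma endo_hornerD M (f : endo M) p q :
  endo_horner (p + q) f = endo_horner p f + endo_horner q f.
Proof.
pose n := maxn (size p) (size q).
rewrite (endo_horner_wide f (size_polyD p q)) -/n.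
rewrite (@endo_horner_wide _ f p n) ?leq_maxl // (@endo_horner_wide _ f q n) ?leq_maxr //.
by rewrite -big_split; apply: eq_bigr => i _; rewrite coefD scalerDl.
Qed.

Lemma endo_hornerZ M (f : endo M) a p : endo_horner (a *: p) f = a *: endo_horner p f.
Proof.
rewrite (endo_horner_wide f (size_scale_leq a p)) /endo_horner scaler_sumr.
by apply: eq_bigr => i _; rewrite coefZ scalerA.
Qed.

Lemma endo_horner0 M (f : endo M) : endo_horner 0 f = 0.
Proof. by rewrite /endo_horner size_poly0 big_ord0. Qed.

Lemma endo_hornerB M (f : endo M) p q :
  endo_horner (p - q) f = endo_horner p f - endo_horner q f.
Proof. by rewrite -scaleN1r endo_hornerD endo_hornerZ scaleN1r. Qed.

Lemma endo_horner_sum M (f : endo M) (I : Type) (r : seq I) (A : pred I) (p : I -> {poly K}) :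
  endo_horner (\sum_(i <- r | A i) p i) f = \sum_(i <- r | A i) endo_horner (p i) f.
Proof. exact: (big_morph _ (endo_hornerD f) (endo_horner0 f)). Qed.

Lemma endo_hornerXn M (f : endo M) n : endo_horner 'X^n f = f ^+ n.
Proof.
rewrite /endo_horner size_polyXn (bigD1 ord_max) //= coefXn eqxx scale1r.
rewrite big1 ?addr0 // => i ni; rewrite coefXn (_ : _ == _ = false) ?scale0r //.
by apply: contraNF ni => /eqP e; apply/eqP/val_inj.
Qed.

Lemma endo_horner1 M (f : endo M) : endo_horner 1 f = 1.
Proof. by rewrite -(expr0 'X) endo_hornerXn expr0. Qed.

Lemma endo_hornerX M (f : endo M) : endo_horner 'X f = f.
Proof. by rewrite -(expr1 'X) endo_hornerXn expr1. Qed.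

Lemma endo_hornerM M (f : endo M) p q :
  endo_horner (p * q) f = endo_horner p f * endo_horner q f.
Proof.
rewrite -[p]coefK -[q in LHS]coefK !poly_def mulr_suml !endo_horner_sum mulr_suml.
apply: eq_bigr => i _; rewrite mulr_sumr endo_horner_sum mulr_sumr.
apply: eq_bigr => j _.
rewrite -scalerAl -scalerAr -exprD !endo_hornerZ !endo_hornerXn exprD.
by rewrite -endo_scaleAl -endo_scaleAr.
Qed.

Lemma endo_horner_dvd M (f : endo M) p q : p %| q ->
  endo_horner p f = 0 -> endo_horner q f = 0.
Proof. by case/dvdpP => u -> p0; rewrite endo_hornerM p0 mulr0. Qed.

Lemma endo_horner_comm M (f g : endo M) h :
  f * g = g * f -> f * endo_horner h g = endo_horner h g * f.
Proof.
move=> fg; rewrite /endo_horner mulr_sumr mulr_suml; apply: eq_bigr => i _.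
by rewrite -endo_scaleAl -endo_scaleAr (commrX i fg).
Qed.

Lemma endo_horner_nat M N (f : endo M) (g : endo N) (x : mor M N) h :
  (g : mor N N) ∘ x = x ∘ f ->
  (endo_horner h g : mor N N) ∘ x = x ∘ (endo_horner h f : mor M M).
Proof.
move=> e; rewrite comp_suml comp_sumr; apply: eq_bigr => i _.
rewrite compZl compZr; congr (_ *: _).
elim: (i : nat) => [|n IHn]; first by rewrite !expr0 comp1m compm1.
rewrite !exprS /GRing.mul /=.
by rewrite -compA IHn compA e -compA.
Qed.

Lemma endo_horner_morph M (A : falgType K) (phi : {rmorphism endo M -> A}) f h :
  scalable phi -> phi (endo_horner h f) = \sum_(i < size h) h`_i *: phi f ^+ i.
Proof.
move=> phiZ; rewrite /endo_horner rmorph_sum; apply: eq_bigr => i _.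
by rewrite phiZ rmorphXn.
Qed.

End EndoHorner.

(** * Simple objects *)

Section AlgTrace.
Variables (K : fieldType) (B : falgType K) (z : B).
Implicit Type h : {poly K}.

Definition alg_eval h : B := \sum_(i < size h) h`_i *: z ^+ i.

Let mat (b : B) := passmx.mxof (vbasis {:B}) (vbasis {:B}) (amull b).

Lemma mxof_amullX n : mat (z ^+ n) = mat z ^+ n.
Proof.
elim: n => [|n IHn].
  by rewrite !expr0 /mat amull1 passmx.mxof1 ?(basis_free (vbasisP _)).
rewrite exprS exprSr -IHn /mat.
have -> : amull (z * z ^+ n) = (amull z \o amull (z ^+ n))%VF.
  by apply/lfunP => v; rewrite comp_lfunE !lfunE /= mulrA.
by rewrite (@passmx.mxof_comp _ _ _ _ _ (vbasis {:B}) _ (vbasisP _)).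
Qed.

Lemma mxof_amull_lin a u v : mat (a *: u + v) = a *: mat u + mat v.
Proof. by rewrite /mat linearP passmx.mxof_linear. Qed.

Lemma mxof_amullD u v : mat (u + v) = mat u + mat v.
Proof. by rewrite -[u in LHS]scale1r mxof_amull_lin scale1r. Qed.

Lemma mxof_amull0 : mat 0 = 0.
Proof. by apply: (addrI (mat 0)); rewrite -mxof_amullD !addr0. Qed.

Lemma mxof_amullZ a u : mat (a *: u) = a *: mat u.
Proof. by rewrite -[a *: u]addr0 mxof_amull_lin mxof_amull0 addr0. Qed.

Lemma mxof_amull_eval h : mat (alg_eval h) = \sum_(i < size h) h`_i *: mat z ^+ i.
Proof.
rewrite /alg_eval (big_morph _ mxof_amullD mxof_amull0); apply: eq_bigr => i _.
by rewrite mxof_amullZ mxof_amullX.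
Qed.

Lemma mxof_amull_eq0 b : mat b = 0 -> b = 0.
Proof.
move/eqP; rewrite (passmx.mxof_eq0 (vbasisP _) (vbasisP _)) => /eqP e.
by apply: amull_inj; rewrite e linear0.
Qed.

End AlgTrace.

Lemma matrix_minimal_poly (K : fieldType) n (A : 'M[K]_n) : (0 < n)%N ->
  exists p : {poly K}, p \is monic /\
    forall h : {poly K}, \sum_(i < size h) h`_i *: A ^+ i = 0 <-> p %| h.
Proof.
case: n A => // n A _; exists (mxminpoly A); split; first exact: mxminpoly_monic.
by move=> h; rewrite -horner_mx_sum; apply: rwP; apply: mxminpoly_minP.
Qed.

Lemma minimal_poly (K : fieldType) (B : falgType K) (z : B) :
  exists p : {poly K}, p \is monic /\ forall h, alg_eval z h = 0 <-> p %| h.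
Proof.
have [|p [pm pP]] := @matrix_minimal_poly K _
  (passmx.mxof (vbasis {:B}) (vbasis {:B}) (amull z)).
  rewrite lt0n dimv_eq0; apply/eqP => B0.
  by have := memvf (1 : B); rewrite B0 memv0 oner_eq0.
exists p; split=> // h; rewrite -pP -mxof_amull_eval; split=> [->|]; last exact: mxof_amull_eq0.
by rewrite mxof_amull0.
Qed.

(** When [B] is a field, [r] is its degree over [K[z]]. *)
Lemma alg_trace_roots (K L : fieldType) (iota : {rmorphism K -> L}) (p : {poly K})
    (rs : seq L) (B : falgType K) (z : B) :
  irreducible_poly p -> p \is monic -> alg_eval z p = 0 ->
  map_poly iota p = \prod_(a <- rs) ('X - a%:P) -> uniq rs ->
  exists r, (\dim {:B} = r * (size p).-1)%N /\ forall h,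
    iota (alg_trace (alg_eval z h)) = r%:R * \sum_(a <- rs) (map_poly iota h).[a].
Proof.
move=> pi pm zp pE rsu.
have mz := mxof_amull_eval z.
have : exists r, (\dim {:B} = r * (size p).-1)%N /\ forall h : {poly K},
    iota (\tr (\sum_(i < size h) h`_i *:
      passmx.mxof (vbasis {:B}) (vbasis {:B}) (amull z) ^+ i))
    = r%:R * \sum_(a <- rs) (map_poly iota h).[a].
  have := mz p; rewrite zp mxof_amull0 => /esym.
  move: (passmx.mxof _ _ _).
  case: (\dim {:B}) => [|n] A Ap.
    exists 0%N; split=> // h; rewrite mul0r -[RHS](rmorph0 iota); congr (iota _).
    exact: big_ord0.
  rewrite -horner_mx_sum in Ap.
  have [r [nE rE]] := trace_horner_mx pi pm pE rsu Ap; exists r; split=> // h.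
  by rewrite -horner_mx_sum rE.
move=> [r [nE rE]]; exists r; split=> // h.
by rewrite -rE -mz.
Qed.

Section Center.
Variables (K : fieldType) (A : falgType K).
Local Notation Z := (center_alg A).

Lemma mem_center (x : A) : reflect (forall y, y * x = x * y) (x \in center_aspace {:A}%AS).
Proof.
apply: (iffP idP) => [|xc].
  by rewrite memv_cap => /andP [_ /centvP h] y; rewrite h ?memvf.
by rewrite memv_cap memvf; apply/centvP => y _.
Qed.

Lemma vsval1 : vsval (1 : Z) = 1.
Proof.
apply/eqP; change (algid (center_aspace {:A}%AS) == 1); rewrite algid_eq1.
by apply/mem_center => y; rewrite mulr1 mul1r.
Qed.

Lemma vsvalX (z : Z) n : vsval (z ^+ n) = vsval z ^+ n.
Proof.
elim: n => [|n IHn]; first by rewrite !expr0 vsval1.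
by rewrite !exprS -IHn.
Qed.

Lemma vsval_eval (z : Z) h : vsval (alg_eval z h) = \sum_(i < size h) h`_i *: vsval z ^+ i.
Proof.
rewrite /alg_eval linear_sum; apply: eq_bigr => i _.
by rewrite linearZ /= vsvalX.
Qed.

Lemma alg_traceZ (B : falgType K) c (b : B) : alg_trace (c *: b) = c * alg_trace b.
Proof. by rewrite /alg_trace mxof_amullZ mxtraceZ. Qed.

End Center.

Section SimpleData.
Variables (K : fieldType) (C : rigid_category K).
Hypotheses (K0 : [pchar K] =i pred0) (C_ss : semisimple_category C).
Hypotheses (C_psab : pseudo_abelian C) (C_int : integral_type C).
Variable F : tensor_aut C.
Local Notation U := (one_obj C).
Implicit Types M N S T : C.

Let C_add := rcat_additive C.

Lemma one_simple : simple_object U.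
Proof.
apply: indecomposable_simple => // [U0|e ee].
  have : (1 : K) = 0 by apply: (@scale_id_inj _ C); rewrite /= U0 !scaler0.
  by apply/eqP/oner_neq0.
have : one_scalar e * one_scalar e = one_scalar e.
  apply: (@scale_id_inj _ C) => /=; rewrite -scalerA !one_scalarE.
  rewrite -[in RHS]ee -[in LHS](comp1m e).
  by rewrite -compZl comp1m one_scalarE.
move/eqP; rewrite -subr_eq0 -{3}[one_scalar e]mulr1 -mulrBr mulf_eq0 subr_eq0.
case/orP => /eqP e0; [left|right]; by rewrite -(one_scalarE e) e0 ?scale0r ?scale1r.
Qed.

(** A nonzero [f] corresponds to a nonzero morphism [1 -> M ⊗ D M], which
    splits because [1] is simple; the splitting is contraction with some [g].
    This is what makes multiplicities nonzero. *)
Lemma ctrace_nondeg M (f : endo M) : f <> 0 -> exists g : endo M, ctrace (g * f) = 1.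
Proof.
move=> f0; have [r rE] : exists r, r ∘ ((f ⊠ idm (dual_obj M)) ∘ coev M) = idm U.
  apply: (simple_mono C_add C_ss C_psab one_simple) => e.
  by apply: f0; rewrite -[f]unbend_coev e /unbend tens0l comp0m !compm0.
have [g gE] := form_onto r; exists g; apply: ctrace_eq.
by rewrite scale1r -rE -gE tensm_l -!compA.
Qed.

(** The factors of [End(S)] give orthogonal idempotents, so there is only one. *)
Lemma simple_wedderburn S (w : wedderburn S) : simple_object S ->
  exists i0, forall i : 'I_(wed_num w), i = i0.
Proof.
move=> Ss; have [i0 _] : exists i : 'I_(wed_num w), True.
  apply: NNPP => ne; apply: Ss.1; apply: (@wed_inj _ _ _ w) => i.
  by case: ne; exists i.
exists i0 => i; apply/eqP; apply: contraT => ii0.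
have [f fE] := wed_surj (w := w) (fun j => if j == i then 1 else 0).
have ff : f * f = f.
  apply/eqP; rewrite -subr_eq0; apply/eqP; apply: (@wed_inj _ _ _ w) => j.
  rewrite rmorphB rmorphM fE; case: ifP => _; by rewrite ?mul1r ?mul0r subrr.
case: (simple_idem C_psab Ss ff) => fE'.
  by have := fE i; rewrite fE' rmorph0 eqxx => /esym/eqP; rewrite oner_eq0.
have := fE i0; rewrite fE' (rmorph1 (wed_proj w i0)) eq_sym (negPf ii0).
by move/eqP; rewrite oner_eq0.
Qed.

Lemma simple_div S (f : endo S) : simple_object S -> f <> 0 ->
  exists g : endo S, g * f = 1 /\ f * g = 1.
Proof.
move=> Ss f0; have [i iE] := schur C_add C_ss C_psab Ss Ss f0.
by exists (bwd i); rewrite -iE; split; [exact: bwdK|exact: fwdK].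
Qed.

Lemma taut_central M : central (F M : endo M).
Proof. by move=> f; apply: (taut_nat F f). Qed.

Lemma taut_horner_nat M N (x : mor M N) h :
  (endo_horner h (F N) : mor N N) ∘ x = x ∘ (endo_horner h (F M) : mor M M).
Proof. by apply: endo_horner_nat; apply: taut_nat. Qed.

Lemma horner_central M h : central (endo_horner h (F M)).
Proof. by move=> f; apply: (taut_horner_nat f). Qed.

(** All the numerical information on a simple object: the minimal polynomial [p]
    of [F S], the multiplicity [m], the degree [d] of [End(S)] over its centre, and
    the degree [r] of the centre over [K[F S]]. On the centre the reduced trace is
    [d] times the trace, and traces from the centre to [K] are sums over the roots
    of [p] counted [r] times. *)
Lemma simple_data S : simple_object S ->
  exists (p : {poly K}) (m : int) (d r : nat),
  [/\ [/\ irreducible_poly p, p \is monic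
        & forall h, endo_horner h (F S) = 0 <-> p %| h],
      has_multiplicity S m,
      m * (d * r)%:Z != 0,
      forall (L : fieldType) (iota : {rmorphism K -> L}) (rs : seq L),
        map_poly iota p = \prod_(a <- rs) ('X - a%:P) -> uniq rs -> forall h,
        iota (ctrace (endo_horner h (F S)))
          = (m * (d * r)%:Z)%:~R * \sum_(a <- rs) (map_poly iota h).[a]
    & exists (A : falgType K) (phi : endo S -> A),
        [/\ linear phi, bijective phi,
            \dim {:A} = (d ^ 2 * (r * (size p).-1))%N
          & r = 1%N -> generates_center (F S)]].
Proof.
move=> Ss; have [w [mu [[T [TT trT]] muZ]]] := C_int S.
have [i0 i0E] := simple_wedderburn w Ss.
pose A := wed_alg w i0; pose phi := wed_proj w i0.
have phi_inj : injective phi.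
  move=> f g e; apply/eqP; rewrite -subr_eq0; apply/eqP.
  by apply: (@wed_inj _ _ _ w) => i; rewrite (i0E i) rmorphB -/phi e subrr.
(* As all indices are equal to [i0], a family is given by its value there. *)
have phi_surj a : exists f, phi f = a.
  have [f fE] := wed_surj (w := w) (fun i => eq_rect i0 (wed_alg w) a i (esym (i0E i))).
  by exists f; rewrite /phi fE [esym _](eq_irrelevance _ erefl).
have phiZ : scalable phi := @wed_scal _ _ _ w i0.
have [m mE] := muZ i0.
have {}mE : mu = m%:~R by apply: phi_inj; rewrite mE rmorph_int.
have {}trT f : ctrace f = T i0 (phi (m%:~R * f)).
  rewrite trT (big_pred1 i0) ?mE // => i; by rewrite /= (i0E i) eqxx.
have [t [[s st] tE]] := TT i0.
pose Z := center_alg A.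
have centerE f : central f <-> phi f \in center_aspace {:A}%AS.
  split=> [fc|/mem_center fc g].
    apply/mem_center => y; have [g <-] := phi_surj y.
    by rewrite -!rmorphM fc.
  by apply: phi_inj; rewrite !rmorphM fc.
pose z : Z := Subvs ((centerE _).1 (@taut_central S)).
have evalE h : phi (endo_horner h (F S)) = vsval (alg_eval z h).
  by rewrite endo_horner_morph // vsval_eval.
have [p [pm pP]] := minimal_poly z.
have {}pP h : endo_horner h (F S) = 0 <-> p %| h.
  rewrite -pP; split=> [e|e].
    by apply: val_inj; rewrite /= -evalE e rmorph0.
  by apply: phi_inj; rewrite evalE e rmorph0.
have p0 := monic_neq0 pm.
have pi : irreducible_poly p.
  split.
    have := (pP p).2 (dvdpp _); case: ltnP => // p1.
    have p1' : p = 1.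
      by move: pm; rewrite (size1_polyC p1) monicE lead_coefC => /eqP ->.
    by rewrite p1' endo_horner1 => /(Ss.1).
  move=> q q1 qp; have [u uE] := dvdpP _ _ qp.
  have := (pP p).2 (dvdpp _); rewrite uE endo_hornerM => uq0.
  have [u0|u0] := classic (endo_horner u (F S) = 0).
    have /pP pu := u0; have u00 : u != 0 by apply: contraNneq p0 => e; rewrite uE e mul0r.
    have q00 : q != 0 by apply: contraNneq p0 => e; rewrite uE e mulr0.
    have := dvdp_leq u00 pu; rewrite uE size_mul //.
    move: q1 q00; rewrite -size_poly_gt0; case: (size q) => [|[|k]] // _ _.
    by rewrite !addnS /= ltnNge leq_addr.
  have [g [gu _]] := simple_div Ss u0.
  have /pP pq : endo_horner q (F S) = 0.
    by rewrite -[LHS]mul1r -gu -mulrA uq0 mulr0.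
  by rewrite -uE /eqp qp.
have zp : alg_eval z p = 0.
  by apply: val_inj; rewrite /= -evalE ((pP p).2 (dvdpp p)) rmorph0.
have [L0 [io0 [rs0 [rs0E rs0u]]]] := irreducible_split K0 pi pm.
have [r [dimZ _]] := alg_trace_roots pi pm zp rs0E rs0u.
pose d := spl_deg s.
have dimA : \dim {:A} = (d ^ 2 * (r * (size p).-1))%N by rewrite -dimZ (spl_degree s).
have deg_gt0 : (0 < (size p).-1)%N by move: pi.1; case: (size p) => [|[|]].
have dimA0 : (0 < \dim {:A})%N.
  rewrite lt0n dimv_eq0; apply/eqP => B0.
  by have := memvf (1 : A); rewrite B0 memv0 oner_eq0.
have [d0 r0] : d != 0 /\ r != 0.
  by move: dimA0; rewrite dimA !muln_gt0 !lt0n => /andP [/andP [? _] /andP []].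
have incl_inj : injective (spl_incl s).
  suff incl0 x : spl_incl s x = 0 -> x = 0.
    by move=> x y e; apply/eqP; rewrite -subr_eq0; apply/eqP/incl0; rewrite rmorphB e subrr.
  move=> x0; apply: contra_eq x0 => xn0.
  have [f fE] := phi_surj (vsval x).
  have f0 : f <> 0 by move=> e; case/eqP: xn0; apply: val_inj; rewrite /= -fE e rmorph0.
  have [g [gf fg]] := simple_div Ss f0.
  have gc : central g.
    have fc : central f by apply/centerE; rewrite fE subvsP.
    by move=> h; rewrite -[LHS]mulr1 -fg -mulrA (mulrA h) -(fc h) -mulrA mulrA gf mul1r.
  have [y yE] : exists y : Z, vsval y = phi g by exists (Subvs ((centerE g).1 gc)).
  have xy : x * y = 1.
    by apply: val_inj; rewrite /= yE -fE -rmorphM fg rmorph1; apply: esym (vsval1 _).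
  apply/eqP => x0; have := congr1 (spl_incl s) xy.
  by rewrite rmorphM x0 mul0r rmorph1 => /esym/eqP; rewrite oner_eq0.
have trMz (X : 'M[spl_field s]_(spl_deg s)) n : \tr (X *~ n) = \tr X *~ n by apply: raddfMz.
(* A central element is a scalar matrix of size [d] in a splitting. *)
have tZ n (x : Z) : t (n%:~R * vsval x) = (n * d%:Z)%:~R *: x.
  apply: incl_inj; rewrite st mulrzl rmorphMz spl_center trMz mxtrace_scalar.
  by rewrite scaler_int rmorphMz (mulrC n) mulrzA -pmulrn.
have trZ h : ctrace (endo_horner h (F S)) = (m * d%:Z)%:~R * alg_trace (alg_eval z h).
  by rewrite trT rmorphM rmorph_int evalE tE tZ alg_traceZ.
exists p, m, d, r; split=> //.
- by exists w; exists T; split=> // f; rewrite -mE trT (big_pred1 i0) ?mE // => i; rewrite /= (i0E i) eqxx.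
- rewrite mulf_neq0 //; last by rewrite -[0]/(Posz 0) eqz_nat muln_eq0 negb_or d0.
  have [g] := ctrace_nondeg (fun e : (1 : endo S) = 0 => Ss.1 e).
  apply: contra_eqN => /eqP m0; rewrite trT m0 mul0r rmorph0 tE.
  have := tZ 0 0; rewrite !mul0r => ->.
  by rewrite alg_traceZ mul0r eq_sym oner_neq0.
- move=> L io rs rsE rsu h.
  have [r' [dimZ' rE]] := alg_trace_roots pi pm zp rsE rsu.
  have -> : r = r'.
    by apply/eqP; rewrite -(eqn_pmul2r deg_gt0) -dimZ -dimZ'.
  rewrite trZ rmorphM rE rmorph_int mulrA; congr (_ * _).
  by rewrite PoszM mulrA [RHS]intrM.
exists A, phi; split=> //.
- by move=> a x y; rewrite rmorphD phiZ.
- have [psi psiE] : exists psi : A -> endo S, forall a, phi (psi a) = a.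
    pose X a := constructive_indefinite_description _ (phi_surj a).
    by exists (fun a => proj1_sig (X a)) => a; apply: (proj2_sig (X a)).
  by exists psi => x; [apply: phi_inj; rewrite psiE|].
move=> r1 g; split=> [|[h ->]]; last exact: horner_central.
move/centerE => gc; pose y : Z := Subvs gc.
have evZ_wide (h : {poly K}) n : (size h <= n)%N -> alg_eval z h = \sum_(i < n) h`_i *: z ^+ i.
  move=> hn; rewrite /alg_eval (big_ord_widen n (fun i => h`_i *: z ^+ i) hn).
  rewrite big_mkcond; apply: eq_bigr => i _; case: ltnP => // ih.
  by rewrite nth_default // scale0r.
pose X := [tuple z ^+ i | i < (size p).-1].
have XE (i : 'I_(size p).-1) : X`_i = z ^+ i by rewrite -tnth_nth tnth_mktuple.
have sumE (c : 'I_(size p).-1 -> K) :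
    \sum_i c i *: X`_i = alg_eval z (rVpoly (\row_i c i)).
  rewrite (evZ_wide _ (size p).-1) ?size_poly //; apply: eq_bigr => i _.
  by rewrite coef_rVpoly_ord mxE XE.
have X_free : free X.
  apply/freeP => c; rewrite sumE => c0 i.
  have /pP pc : endo_horner (rVpoly (\row_i c i)) (F S) = 0.
    by apply: phi_inj; rewrite evalE c0 rmorph0.
  have c00 : rVpoly (\row_i c i) = 0.
    apply/eqP; apply: contraTT pc => c1; apply: contraL (leqnn (size p)) => /(dvdp_leq c1) le.
    rewrite -ltnNge (leq_ltn_trans (leq_trans le (size_poly _ _))) //.
    by rewrite prednK // ltnW // pi.1.
  by have := coef_rVpoly_ord (\row_i c i) i; rewrite c00 coef0 mxE.
have X_basis : basis_of {:Z} X.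
  by rewrite basisEfree X_free subvf size_tuple dimZ r1 mul1n leqnn.
exists (rVpoly (\row_i coord X i y)); apply: phi_inj.
by rewrite evalE -sumE -(coord_basis X_basis) ?memvf.
Qed.

End SimpleData.

(** * Dimensions *)

Section HasDim.
Variable K : fieldType.

Lemma has_dim0 (V : lmodType K) : (forall v : V, v = 0) -> has_dim V 0.
Proof.
move=> V0; exists (fun => 0) => v; exists [ffun => 0].
by split=> [|c _]; [rewrite big_ord0 | apply/ffunP => -[]].
Qed.

Lemma has_dim1 (V : lmodType K) (v : V) : v != 0 -> (forall x, exists c, x = c *: v) ->
  has_dim V 1.
Proof.
move=> v0 gen; exists (fun => v) => x; have [c ->] := gen x.
exists [ffun => c]; split=> [|f]; first by rewrite big_ord1 ffunE.
rewrite big_ord1 => /eqP; rewrite -subr_eq0 -scalerBl scaler_eq0 (negPf v0) orbF subr_eq0.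
by move/eqP => cE; apply/ffunP => i; rewrite ffunE (ord1 i) cE.
Qed.

Lemma has_dim_neq0 (V : lmodType K) k : has_dim V k -> k != 0%N -> exists v : V, v <> 0.
Proof.
case: k => // k [b bP] _; exists (b ord0) => b0.
have [c [_ cu]] := bP 0.
have e1 : c = [ffun => 0].
  by apply: cu; rewrite big1 // => i _; rewrite ffunE scale0r.
have e2 : c = [ffun i => (i == ord0)%:R].
  apply: cu; rewrite (bigD1 ord0) //= ffunE eqxx b0 scaler0 add0r big1 // => i /negPf.
  by rewrite ffunE => ->; rewrite scale0r.
have := congr1 (fun f : {ffun _} => f ord0) e2.
by rewrite e1 !ffunE eqxx => /eqP; rewrite eq_sym oner_eq0.
Qed.

Lemma has_dim_bij (V W : lmodType K) (f : V -> W) k : linear f -> bijective f ->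
  has_dim V k -> has_dim W k.
Proof.
move=> fl [g fK gK] [b bP].
have fsum (c : 'I_k -> K) : f (\sum_i c i *: b i) = \sum_i c i *: f (b i).
  have fD x y : f (x + y) = f x + f y by have := fl 1 x y; rewrite !scale1r.
  have f0 : f 0 = 0 by apply: (addrI (f 0)); rewrite -fD !addr0.
  rewrite (big_morph f fD f0); apply: eq_bigr => i _.
  by have := fl (c i) (b i) 0; rewrite f0 !addr0.
exists (f \o b) => w; have [c [cE cu]] := bP (g w).
exists c; split=> [|c' c'E]; first by rewrite -fsum -cE gK.
by apply: cu; rewrite c'E -fsum fK.
Qed.

Lemma has_dim_vect (A : vectType K) k : has_dim A k -> \dim {:A} = k.
Proof.
move=> [b bP]; pose X := [tuple b i | i < k].
have XE (i : 'I_k) : X`_i = b i by rewrite -tnth_nth tnth_mktuple.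
have Xf : free X.
  apply/freeP => c c0 i; have [c1 [_ cu]] := bP 0.
  have e1 : c1 = [ffun => 0].
    by apply: cu; rewrite big1 // => j _; rewrite ffunE scale0r.
  have e2 : c1 = [ffun j => c j].
    by apply: cu; rewrite -[LHS]c0; apply: eq_bigr => j _; rewrite ffunE XE.
  by have := congr1 (fun f : {ffun _} => f i) e2; rewrite e1 !ffunE.
suff bX : basis_of {:A} X by exact: size_basis bX.
rewrite /basis_of Xf andbT eqEsubv subvf; apply/subvP => v _.
have [c [-> _]] := bP v; apply: memv_suml => i _; apply: memvZ.
by apply: memv_span; rewrite -XE mem_nth // size_tuple.
Qed.

Lemma has_dim_biproduct (C : klin_category K) (U M N B : C) k l : biproduct M N B ->
  has_dim (mor U M) k -> has_dim (mor U N) l -> has_dim (mor U B) (k + l).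
Proof.
move=> [i [j [p [q [pi qj pj qi ijE]]]]] [b bP] [b' bP'].
exists (fun s => match split s with inl s => i ∘ b s | inr s => j ∘ b' s end) => v.
have [c [cE cu]] := bP (p ∘ v); have [c' [c'E cu']] := bP' (q ∘ v).
have sumE (x : 'I_(k + l) -> K) : \sum_s x s *:
    match split s with inl s => i ∘ b s | inr s => j ∘ b' s end
  = i ∘ (\sum_s x (lshift l s) *: b s) + j ∘ (\sum_s x (rshift k s) *: b' s).
  rewrite big_split_ord !comp_sumr; congr (_ + _); apply: eq_bigr => s _.
    by rewrite (unsplitK (inl s)) compZr.
  by rewrite (unsplitK (inr s)) compZr.
exists [ffun s => match split s with inl s => c s | inr s => c' s end]; split.
  rewrite sumE.
  under eq_bigr => s _ do rewrite ffunE (unsplitK (inl s)).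
  under [X in _ + _ ∘ X]eq_bigr => s _ do rewrite ffunE (unsplitK (inr s)).
  by rewrite -cE -c'E !compA -compDl ijE comp1m.
move=> x; rewrite sumE => vE.
have e : c = [ffun s => x (lshift l s)].
  apply: cu; rewrite vE compDr !compA pi pj comp1m comp0m addr0.
  by apply: eq_bigr => s _; rewrite ffunE.
have e' : c' = [ffun s => x (rshift k s)].
  apply: cu'; rewrite vE compDr !compA qi qj comp1m comp0m add0r.
  by apply: eq_bigr => s _; rewrite ffunE.
apply/ffunP => s; rewrite ffunE -[s in RHS]splitK.
by case: (split s) => t; rewrite ?e ?e' ffunE.
Qed.

End HasDim.

(** * The equalizer of two commuting algebraic elements *)

Section Equalizer.
Variables (K : fieldType) (C : klin_category K) (X : C).
Variables (x y : endo X) (xy : x * y = y * x).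
Variable p : {poly K}.
Hypotheses (px : endo_horner p x = 0) (py : endo_horner p y = 0).

(** The value at [(x, y)] of the two-variable polynomial [(p(x) - p(y)) / (x - y)]. *)
Definition bezoutian : endo X :=
  \sum_(k < size p) p`_k *: \sum_(i < k) x ^+ (k.-1 - i) * y ^+ i.

Lemma bezoutian_eq : x * bezoutian = y * bezoutian.
Proof.
apply/eqP; rewrite -subr_eq0 -mulrBl /bezoutian mulr_sumr.
under eq_bigr => k _ do rewrite -endo_scaleAr -subrXX_comm // scalerBr.
by rewrite sumrB -/(endo_horner p x) -/(endo_horner p y) px py subrr.
Qed.

Lemma deriv_sum : p^`() = \sum_(k < size p) (p`_k *+ k) *: 'X^(k.-1).
Proof.
rewrite -[p in LHS]coefK poly_def raddf_sum; apply: eq_bigr => k _.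
by rewrite /= derivZ derivXn -scalerMnr scalerMnl.
Qed.

Lemma bezoutian_diag Y (w : mor Y X) : (x : mor X X) ∘ w = y ∘ w ->
  (bezoutian : mor X X) ∘ w = endo_horner p^`() y ∘ w.
Proof.
move=> xw.
have xn n : (x ^+ n : mor X X) ∘ w = (y ^+ n : mor X X) ∘ w.
  elim: n => // n IHn; rewrite exprSr exprS /GRing.mul /= -!compA xw compA.
  have -> : (x ^+ n : mor X X) ∘ y = y ∘ (x ^+ n : mor X X).
    exact: esym (commrX n (esym xy)).
  by rewrite -compA IHn.
rewrite deriv_sum endo_horner_sum !comp_suml; apply: eq_bigr => k _.
rewrite endo_hornerZ !compZl comp_suml endo_hornerXn -scalerMnl scalerMnr; congr (_ *: _).
transitivity (\sum_(i < k) ((y ^+ k.-1 : mor X X) ∘ w)); last first.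
  by rewrite sumr_const card_ord.
apply: eq_bigr => i _.
have -> : x ^+ (k.-1 - i) * y ^+ i = y ^+ i * x ^+ (k.-1 - i).
  by apply: commrX; apply/commr_sym/commrX.
have -> : k.-1 = (i + (k.-1 - i))%N.
  by rewrite subnKC // -ltnS prednK ?(leq_ltn_trans _ (ltn_ord i)).
by rewrite addKn exprD /GRing.mul /= -!compA xn.
Qed.

Variable u : {poly K}.
Hypothesis pu : p %| p^`() * u - 1.

(** On the part of [X] where [x] and [y] agree, the Bezoutian acts as [p'(y)];
    dividing by it gives the projector on this part. In the universal case, which is
    [K[x]/(p) ⊗ K[y]/(p)], this is the separability idempotent. *)
Definition equalizer : endo X := endo_horner u y * bezoutian.

Lemma equalizer_eq : x * equalizer = y * equalizer.
Proof.
rewrite /equalizer !mulrA (endo_horner_comm _ xy) -mulrA bezoutian_eq !mulrA.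
by rewrite -(endo_horner_comm _ (erefl (y * y))).
Qed.

Lemma equalizer_id Y (w : mor Y X) : (x : mor X X) ∘ w = y ∘ w ->
  (equalizer : mor X X) ∘ w = w.
Proof.
move=> xw; rewrite /equalizer /GRing.mul /= -compA bezoutian_diag // compA.
have -> : (endo_horner u y : mor X X) ∘ endo_horner p^`() y = endo_horner (p^`() * u) y.
  by rewrite mulrC endo_hornerM.
have -> : p^`() * u = (p^`() * u - 1) + 1 by rewrite subrK.
by rewrite endo_hornerD (endo_horner_dvd pu py) add0r endo_horner1 comp1m.
Qed.

Lemma equalizer_idem : equalizer * equalizer = equalizer.
Proof. by apply: equalizer_id; apply: equalizer_eq. Qed.

End Equalizer.

Section DualEndo.
Variable (K : fieldType) (C : rigid_category K).
Local Notation D := dual_obj.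
Implicit Type M : C.

Lemma ev_inj M (k k' : endo (D M)) :
  ev M ∘ (k ⊠ idm M) = ev M ∘ (k' ⊠ idm M) -> k = k'.
Proof.
have kE (l : endo (D M)) : l = lunit (D M) ∘ (((ev M ∘ (l ⊠ idm M)) ⊠ idm (D M)) ∘
    (bwd (assoc (D M) M (D M)) ∘ ((idm (D M) ⊠ coev M) ∘ bwd (runit (D M))))).
  rewrite tensm_l -!compA -(reassoc2 (assocV_nat _ _ _)) tensm1.
  rewrite (reassoc2 (tensm_swap _ _)) -runitV_nat.
  by apply: esym; have := congr1 (fun x => x ∘ (l : mor _ _)) (zigr_id M); rewrite comp1m -!compA.
by move=> e; rewrite (kE k) (kE k') e.
Qed.

Lemma ev_horner M (k : endo (D M)) (f : endo M) h :
  ev M ∘ (k ⊠ idm M) = ev M ∘ (idm (D M) ⊠ f) ->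
  ev M ∘ ((endo_horner h k : mor _ _) ⊠ idm M)
    = ev M ∘ (idm (D M) ⊠ (endo_horner h f : mor _ _)).
Proof.
move=> e.
have e_n n : ev M ∘ ((k ^+ n : mor _ _) ⊠ idm M) = ev M ∘ (idm (D M) ⊠ (f ^+ n : mor _ _)).
  elim: n => [|n IHn]; first by rewrite !expr0 !tensm1.
  rewrite exprSr exprS /GRing.mul /= tensm_l tensm_r compA IHn -compA -tensm_swap.
  by rewrite compA e -compA.
rewrite /endo_horner.
have sl (I : finType) (c : I -> K) (g : I -> endo (D M)) :
    (\sum_i c i *: g i : mor _ _) ⊠ idm M = \sum_i c i *: ((g i : mor _ _) ⊠ idm M).
  rewrite (big_morph (fun g : mor (D M) (D M) => g ⊠ idm M)
    (fun a b => tensDl a b _) (tens0l _ _ _)).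
  by apply: eq_bigr => i _; rewrite tensZl.
have sr (I : finType) (c : I -> K) (g : I -> endo M) :
    idm (D M) ⊠ (\sum_i c i *: g i : mor _ _) = \sum_i c i *: (idm (D M) ⊠ (g i : mor _ _)).
  rewrite (big_morph (fun g : mor M M => idm (D M) ⊠ g)
    (fun a b => tensDr _ a b) (tens0r _ _ _)).
  by apply: eq_bigr => i _; rewrite tensZr.
rewrite sl sr !comp_sumr; apply: eq_bigr => i _.
by rewrite !compZr e_n.
Qed.

End DualEndo.

Section CharZero.
Variable K : fieldType.
Hypothesis K0 : [pchar K] =i pred0.

Lemma intr_inj_char0 (m n : int) : m%:~R = n%:~R :> K -> m = n.
Proof.
suff z0 (z : int) : z%:~R = 0 :> K -> z = 0.
  by move=> e; apply/eqP; rewrite -subr_eq0; apply/eqP/z0; rewrite rmorphB /= e subrr.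
have nat0 n' : n'%:R = 0 :> K -> n' = 0%N.
  by move=> e; apply/eqP; rewrite -((pcharf0P K).1 K0) e.
case: z => k; first by move=> /nat0 ->.
by rewrite NegzE mulrNz => /eqP; rewrite oppr_eq0 => /eqP /nat0.
Qed.

End CharZero.

(** * The invariants of F in S ⊗ D T *)

Section TensorEqualizer.
Variables (K : fieldType) (C : rigid_category K).
Hypotheses (K0 : [pchar K] =i pred0) (C_ss : semisimple_category C).
Hypotheses (C_psab : pseudo_abelian C) (C_int : integral_type C).
Variable F : tensor_aut C.
Local Notation U := (one_obj C).
Local Notation D := dual_obj.
Implicit Types M N S T : C.

Let C_add := rcat_additive C.

(** When only [1] is fixed among the simple objects, an object on which [F] is
    the identity is a sum of copies of [1], as all its simple summands are fixed. *)
Lemma trivial_object M :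
  (forall S, simple_object S -> F S = idm S -> isomorphic S U) ->
  decomposable M -> F M = idm M ->
  exists k (u : 'I_k -> mor U M) (v : 'I_k -> mor M U),
    [/\ forall i, v i ∘ u i = idm U, \sum_i u i ∘ v i = idm M
      & has_dim (mor U M) k].
Proof.
move=> hi; elim=> {M} [M M0 _|S Ss FS|M N B bp _ IHM _ IHN FB].
- exists 0%N, (fun => 0), (fun => 0); split=> [[]//||]; first by rewrite big_ord0.
  by apply: has_dim0 => v; rewrite -[v]comp1m M0 comp0m.
- have [i] := isomorphic_sym (hi S Ss FS).
  exists 1%N, (fun => fwd i), (fun => bwd i); split=> [_||].
  + exact: bwdK.
  + by rewrite big_ord1 fwdK.
  apply: (@has_dim1 _ _ (fwd i)).
    by apply/eqP; apply: iso_neq0; case: (one_simple C_ss).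
  move=> x; exists (one_scalar (bwd i ∘ x)).
  by rewrite -[fwd i]compm1 -compZr one_scalarE compA fwdK comp1m.
have [i [j [p [q [pi qj pj qi ijE]]]]] := bp.
have FM : F M = idm M.
  by rewrite -[LHS]comp1m -pi -compA -(taut_nat F i) FB comp1m.
have FN : F N = idm N.
  by rewrite -[LHS]comp1m -qj -compA -(taut_nat F j) FB comp1m.
have [k [u [v [vu uv dk]]]] := IHM FM; have [l [u' [v' [vu' uv' dl]]]] := IHN FN.
exists (k + l)%N.
exists (fun s => match split s with inl s => i ∘ u s | inr s => j ∘ u' s end).
exists (fun s => match split s with inl s => v s ∘ p | inr s => v' s ∘ q end).
split; last exact: has_dim_biproduct dk dl.
  move=> s; case: (split s) => t.
    by rewrite -compA (reassoc pi) comp1m.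
  by rewrite -compA (reassoc qj) comp1m.
rewrite big_split_ord -ijE; congr (_ + _).
  under eq_bigr => s _ do rewrite (unsplitK (inl s)) -compA (compA (u s)).
  by rewrite -comp_sumr -comp_suml uv comp1m.
under eq_bigr => s _ do rewrite (unsplitK (inr s)) -compA (compA (u' s)).
by rewrite -comp_sumr -comp_suml uv' comp1m.
Qed.

Lemma decomposable_all M : decomposable M.
Proof.
have [w _] := C_int M.
by apply: length_decomposable => //; apply: (wedderburn_length (w := w)).
Qed.

Section Pair.
Variables (S T : C) (p u : {poly K}).
Hypotheses (pS : endo_horner p (F S) = 0) (pT : endo_horner p (F T) = 0).
Hypothesis pu : p %| p^`() * u - 1.
Local Notation X := (S ⊗ D T).

Let e_l (f : endo S) : endo X := f ⊠ idm (D T).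
Let e_r (f : endo (D T)) : endo X := idm S ⊠ f.

Lemma horner_tens_l f h : endo_horner h (e_l f) = e_l (endo_horner h f).
Proof.
rewrite /endo_horner /e_l (big_morph (fun g : mor S S => g ⊠ idm (D T))
    (fun a b => tensDl a b _) (tens0l _ _ _)).
apply: eq_bigr => i _; rewrite tensZl; congr (_ *: _).
elim: (i : nat) => [|n IHn]; first by rewrite !expr0 tensm1.
by rewrite !exprS IHn /GRing.mul /= tensm_l.
Qed.

Lemma horner_tens_r f h : endo_horner h (e_r f) = e_r (endo_horner h f).
Proof.
rewrite /endo_horner /e_r (big_morph (fun g : mor (D T) (D T) => idm S ⊠ g)
    (fun a b => tensDr _ a b) (tens0r _ _ _)).
apply: eq_bigr => i _; rewrite tensZr; congr (_ *: _).
elim: (i : nat) => [|n IHn]; first by rewrite !expr0 tensm1.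
by rewrite !exprS IHn /GRing.mul /= tensm_r.
Qed.

(** Morphisms [1 -> S ⊗ D T] are the morphisms [T -> S], on which [F] acts by
    conjugation. The projector onto the invariants of [F] is therefore the equalizer
    of [F S ⊠ 1] and of [1 ⊠ G], with [G] the transpose of [F T], which naturality
    identifies with the inverse of [F (D T)]. *)
Lemma invariant_projector : exists e : endo X,
  [/\ e * e = e, F X * e = e,
      forall v : mor U X, (e : mor X X) ∘ v = v
    & tau e = \sum_(k < size p) p`_k * \sum_(i < k)
        ctrace (endo_horner 'X^(k.-1 - i) (F S)) * ctrace (endo_horner (u * 'X^i) (F T))].
Proof.
have [G [GF FG]] := taut_iso F (D T).
have GE : ev T ∘ (G ⊠ idm T) = ev T ∘ (idm (D T) ⊠ F T).
  have h : ev T ∘ (F (D T) ⊠ F T) = ev T.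
    by rewrite -(taut_tens F) -(taut_nat F (ev T)) taut_one comp1m.
  rewrite -{1}h -compA -tensm_comp compm1 FG //.
have pG : endo_horner p (G : endo (D T)) = 0.
  by apply: ev_inj; rewrite (ev_horner _ GE) pT tens0r tens0l !compm0.
pose x := e_l (F S); pose y := e_r (G : endo (D T)).
have xy : x * y = y * x by apply: tensm_swap.
have px : endo_horner p x = 0 by rewrite horner_tens_l pS /e_l tens0l.
have py : endo_horner p y = 0 by rewrite horner_tens_r pG /e_r tens0r.
have FX : F X = e_r (F (D T)) * x by rewrite (taut_tens F) -tensm_rl.
have ry : e_r (F (D T)) * y = 1.
  by rewrite /e_r /y /GRing.mul /= -tensm_r FG tensm1.
have yr : y * e_r (F (D T)) = 1.
  by rewrite /e_r /y /GRing.mul /= -tensm_r GF tensm1.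
exists (equalizer x y p u); split.
- exact: equalizer_idem.
- by rewrite FX -mulrA equalizer_eq // mulrA ry mul1r.
- move=> v; apply: equalizer_id => //.
  have Fv : (F X : mor X X) ∘ v = v by rewrite (taut_nat F) taut_one compm1.
  rewrite -[in RHS]Fv FX compA.
  by rewrite [X in _ = X ∘ v](_ : _ = x) // -[RHS]mul1r -yr -mulrA.
rewrite /equalizer /bezoutian mulr_sumr tau_sum; apply: eq_bigr => k _.
rewrite -endo_scaleAr tauZ mulr_sumr tau_sum; congr (_ * _); apply: eq_bigr => i _.
have -> : endo_horner u y * (x ^+ (k.-1 - i) * y ^+ i)
    = (endo_horner 'X^(k.-1 - i) (F S) : mor S S) ⊠
      (endo_horner (u * 'X^i) (G : endo (D T)) : mor (D T) (D T)).
  rewrite -!(endo_hornerXn y) -!(endo_hornerXn x).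
  have -> : endo_horner 'X^(k.-1 - i) x * endo_horner 'X^i y
    = endo_horner 'X^i y * endo_horner 'X^(k.-1 - i) x.
    by rewrite !endo_hornerXn; apply: commrX; apply/commr_sym/commrX.
  by rewrite mulrA -endo_hornerM horner_tens_r horner_tens_l -tensm_rl.
by apply: tau_tens; apply: ev_horner.
Qed.

End Pair.

End TensorEqualizer.

(** * The dimension of Hom(T, S) *)

Section RootSums.
Variables (K L : fieldType) (iota : {rmorphism K -> L}) (p : {poly K}) (rs : seq L).
Hypothesis pE : map_poly iota p = \prod_(a <- rs) ('X - a%:P).

(** Up to the factor [p'(b)], the Bezoutian is [(p(a) - p(b)) / (a - b)] and so
    vanishes at two distinct roots. *)
Lemma root_bezoutian a b (u : {poly K}) : a \in rs -> b \in rs -> p %| p^`() * u - 1 ->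
  (map_poly iota u).[b] * (\sum_(k < size p) iota p`_k * \sum_(i < k) a ^+ (k.-1 - i) * b ^+ i)
  = (a == b)%:R.
Proof.
move=> ra rb pu.
have pr x : x \in rs -> \sum_(k < size p) iota p`_k * x ^+ k = 0.
  move=> xr; have : root (map_poly iota p) x by rewrite pE root_prod_XsubC.
  rewrite /root horner_coef size_map_poly => /eqP e; rewrite -[RHS]e.
  by apply: eq_bigr => k _; rewrite coef_map.
case: eqVneq => [<-|ab] /=; last first.
  apply: (@mulfI _ (a - b)); first by rewrite subr_eq0.
  rewrite mulr0 mulrCA mulr_sumr.
  under eq_bigr => k _ do rewrite mulrCA -subrXX mulrBr.
  by rewrite sumrB !pr // subrr mulr0.
have -> : \sum_(k < size p) iota p`_k * \sum_(i < k) a ^+ (k.-1 - i) * a ^+ i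
    = (map_poly iota p^`()).[a].
  rewrite deriv_sum (big_morph (fun h => (map_poly iota h).[a]) (id1 := 0) (op1 := +%R));
    first last.
  - by rewrite rmorph0 horner0.
  - by move=> h h'; rewrite rmorphD hornerD.
  apply: eq_bigr => k _; rewrite map_polyZ map_polyXn hornerZ hornerXn rmorphMn /= mulrnAl -mulrnAr.
  congr (_ * _); transitivity (\sum_(i < k) a ^+ k.-1); last by rewrite sumr_const card_ord.
  apply: eq_bigr => i _.
  by rewrite -exprD subnK // -ltnS prednK // (leq_ltn_trans _ (ltn_ord i)).
have /dvdpP [v vE] := pu.
have : (map_poly iota (p^`() * u - 1)).[a] = 0.
  rewrite vE rmorphM hornerM /=.
  have : root (map_poly iota p) a by rewrite pE root_prod_XsubC.
  by move/rootP => ->; rewrite mulr0.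
rewrite rmorphB rmorphM rmorph1 /= hornerD hornerN hornerC hornerM mulrC => /eqP.
by rewrite subr_eq0 => /eqP.
Qed.

End RootSums.

Section HomDim.
Variables (K : fieldType) (C : rigid_category K).
Hypotheses (K0 : [pchar K] =i pred0) (C_ss : semisimple_category C).
Hypotheses (C_psab : pseudo_abelian C) (C_int : integral_type C).
Variable F : tensor_aut C.
Local Notation U := (one_obj C).
Local Notation D := dual_obj.
Implicit Types M N S T : C.

(** By the last clause the trace on [K[F S]] is [c] times the trace of this field
    over [K]; sums over roots avoid choosing a model of the field. *)
Definition trace_data S (p : {poly K}) (c : int) :=
  [/\ irreducible_poly p, p \is monic, c != 0,
      forall h, endo_horner h (F S) = 0 <-> p %| h
    & forall (L : fieldType) (iota : {rmorphism K -> L}) (rs : seq L),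
      map_poly iota p = \prod_(a <- rs) ('X - a%:P) -> uniq rs -> forall h,
      iota (ctrace (endo_horner h (F S)))
        = c%:~R * \sum_(a <- rs) (map_poly iota h).[a]].

Lemma unbend_linear S T : linear (@unbend K C S T).
Proof.
move=> a u v; rewrite /unbend tensDl tensZl !compDl !compZl !compDr !compZr //.
Qed.

(** Both sides are the trace of the invariant projector of [S ⊗ D T]: its image
    is a sum of copies of [1], and its trace is multiplicative in the two strands. *)
Lemma hom_dim S T p cS cT :
  (forall S, simple_object S -> F S = idm S -> isomorphic S U) ->
  trace_data S p cS -> trace_data T p cT ->
  exists k : nat, has_dim (mor T S) k /\ k%:Z = cS * cT * (size p).-1%:Z.
Proof.
move=> hi [pi pm _ pS trS] [_ _ _ pT trT].
have [u pu] := inverse_mod (irreducible_separable K0 pi).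
have [e [ee Fe ev te]] := invariant_projector ((pS p).2 (dvdpp p)) ((pT p).2 (dvdpp p)) pu.
have [E [i [q [qi iq]]]] := C_psab ee.
have ei : (e : mor _ _) ∘ i = i by rewrite -iq -compA qi compm1.
have Fi : (F (S ⊗ D T) : mor _ _) ∘ i = i.
  by rewrite -{1}ei compA; have -> : (F (S ⊗ D T) : mor _ _) ∘ e = e by exact: Fe.
have FE : F E = idm E by rewrite -[LHS]comp1m -qi -compA -(taut_nat F i) Fi.
have [k [x [y [yx xy dk]]]] := trivial_object C_ss hi (decomposable_all C_ss C_psab C_int E) FE.
exists k; split.
  apply: (has_dim_bij (f := fun w => unbend (i ∘ w))) dk.
    by move=> a w w'; rewrite compDr compZr unbend_linear.
  exists (fun f => q ∘ ((f ⊠ idm (D T)) ∘ coev T)) => w.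
    by rewrite unbendK compA qi comp1m.
  by rewrite compA iq ev unbend_coev.
have tk : tau e = k%:R.
  have -> : e = \sum_j (i ∘ x j) ∘ (y j ∘ q) :> endo _.
    rewrite -[LHS]iq -[i in LHS]compm1 -xy comp_sumr comp_suml; apply: eq_bigr => j _.
    by rewrite -!compA.
  transitivity (\sum_(j < k) (1 : K)); last by rewrite sumr_const card_ord.
  rewrite tau_sum.
  apply: eq_bigr => j _; rewrite tau_rank1 -!compA (compA q) qi comp1m yx.
  by rewrite -[idm U]scale1r one_scalarZ.
have [L [iota [rs [rsE rsu]]]] := irreducible_split K0 pi pm.
apply: (intr_inj_char0 K0); apply: (fmorph_inj iota).
rewrite /= -[(k%:Z)%:~R]tk te.
have -> : (size p).-1 = size rs by rewrite (size_roots rsE).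
transitivity ((cS * cT)%:~R * \sum_(a <- rs) \sum_(b <- rs) (a == b)%:R : L); last first.
  rewrite rmorph_int [in RHS]intrM; congr (_ * _).
  rewrite big_seq (eq_bigr (fun => 1)) => [|a ar].
    by rewrite -big_seq big_const_seq count_predT iter_addr_0.
  by rewrite (bigD1_seq a) //= eqxx big1 ?addr0 // => b /negPf; rewrite eq_sym => ->.
rewrite rmorph_sum /=.
transitivity (\sum_(k < size p) iota p`_k * \sum_(i < k)
    (cS%:~R * \sum_(a <- rs) a ^+ (k.-1 - i)) *
    (cT%:~R * \sum_(b <- rs) (map_poly iota u).[b] * b ^+ i)).
  apply: eq_bigr => j _; rewrite rmorphM rmorph_sum; congr (_ * _).
  apply: eq_bigr => l _; rewrite rmorphM (trS _ _ _ rsE rsu) (trT _ _ _ rsE rsu).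
  congr (_ * _ * (_ * _)); apply: eq_bigr => a _.
    by rewrite map_polyXn hornerXn.
  by rewrite rmorphM /= hornerM map_polyXn hornerXn.
transitivity ((cS * cT)%:~R * \sum_(a <- rs) \sum_(b <- rs)
   ((map_poly iota u).[b] * (\sum_(k < size p) iota p`_k * \sum_(i < k) a ^+ (k.-1 - i) * b ^+ i)));
  last first.
  congr (_ * _); rewrite big_seq [RHS]big_seq; apply: eq_bigr => a ar.
  by rewrite big_seq [RHS]big_seq; apply: eq_bigr => b br; rewrite (root_bezoutian rsE).
have dist (f g : L -> L) : (\sum_(a <- rs) f a) * (\sum_(b <- rs) g b)
   = \sum_(a <- rs) \sum_(b <- rs) f a * g b.
  by rewrite mulr_suml; apply: eq_bigr => a _; rewrite mulr_sumr.
rewrite intrM.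
under eq_bigr => j _.
  under eq_bigr => l _ do rewrite mulrACA dist.
  rewrite -mulr_sumr exchange_big /=.
  under eq_bigr => a _ do rewrite exchange_big /=.
  rewrite mulrCA mulr_sumr.
  over.
rewrite -mulr_sumr exchange_big /=; congr (_ * _); apply: eq_bigr => a _.
under eq_bigr => j _ do rewrite mulr_sumr.
rewrite exchange_big /=; apply: eq_bigr => b _.
rewrite mulr_sumr; apply: eq_bigr => j _.
rewrite !mulr_sumr; apply: eq_bigr => l _; ring.
Qed.

End HomDim.

(** * Power series and reversed polynomials *)

Section Series.
Variable K : fieldType.
Hypothesis K0 : [pchar K] =i pred0.
Implicit Types (p q : {poly K}) (a b : nat -> K).

(** Congruence modulo ['X^N]: power series are handled through their
    truncations. *)
Definition eqX N p q := forall i, (i < N)%N -> p`_i = q`_i.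

Lemma eqX_mul N p p' q q' : eqX N p p' -> eqX N q q' -> eqX N (p * q) (p' * q').
Proof.
move=> e e' i iN; rewrite !coefM; apply: eq_bigr => j _.
by rewrite e ?e' // (leq_ltn_trans _ iN) // ?leq_subr // -ltnS.
Qed.

Lemma eqX_exp N p q k : eqX N p q -> eqX N (p ^+ k) (q ^+ k).
Proof. by move=> e; elim: k => // k IHk; rewrite !exprS; apply: eqX_mul. Qed.

Definition euler p := 'X * p^`().

Lemma coef_euler p i : (euler p)`_i = p`_i *+ i.
Proof. by rewrite /euler coefXM coef_deriv; case: i. Qed.

Lemma eulerM p q : euler (p * q) = euler p * q + p * euler q.
Proof. by rewrite /euler derivM; ring. Qed.

Lemma eulerD p q : euler (p + q) = euler p + euler q.
Proof. by rewrite /euler derivD mulrDr. Qed.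

(** The truncation of [\sum_(n > 0) a_n t ^ n]. *)
Definition trunc N a : {poly K} := \poly_(i < N) (if i == 0%N then 0 else a i).

Lemma coef_trunc N a i : (i < N)%N -> (trunc N a)`_i = if i == 0%N then 0 else a i.
Proof. by rewrite coef_poly => ->. Qed.

Lemma natS_neq0 n : n.+1%:R != 0 :> K.
Proof. by rewrite ((pcharf0P K).1 K0). Qed.

(** The coefficient of degree [i] of the equation gives [i p_i] from the lower
    ones, as the multiplier has no constant term. *)
Lemma euler_unique N p b : eqX N (euler p) (trunc N b * p) -> p`_0 = 0 ->
  forall i, (i < N)%N -> p`_i = 0.
Proof.
move=> e p0; elim/ltn_ind => -[//|i] IH iN.
have := e _ iN; rewrite coef_euler coefM big_ord_recl subn0 coef_trunc; last first.
  exact: leq_ltn_trans iN.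
rewrite mul0r add0r big1 => [|j _].
  by move/eqP; rewrite -mulr_natr mulf_eq0 (negPf (natS_neq0 _)) orbF => /eqP.
rewrite /= /bump add1n subSS IH ?mulr0 //; first by rewrite ltnS leq_subr.
by rewrite (leq_ltn_trans _ iN) // (leq_trans (leq_subr _ _)).
Qed.

(** The equation [t q' / q = - \sum_(n > 0) b_n t ^ n], solved by
    [\prod (1 - a t)] for [b_n = \sum a ^ n]. *)
Definition logderiv q b := q`_0 = 1 /\ forall N, eqX N (euler q) (- (trunc N b * q)).

Lemma logderiv1 : logderiv 1 (fun => 0).
Proof.
split=> [|N i iN]; first by rewrite coef1.
rewrite coef_euler coef1 coefN mulr1 coef_trunc //; case: i iN => [|i] _ /=.
  by rewrite mulr0n oppr0.
by rewrite mul0rn oppr0.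
Qed.

Lemma logderivM q q' b b' : logderiv q b -> logderiv q' b' ->
  logderiv (q * q') (fun n => b n + b' n).
Proof.
move=> [q0 qb] [q0' qb']; split; first by rewrite coef0M q0 q0' mulr1.
move=> N; have -> : trunc N (fun n => b n + b' n) = trunc N b + trunc N b'.
  apply/polyP => i; rewrite coefD !coef_poly.
  by case: (i < N)%N; case: (i == 0%N); rewrite ?addr0.
move=> i iN; rewrite eulerM coefD (eqX_mul (qb N) (fun _ _ => erefl) iN).
rewrite (eqX_mul (fun _ _ => erefl) (qb' N) iN) -coefD; apply: (congr1 (fun r : {poly K} => r`_i)); ring.
Qed.

Lemma logderivX q b n : logderiv q b -> logderiv (q ^+ n) (fun k => b k *+ n).
Proof.
move=> qb; elim: n => [|n IHn]; first exact: logderiv1.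
have [h0 h] := logderivM qb IHn; rewrite exprS; split=> // N i iN.
rewrite (h N i iN); apply: (congr1 (fun r => (- (r * (q * q ^+ n)))`_i)); apply/polyP => j; rewrite !coef_poly.
by case: (j < N)%N; case: (j == 0%N); rewrite ?mulrS.
Qed.

Lemma logderiv_neq0 q b : logderiv q b -> q != 0.
Proof.
move=> [q0 _]; apply/eqP => e; move: q0; rewrite e coef0 => /esym/eqP.
by rewrite oner_eq0.
Qed.

Definition exp_series a := series_exp (fun n => if n == 0%N then 0 else a n / n%:R).

Lemma coef_exp_low N p i : (i < N)%N -> p`_0 = 0 -> (p ^+ N)`_i = 0.
Proof.
move=> iN p0; have /dvdpP [q ->] : 'X %| p.
  by rewrite -['X]subr0 -polyC0 dvdp_XsubCl /root horner_coef0 p0.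
by rewrite exprMn coefMXn iN.
Qed.

Lemma exp_series0 a : exp_series a 0 = 1.
Proof.
by rewrite /exp_series /series_exp big_ord1 expr0 fact0 invr1 scale1r coef1.
Qed.

(** [u = exp(v)] satisfies [t u' = t v' u]. Truncating at degree [n], as in
    the definition of the exponential, leaves the coefficient of degree [n] unchanged. *)
Lemma exp_series_ode a N :
  eqX N (euler (\poly_(i < N) exp_series a i)) (trunc N a * \poly_(i < N) exp_series a i).
Proof.
case: N => [|N] //; set u := exp_series a.
pose v n := if n == 0%N then 0 else a n / n%:R.
pose V := \poly_(i < N.+1) v i.
pose E := \sum_(k < N.+1) (k`!%:R)^-1 *: V ^+ k.
have V0 : V`_0 = 0 by rewrite coef_poly.
have uE : eqX N.+1 (\poly_(i < N.+1) u i) E.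
  move=> n nN; rewrite coef_poly nN /u /exp_series /series_exp -/v !coef_sum.
  have VV : eqX n.+1 (\poly_(i < n.+1) v i) V.
    by move=> i ni; rewrite !coef_poly ni (leq_trans ni nN).
  rewrite (big_ord_widen N.+1 (fun k => ((k`!%:R)^-1 *: (\poly_(i < n.+1) v i) ^+ k)`_n) nN).
  rewrite big_mkcond; apply: eq_bigr => k _; rewrite !coefZ.
  case: ltnP => [kn|kn]; first by rewrite (eqX_exp k VV).
  by rewrite (coef_exp_low kn V0) mulr0.
have eV : euler V = trunc N.+1 a.
  apply/polyP => i; rewrite coef_euler !coef_poly; case: ifP => _; last by rewrite mul0rn.
  rewrite /v; case: i => [|i] //=.
  by rewrite -[LHS]mulr_natr divfK // natS_neq0.
have eE : eqX N.+1 (euler E) (trunc N.+1 a * E).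
  have eX k : euler (V ^+ k) = (trunc N.+1 a * V ^+ k.-1) *+ k.
    elim: k => [|k IHk]; first by rewrite expr0 mulr0n /euler derivC mulr0.
    rewrite exprS eulerM eV IHk mulrS; congr (_ + _).
    case: k {IHk} => [|k]; first by rewrite !mulr0n mulr0.
    by rewrite /= mulrnAr mulrCA -exprS.
  have -> : euler E = \sum_(k < N) (k`!%:R)^-1 *: (trunc N.+1 a * V ^+ k).
    rewrite /E (big_morph euler eulerD (id1 := 0)); last by rewrite /euler deriv0 mulr0.
    rewrite big_ord_recl /= expr0 /euler derivZ derivC scaler0 mulr0 add0r.
    apply: eq_bigr => k _; rewrite -/(euler _).
    have -> : euler ((bump 0 k)`!%:R^-1 *: V ^+ bump 0 k)
       = (bump 0 k)`!%:R^-1 *: euler (V ^+ bump 0 k).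
      by rewrite /euler derivZ scalerAr.
    rewrite eX /bump /= add1n factS natrM invfM -[X in _ *: X]scaler_nat scalerA.
    by congr (_ *: _); rewrite mulrAC mulVf ?mul1r ?natS_neq0.
  move=> i iN; rewrite /E big_ord_recr /= mulrDr mulr_sumr coefD.
  have -> : (trunc N.+1 a * ((N`!%:R)^-1 *: V ^+ N))`_i = 0.
    rewrite -scalerAr coefZ coefM big_ord_recl coef_trunc // mul0r add0r big1 ?mulr0 //.
    move=> j _; rewrite (coef_exp_low _ V0) ?mulr0 //.
    by rewrite /= /bump add1n (leq_trans _ (iN : (i <= N)%N)) // ltn_subrL /= (leq_ltn_trans _ (ltn_ord j)).
  by rewrite addr0; apply: (congr1 (fun r : {poly K} => r`_i)); apply: eq_bigr => k _; rewrite scalerAr.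
move=> i iN; rewrite coef_euler (uE i iN) -coef_euler (eE i iN).
by apply: esym; apply: (eqX_mul (fun _ _ => erefl) uE).
Qed.

(** Both [Q exp(v)] and [P] solve the same first order equation, and have the
    same constant term. *)
Lemma exp_series_quotient a P Q bP bQ : logderiv P bP -> logderiv Q bQ ->
  (forall n, (0 < n)%N -> a n = bQ n - bP n) ->
  forall n, \sum_(i < n.+1) Q`_i * exp_series a (n - i)%N = P`_n.
Proof.
move=> [P0 hP] [Q0 hQ] aE n; pose N := n.+1.
pose u := \poly_(i < N) exp_series a i.
have -> : \sum_(i < n.+1) Q`_i * exp_series a (n - i)%N = (Q * u)`_n.
  by rewrite coefM; apply: eq_bigr => i _; rewrite coef_poly ltnS leq_subr.
apply/eqP; rewrite -subr_eq0 -coefB; apply/eqP.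
apply: (@euler_unique N _ (fun k => - bP k)) => //; last first.
  by rewrite coefB coef0M Q0 P0 coef_poly /= exp_series0 mulr1 subrr.
have tE : trunc N a = trunc N bQ - trunc N bP.
  apply/polyP => i; rewrite coefB !coef_poly; case: (i < N)%N; last by rewrite subrr.
  by case: (posnP i) => [_|/aE ->]; rewrite ?subrr.
have tN : trunc N (fun k => - bP k) = - trunc N bP.
  by apply/polyP => i; rewrite coefN !coef_poly; case: (i < N)%N; case: (i == 0%N); rewrite ?oppr0.
have eB p q : euler (p - q) = euler p - euler q by rewrite /euler derivB mulrBr.
move=> i iN; rewrite eB coefB eulerM coefD (hP N i iN).
rewrite (eqX_mul (hQ N) (fun _ _ => erefl) iN).
rewrite (eqX_mul (fun _ _ => erefl) (@exp_series_ode a N) iN) -/u tE tN.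
rewrite -coefD -coefB; apply: (congr1 (fun r : {poly K} => r`_i)); ring.
Qed.

(** Two representations [p / q] and [p' / q'] of a series satisfy [p q' = p' q]. *)
Lemma ord_at_one_unique (u : nat -> K) m m' :
  ord_at_one u m -> ord_at_one u m' -> m = m'.
Proof.
move=> [p [q [p0 q0 pq ->]]] [p' [q' [p0' q0' pq' ->]]].
have e : p * q' = p' * q.
  apply/polyP => n; pose V := \poly_(i < n.+1) u i.
  have h (r s : {poly K}) : (forall n, \sum_(i < n.+1) r`_i * u (n - i)%N = s`_n) ->
      eqX n.+1 (r * V) s.
    move=> rs i ni; rewrite -rs coefM; apply: eq_bigr => j _.
    by rewrite coef_poly (leq_ltn_trans (leq_subr _ _) ni).
  rewrite -(eqX_mul (h _ _ pq) (fun _ _ => erefl) (ltnSn n)).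
  rewrite -(eqX_mul (h _ _ pq') (fun _ _ => erefl) (ltnSn n)).
  by apply: (congr1 (fun r : {poly K} => r`_n)); ring.
have := congr1 (mup 1) e; rewrite !mupM // => em.
by apply/eqP; rewrite subr_eq addrAC eq_sym subr_eq -!PoszD em.
Qed.

Lemma coef_reverse p i : (reverse_poly p)`_i
  = if (i < size p)%N then p`_((size p).-1 - i) else 0.
Proof. by rewrite coef_poly. Qed.

Lemma reverse_XsubC c p : p != 0 ->
  reverse_poly (('X - c%:P) * p) = (1 - c *: 'X) * reverse_poly p.
Proof.
rewrite -size_poly_gt0 => p0; apply/polyP => i.
have -> : ((1 - c *: 'X) * reverse_poly p)`_i
    = (reverse_poly p)`_i - c * (if i == 0%N then 0 else (reverse_poly p)`_i.-1).
  by rewrite mulrBl mul1r -scalerAl coefB coefZ coefXM.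
have sE : size (('X - c%:P) * p) = (size p).+1.
  by rewrite mulrC size_Mmonic ?monicXsubC ?size_XsubC ?addn2 // -size_poly_gt0.
rewrite !coef_reverse sE mulrBl coefB coefXM coefCM ltnS /= subn_eq0.
case: i => [|i] /=.
  by rewrite !subn0 p0 leqNgt p0 (nth_default 0 (leqnn _)).
case: (ltnP i (size p)) => [ip|pi]; last first.
  by rewrite [(i.+1 < _)%N]ltnNge (leq_trans pi (leqnSn i)) /= mulr0 subr0.
have -> : (size p - i.+1 = (size p).-1 - i)%N by rewrite subnS -predn_sub.
by case: ltnP => _; rewrite ?subnS.
Qed.

Lemma reverse_at1 p : (reverse_poly p).[1] = p.[1].
Proof.
rewrite (horner_coef_wide _ (size_poly _ _)) horner_coef (reindex_inj rev_ord_inj) /=.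
apply: eq_bigr => i _; rewrite !expr1n coef_reverse; have := ltn_ord (rev_ord i) => /= ->.
have sp : (size p).-1 = (i + (size p - i.+1))%N.
  by rewrite -{1}(subnKC (ltn_ord i)) addSn.
by rewrite sp addnK.
Qed.

End Series.

Lemma reverse_prod_XsubC (L : fieldType) (rs : seq L) :
  reverse_poly (\prod_(a <- rs) ('X - a%:P)) = \prod_(a <- rs) (1 - a *: 'X).
Proof.
elim: rs => [|a rs IHrs].
  rewrite !big_nil; apply/polyP => i; rewrite coef_reverse size_poly1 coef1.
  by case: i => [|i] //=; rewrite coef1.
by rewrite !big_cons reverse_XsubC ?IHrs // monic_neq0 // monic_prod_XsubC.
Qed.

Lemma map_reverse (K L : fieldType) (iota : {rmorphism K -> L}) (p : {poly K}) :
  map_poly iota (reverse_poly p) = reverse_poly (map_poly iota p).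
Proof.
apply/polyP => i; rewrite coef_map !coef_reverse size_map_poly coef_map /=.
by case: ifP => _; rewrite ?rmorph0.
Qed.

Lemma reverse_reverse (K : fieldType) (p : {poly K}) : p`_0 != 0 ->
  reverse_poly (reverse_poly p) = p.
Proof.
move=> p0; have sp : (0 < size p)%N.
  by rewrite lt0n size_poly_eq0; apply: contraNneq p0 => ->; rewrite coef0.
have sE : size (reverse_poly p) = size p.
  apply/eqP; rewrite eqn_leq size_poly /= -(prednK sp) -[(_ < _)%N]negbK -leqNgt.
  apply/negP => le; move: p0; have := nth_default 0 le.
  by rewrite coef_reverse ltn_predL sp subnn => ->; rewrite eqxx.
apply/polyP => i; rewrite coef_reverse sE; case: ltnP => [ip|]; last by move/(nth_default 0).
rewrite coef_reverse (leq_ltn_trans (leq_subr _ _)) ?ltn_predL // subKn //.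
by rewrite -ltnS prednK.
Qed.

Section RootLogDeriv.
Variables (K L : fieldType) (iota : {rmorphism K -> L}).

(** Newton's identities. *)
Lemma logderiv_roots (rs : seq L) :
  logderiv (\prod_(a <- rs) (1 - a *: 'X)) (fun n => \sum_(a <- rs) a ^+ n).
Proof.
elim: rs => [|a rs IHrs].
  rewrite big_nil; have [h0 h] := logderiv1 L; split=> // N i iN; rewrite (h N i iN).
  apply: (congr1 (fun r : {poly L} => (- (r * 1))`_i)); apply/polyP => j; rewrite !coef_poly.
  by rewrite big_nil.
rewrite big_cons.
have la : logderiv (1 - a *: 'X) (fun n => a ^+ n).
  split=> [|N i iN]; first by rewrite coefB coef1 coefZ coefX mulr0 subr0.
  set t := trunc _ _.
  have tE : (t * (1 - a *: 'X))`_i = t`_i - a * (if i == 0%N then 0 else t`_i.-1).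
    by rewrite mulrC mulrBl mul1r -scalerAl coefB coefZ coefXM.
  rewrite coef_euler coefN tE coefB coef1 coefZ coefX coef_trunc //.
  case: i iN {tE} => [|i] iN /=; first by rewrite mulr0n mulr0 subr0 oppr0.
  rewrite coef_trunc ?(ltn_trans _ iN) //.
  case: i iN => [|i] _ /=; first by rewrite mulr1n mulr1 mulr0 subr0 sub0r expr1.
  by rewrite mulr0 subr0 mul0rn -exprS subrr oppr0.
have [h0 h] := logderivM la IHrs; split=> // N i iN; rewrite (h N i iN).
apply: (congr1 (fun r : {poly L} => (- (r * ((1 - a *: 'X) * \prod_(a0 <- rs) (1 - a0 *: 'X))))`_i)).
by apply/polyP => j; rewrite !coef_poly big_cons.
Qed.

Lemma logderiv_map (q : {poly K}) (b : nat -> K) :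
  logderiv (map_poly iota q) (iota \o b) -> logderiv q b.
Proof.
move=> [q0 h]; split.
  by apply: (fmorph_inj iota); rewrite rmorph1 -q0 coef_map.
move=> N i iN; apply: (fmorph_inj iota).
rewrite coef_euler rmorphMn /= -coef_map -coef_euler (h N i iN) -coef_map rmorphN rmorphM /=.
apply: (congr1 (fun r : {poly L} => (- (r * map_poly iota q))`_i)).
apply/polyP => j; rewrite coef_map !coef_poly.
by case: (j < N)%N; case: (j == 0%N) => /=; rewrite ?rmorph0.
Qed.

End RootLogDeriv.

(** * The zeta function as a rational function *)

Section Zeta.
Variables (K : fieldType) (C : rigid_category K).
Hypotheses (K0 : [pchar K] =i pred0) (C_ss : semisimple_category C).
Hypotheses (C_psab : pseudo_abelian C) (C_int : integral_type C).
Variable F : tensor_aut C.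
Local Notation U := (one_obj C).
Implicit Types M N S T : C.

Let C_add := rcat_additive C.

Lemma trace_dataP S : simple_object S -> exists p c, trace_data F S p c.
Proof.
move=> Ss; have [p [m [d [r [[pi pm pS] _ c0 tr _]]]]] := simple_data K0 C_ss C_psab C_int F Ss.
by exists p, (m * (d * r)%:Z).
Qed.

Lemma taut_exp M n : F M ^+ n = endo_horner 'X^n (F M).
Proof. by rewrite endo_hornerXn. Qed.

Lemma ctrace_biproduct M N B h : biproduct M N B ->
  ctrace (endo_horner h (F B)) = ctrace (endo_horner h (F M)) + ctrace (endo_horner h (F N)).
Proof.
move=> [i [j [p [q [pi qj pj qi ijE]]]]].
have -> : endo_horner h (F B) = i ∘ ((endo_horner h (F M) : mor _ _) ∘ p)
                              + j ∘ ((endo_horner h (F N) : mor _ _) ∘ q) :> endo B.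
  rewrite -[LHS]compm1 -ijE compDr !compA.
  by rewrite !(taut_horner_nat F) -!compA.
rewrite ctraceD !(ctraceC _ i) !(ctraceC _ j) -!compA pi qj.
by rewrite !compm1.
Qed.

Lemma ctrace_iso M N h : isomorphic M N ->
  ctrace (endo_horner h (F M)) = ctrace (endo_horner h (F N)).
Proof.
move=> [i]; rewrite -[endo_horner h (F M)](compm1 (_ : mor M M)) -(bwdK i) compA.
by rewrite (ctraceC i) compA -(taut_horner_nat F) -compA fwdK compm1.
Qed.

Lemma ctrace_zero M (f : endo M) : idm M = 0 -> ctrace f = 0.
Proof. by move=> M0; rewrite -[f](compm1 (f : mor M M)) M0 compm0 ctrace0. Qed.

Lemma trace_data_rank S p c : trace_data F S p c ->
  ctrace (idm S : endo S) = c%:~R * (size p).-1%:R.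
Proof.
move=> [pi pm _ _ trS].
have [L [iota [rs [rsE rsu]]]] := irreducible_split K0 pi pm.
have -> : (idm S : endo S) = endo_horner 1 (F S) by rewrite endo_horner1.
apply: (fmorph_inj iota); rewrite (trS _ _ _ rsE rsu).
rewrite rmorphM rmorph_int -(size_roots rsE) rmorph_nat; congr (_ * _).
rewrite big_seq (eq_bigr (fun => 1)) => [|a _]; last by rewrite rmorph1 hornerC.
by rewrite -big_seq big_const_seq count_predT iter_addr_0.
Qed.

Lemma trace_data_rank_neq0 S p c : trace_data F S p c -> ctrace (idm S : endo S) != 0.
Proof.
move=> d; rewrite (trace_data_rank d); have [[p1 _] _ c0 _ _] := d.
apply: mulf_neq0; last by rewrite ((pcharf0P K).1 K0); case: (size p) p1 => [|[|]].
by apply: contra_neq c0 => e; apply: (intr_inj_char0 K0).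
Qed.

Lemma trace_data_id S p c : simple_object S -> trace_data F S p c -> F S = idm S ->
  p = 'X - 1%:P.
Proof.
move=> Ss [pi pm _ pS _] FS.
have : p %| 'X - 1%:P.
  apply/pS; rewrite endo_hornerB endo_hornerX FS.
  by rewrite -[1%:P]/(1 : {poly K}) endo_horner1 subrr.
move=> pd; apply/eqP; rewrite -eqp_monic ?monicXsubC //.
by rewrite -dvdp_size_eqp // size_XsubC eqn_leq -{1}(size_XsubC (1 : K)) dvdp_leq ?polyXsubC_eq0 ?pi.1.
Qed.

Lemma trace_data_root1 S p c : trace_data F S p c -> F S <> idm S -> ~~ root p 1.
Proof.
move=> [pi pm _ pS _] FS; apply/negP; rewrite -dvdp_XsubCl => d.
apply: FS; have pX : 'X - 1%:P %= p by apply: pi.2; rewrite ?size_XsubC.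
have := (pS ('X - 1%:P)).2; rewrite (eqp_dvdr _ pX) dvdpp => /(_ isT).
rewrite endo_hornerB endo_hornerX -[1%:P]/(1 : {poly K}) endo_horner1 => /eqP.
by rewrite subr_eq0 => /eqP.
Qed.

Lemma mup_exp (x : K) (q : {poly K}) n : q != 0 -> mup x (q ^+ n) = (n * mup x q)%N.
Proof.
move=> q0; elim: n => [|n IHn]; first by rewrite expr0 mupNroot // root1.
by rewrite exprS mupM ?expf_neq0 // IHn mulSn.
Qed.

(** [Z(M, t) = P / Q] with [P] and [Q] of constant term [1]. *)
Definition zeta_fraction M (P Q : {poly K}) := exists bP bQ,
  [/\ logderiv P bP, logderiv Q bQ
    & forall n, (0 < n)%N -> ctrace (F M ^+ n) = bQ n - bP n].

Lemma zeta_fraction_ord M P Q : zeta_fraction M P Q ->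
  ord_at_one (zeta F M) ((mup 1 P)%:Z - (mup 1 Q)%:Z).
Proof.
move=> [bP [bQ [hP hQ tr]]]; exists P, Q; split=> //.
- exact: logderiv_neq0 hP.
- exact: logderiv_neq0 hQ.
exact: (exp_series_quotient K0 (a := fun n => ctrace (F M ^+ n)) hP hQ).
Qed.

(** [Z(S, t) = P_S(t) ^ (-c)], where [c] may have either sign. *)
Lemma zeta_fraction_simple S p c : trace_data F S p c -> exists P Q,
  zeta_fraction S P Q /\
  (mup 1 P)%:Z - (mup 1 Q)%:Z = - (c * (mup 1 (reverse_poly p))%:Z).
Proof.
move=> [pi pm c0 _ trS].
have [L [iota [rs [rsE rsu]]]] := irreducible_split K0 pi pm.
have cK : c%:~R != 0 :> K by apply: contra_neq c0 => e; apply: (intr_inj_char0 K0).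
pose b n := ctrace (F S ^+ n) / c%:~R; set q := reverse_poly p.
have trb n : ctrace (F S ^+ n) = c%:~R * b n by rewrite mulrC divfK.
have qb : logderiv q b.
  apply: (logderiv_map (iota := iota)); rewrite map_reverse rsE reverse_prod_XsubC.
  have [h0 h] := logderiv_roots rs; split=> // N i iN; rewrite (h N i iN).
  apply: (congr1 (fun r : {poly L} => (- (r * (\prod_(a <- rs) (1 - a *: 'X))))`_i)).
  apply/polyP => j; rewrite !coef_poly /= /b fmorph_div rmorph_int taut_exp.
  rewrite (trS _ _ _ rsE rsu) mulrC mulKf; last first.
    by apply: contra_neq cK => e; apply: (fmorph_inj iota); rewrite rmorph_int rmorph0.
  by under [in RHS]eq_bigr => a _ do rewrite map_polyXn hornerXn.
have q0 := logderiv_neq0 qb.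
case: c {c0 trS cK} @b trb qb => k b trb qb.
  exists 1, (q ^+ k); split; last by rewrite mup_exp // mupNroot ?root1 // sub0r PoszM.
  exists (fun => 0), (fun n => b n *+ k); split; [exact: logderiv1|exact: logderivX|].
  by move=> n _; rewrite trb subr0 mulr_natl.
exists (q ^+ k.+1), 1; split.
  exists (fun n => b n *+ k.+1), (fun => 0); split; [exact: logderivX|exact: logderiv1|].
  by move=> n _; rewrite trb sub0r NegzE mulrNz mulNr mulr_natl.
by rewrite mup_exp // (mupNroot (q := 1)) ?root1 // subr0 NegzE mulNr opprK PoszM.
Qed.

Lemma zeta_fraction_sum M N B P Q P' Q' : biproduct M N B ->
  zeta_fraction M P Q -> zeta_fraction N P' Q' -> zeta_fraction B (P * P') (Q * Q').
Proof.
move=> bp [bP [bQ [hP hQ tr]]] [bP' [bQ' [hP' hQ' tr']]].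
exists (fun n => bP n + bP' n), (fun n => bQ n + bQ' n).
split; [exact: logderivM|exact: logderivM|] => n n0.
by rewrite taut_exp (ctrace_biproduct _ bp) -!taut_exp tr // tr' // opprD addrACA.
Qed.

Lemma mup_reverse_id S p c : simple_object S -> trace_data F S p c -> F S = idm S ->
  mup 1 (reverse_poly p) = 1%N.
Proof.
move=> Ss d /(trace_data_id Ss d) ->.
rewrite -[X in reverse_poly X]mulr1 reverse_XsubC ?oner_neq0 //.
have -> : reverse_poly (1 : {poly K}) = 1.
  apply/polyP => i; rewrite coef_reverse size_poly1 coef1.
  by case: i => [|i] //=; rewrite coef1.
have -> : (1 - 1 *: 'X) * 1 = (-1)%:P * ('X - 1%:P) ^+ 1 :> {poly K}.
  by rewrite scale1r expr1 polyCN !polyC1; ring.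
by rewrite mupMr ?rootC ?oppr_eq0 ?oner_eq0 // mup_XsubCX eqxx.
Qed.

Lemma mup_reverse_not_id S p c : trace_data F S p c -> F S <> idm S ->
  mup 1 (reverse_poly p) = 0%N.
Proof.
move=> d FS; apply: mupNroot; rewrite /root reverse_at1.
exact: trace_data_root1 d FS.
Qed.

End Zeta.

(** * Consequences of the separation of simple objects *)

Section Equivalences.
Variables (K : fieldType) (C : rigid_category K).
Hypotheses (K0 : [pchar K] =i pred0) (C_ss : semisimple_category C).
Hypotheses (C_psab : pseudo_abelian C) (C_int : integral_type C).
Variable F : tensor_aut C.
Local Notation U := (one_obj C).
Implicit Types M N S T : C.

Let C_add := rcat_additive C.
Let dataP := trace_dataP K0 C_ss C_psab C_int F.
Let schur' := schur_iso C_add C_ss C_psab.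
Let dec := decomposable_all C_ss C_psab C_int.

Definition fixes_only_one :=
  forall S, simple_object S -> F S = idm S -> isomorphic S U.

Definition separates_simples := forall S T p cS cT,
  simple_object S -> simple_object T -> trace_data F S p cS -> trace_data F T p cT ->
  isomorphic S T.

Lemma taut_id_of_one S (v : mor U S) : simple_object S -> v <> 0 -> F S = idm S.
Proof.
move=> Ss v0; have [i iE] := schur C_add C_ss C_psab (one_simple C_ss) Ss v0.
by apply: (iso_epi (i := i)); rewrite (taut_nat F) taut_one compm1 comp1m.
Qed.

(** Both sides count the simple summands isomorphic to [1]: the others are not
    fixed by [F], hence contribute no zero or pole at [1]. *)
Lemma zeta_order_hom M : fixes_only_one -> exists d P Q,
  [/\ has_dim (mor U M) d, zeta_fraction F M P Q
    & (mup 1 P)%:Z - (mup 1 Q)%:Z = - d%:Z].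
Proof.
move=> hi; elim: (dec M) => {M} [M M0|S Ss|M N B bp _ [d [P [Q [dd z e]]]] _ [d' [P' [Q' [dd' z' e']]]]].
- exists 0%N, 1, 1; split=> //; last by rewrite subrr oppr0.
    by apply: has_dim0 => v; rewrite -[v]comp1m M0 comp0m.
  exists (fun => 0), (fun => 0); split; try exact: logderiv1.
  by move=> n _; rewrite subr0 ctrace_zero.
- have [p [c D]] := dataP Ss; have [P [Q [z e]]] := zeta_fraction_simple K0 D.
  have [FS|FS] := classic (F S = idm S); last first.
    exists 0%N, P, Q; split=> //; last by rewrite e (mup_reverse_not_id D FS) mulr0.
    apply: has_dim0 => v; apply: NNPP => v0; apply: FS; exact: taut_id_of_one v0.
  exists 1%N, P, Q; split=> //.
    have [i] := isomorphic_sym (hi S Ss FS).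
    apply: (has_dim1 (v := fwd i)).
      by apply/eqP; apply: iso_neq0; case: (one_simple C_ss).
    move=> x; exists (one_scalar (bwd i ∘ x)).
    by rewrite -[fwd i]compm1 -compZr one_scalarE compA fwdK comp1m.
  (* [c = 1], because [S] and [1] have the same dimension. *)
  rewrite e (mup_reverse_id Ss D FS) mulr1; congr (- _); apply: (intr_inj_char0 K0).
  have := ctrace_iso F 1 (hi S Ss FS); rewrite !endo_horner1.
  rewrite [X in _ = X](ctrace_one C) (trace_data_rank K0 D) (trace_data_id Ss D FS).
  by rewrite size_XsubC mulr1.
exists (d + d')%N, (P * P'), (Q * Q'); split.
- exact: has_dim_biproduct bp dd dd'.
- exact: zeta_fraction_sum bp z z'.
have [[? [? [hP hQ _]]] [? [? [hP' hQ' _]]]] := (z, z').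
rewrite !mupM ?(logderiv_neq0 hP) ?(logderiv_neq0 hQ) ?(logderiv_neq0 hP')
  ?(logderiv_neq0 hQ') //.
by rewrite !PoszD !opprD addrACA e e'.
Qed.

(** On a fixed simple object the order is [- c], which is not [0]. *)
Lemma order_fixes_only_one :
  (forall M, exists d : nat, has_dim (mor U M) d /\ ord_at_one (zeta F M) (- d%:Z)) ->
  fixes_only_one.
Proof.
move=> hii S Ss FS; have [p [c D]] := dataP Ss.
have [P [Q [z e]]] := zeta_fraction_simple K0 D.
have [d [dd od]] := hii S.
have := ord_at_one_unique od (zeta_fraction_ord K0 z).
rewrite e (mup_reverse_id Ss D FS) mulr1 => /oppr_inj dc.
have d0 : d != 0%N.
  by have [_ _ c0 _ _] := D; apply: contraNneq c0 => d0; rewrite -dc d0.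
have [v v0] := has_dim_neq0 dd d0.
exact/isomorphic_sym/(schur' (one_simple C_ss) Ss v0).
Qed.

(** [hom_dim] shows that [Hom(T, S)] is not zero. *)
Lemma fixes_only_one_separates : fixes_only_one -> separates_simples.
Proof.
move=> hi S T p cS cT Ss Ts dS dT.
have [k [dk kE]] := hom_dim K0 C_ss C_psab C_int hi dS dT.
have k0 : k != 0%N.
  have [[p1 _] _ cS0 _ _] := dS; have [_ _ cT0 _ _] := dT.
  rewrite -eqz_nat kE; apply: mulf_neq0; first exact: mulf_neq0.
  by case: (size p) p1 => [|[|]].
have [v v0] := has_dim_neq0 dk k0.
exact/isomorphic_sym/(schur' Ts Ss v0).
Qed.

(** For [T = S], [hom_dim] says that [(m d r) ^ 2 deg p] is the dimension
    [d ^ 2 r deg p] of [End(S)], whence [m ^ 2 r = 1]. *)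
Lemma simple_multiplicity S : fixes_only_one -> simple_object S ->
  (exists m : int, has_multiplicity S m /\ `|m| = 1) /\ generates_center (F S).
Proof.
move=> hi Ss.
have [p [m [d [r [[pi pm pS] hm c0 tr [A [phi [phil phib dA gc]]]]]]]] :=
  simple_data K0 C_ss C_psab C_int F Ss.
have D : trace_data F S p (m * (d * r)%:Z) by [].
have [k [dk kE]] := hom_dim K0 C_ss C_psab C_int hi D D.
have dAk : \dim {:A} = k by apply: has_dim_vect; apply: (has_dim_bij phil phib dk).
have [d0 r0] : d != 0%N /\ r != 0%N.
  by move: c0; rewrite mulf_eq0 negb_or eqz_nat muln_eq0 negb_or => /andP [_ /andP].
have n0 : ((size p).-1 != 0)%N by move: pi.1; case: (size p) => [|[|]].
have mr : m ^+ 2 * r%:Z = 1.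
  have cancel0 : (d ^ 2 * (r * (size p).-1))%N%:Z != 0.
    by rewrite eqz_nat !muln_eq0 !negb_or d0 r0 n0.
  apply: (mulIf cancel0); rewrite mul1r.
  have e : (d ^ 2 * (r * (size p).-1))%N%:Z = m * (d * r)%:Z * (m * (d * r)%:Z) * (size p).-1%:Z.
    by rewrite -dA dAk kE.
  rewrite [RHS]e -mulnn !PoszM; ring.
have [m1 r1] : `|m| = 1 /\ r = 1%N.
  have := congr1 absz mr; rewrite abszM abszX absz1 /= => /eqP.
  rewrite -mulnn !muln_eq1 => /andP [/andP [/eqP m1 _] /eqP ->]; split=> //.
  by rewrite -abszE m1.
split; last exact: gc.
by exists m.
Qed.

Lemma trace_data_coprime S T p q cS cT : separates_simples -> simple_object S -> simple_object T ->
  trace_data F S p cS -> trace_data F T q cT -> ~ isomorphic S T -> coprimep p q.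
Proof.
move=> sep Ss Ts dS dT nST.
have [pi pm _ _ _] := dS; have [qi qm _ _ _] := dT.
apply: coprime_irreducible => //; apply/eqP => pq; apply: nST.
by rewrite -pq in dT; apply: (sep S T p cS cT).
Qed.

Lemma trace_data_coef0 S p c : simple_object S -> trace_data F S p c -> p`_0 != 0.
Proof.
move=> Ss [pi pm _ pS _]; apply/negP => /eqP p0.
have pX : 'X %= p.
  by apply: pi.2; rewrite ?size_polyX // -['X]subr0 -polyC0 dvdp_XsubCl /root horner_coef0 p0.
have := (pS 'X).2; rewrite (eqp_dvdr _ pX) dvdpp endo_hornerX => /(_ isT) FS.
have [g [gF _]] := taut_iso F S; apply: Ss.1.
by rewrite -gF FS compm0.
Qed.

(** On [B], [h(F)] is the projector onto the [S]-isotypic part. The divisibility by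
    ['X] lets only the traces of [F ^ n] with [n > 0] enter. *)
Lemma isotypic_poly S p c B : separates_simples -> simple_object S -> trace_data F S p c ->
  exists h, [/\ p %| h - 1, 'X %| h
    & forall T (x : mor T B), simple_object T -> ~ isomorphic S T -> x <> 0 ->
        endo_horner h (F T) = 0].
Proof.
move=> sep Ss dS.
have step (h h' : {poly K}) : p %| h - 1 -> p %| h' - 1 -> p %| h * h' - 1.
  move=> ph ph'; have -> : h * h' - 1 = h * (h' - 1) + (h - 1) by ring.
  by rewrite dvdp_addr // dvdp_mull.
have [h0 /andP [ph0 Xh0]] : exists h, (p %| h - 1) && ('X %| h).
  apply: crt_idempotent; rewrite -['X]subr0 -polyC0 coprimep_XsubC.
  by rewrite /root horner_coef0; apply: trace_data_coef0 dS.
suff [h [ph hT]] : exists h, p %| h - 1 /\ forall T (x : mor T B),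
    simple_object T -> ~ isomorphic S T -> x <> 0 -> endo_horner h (F T) = 0.
  exists (h0 * h); split; [exact: step|by rewrite dvdp_mulr|].
  by move=> T x Ts nST x0; rewrite endo_hornerM (hT T x) // mulr0.
elim: (dec B) => {B} [M M0|T Ts|M N B [i [j [q [q' [_ _ _ _ ijE]]]]] _ [h [ph hT]] _ [h' [ph' hT']]].
- exists 1; rewrite subrr dvdp0; split=> // T x _ _ [].
  by rewrite -[x]comp1m M0 comp0m.
- have [ST|ST] := classic (isomorphic S T).
    exists 1; rewrite subrr dvdp0; split=> // T' x Ts' nST x0; case: nST.
    by apply: isomorphic_trans ST _; apply/isomorphic_sym/(schur' Ts' Ts x0).
  have [q [cT dT]] := dataP Ts.
  have [h /andP [ph qh]] := crt_idempotent (trace_data_coprime sep Ss Ts dS dT ST).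
  exists h; split=> // T' x Ts' _ x0.
  have [i iE] := schur C_add C_ss C_psab Ts' Ts x0.
  apply: (iso_mono (i := i)); rewrite compm0 -(taut_horner_nat F).
  by have [_ _ _ pT _] := dT; rewrite (pT h).2 // comp0m.
exists (h * h'); split; first exact: step.
move=> T x Ts nST x0; have [xi|xi] := classic (q ∘ x = 0).
  have [xj|xj] := classic (q' ∘ x = 0); last by rewrite endo_hornerM (hT' T _ Ts nST xj) mulr0.
  by case: x0; rewrite -[x]comp1m -ijE compDl -!compA xi xj !compm0 addr0.
by rewrite endo_hornerM (hT T _ Ts nST xi) mul0r.
Qed.

(** [k] is the multiplicity of [S] in [M]. *)
Lemma isotypic_trace S p c h M : simple_object S -> trace_data F S p c -> p %| h - 1 ->
  (forall T (x : mor T M), simple_object T -> ~ isomorphic S T -> x <> 0 ->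
        endo_horner h (F T) = 0) ->
  exists k : nat, ctrace (endo_horner h (F M)) = k%:R * ctrace (idm S : endo S) /\
    (k = 0%N <-> forall x : mor S M, x = 0).
Proof.
move=> Ss dS ph.
have hS : endo_horner h (F S) = idm S.
  have [_ _ _ pS _] := dS; have := (pS _).2 ph; rewrite endo_hornerB endo_horner1.
  by move/eqP; rewrite subr_eq0 => /eqP.
elim: (dec M) => {M} [M M0 _|T Ts hT|M N B bp _ IHM _ IHN hT].
- exists 0%N; rewrite ctrace_zero // mul0r; split=> //; split=> // _ x.
  by rewrite -[x]comp1m M0 comp0m.
- have [ST|ST] := classic (isomorphic S T).
    exists 1%N; rewrite -(ctrace_iso F h ST) hS mul1r; split=> //; split=> // x0.
    by have [i] := ST; case: (iso_neq0 (i := i) Ss.1 (x0 i)).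
  exists 0%N; rewrite (hT T (idm T) Ts ST Ts.1) ctrace0 mul0r; split=> //.
  by split=> // _ x; apply: NNPP => x0; apply: ST; apply: schur' x0.
have [i [j [p' [q [pi qj _ _ ijE]]]]] := bp.
have [|k [kE k0]] := IHM.
  move=> T x Ts nST x0; apply: (hT T (i ∘ x)) => // e; apply: x0.
  by rewrite -[x]comp1m -pi -compA e compm0.
have [|l [lE l0]] := IHN.
  move=> T x Ts nST x0; apply: (hT T (j ∘ x)) => // e; apply: x0.
  by rewrite -[x]comp1m -qj -compA e compm0.
exists (k + l)%N; rewrite (ctrace_biproduct _ _ bp) kE lE natrD mulrDl; split=> //.
split=> [/eqP|x0].
  rewrite addn_eq0 => /andP [/eqP /k0 kx /eqP /l0 lx] x.
  by rewrite -[x]comp1m -ijE compDl -!compA (kx (p' ∘ x)) (lx (q ∘ x)) !compm0 addr0.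
have -> : k = 0%N.
  by apply: k0.2 => x; rewrite -[x]comp1m -pi -compA (x0 (i ∘ x)) compm0.
have -> : l = 0%N by apply: l0.2 => x; rewrite -[x]comp1m -qj -compA (x0 (j ∘ x)) compm0.
by [].
Qed.

Definition same_traces M N := forall n, (0 < n)%N -> ctrace (F M ^+ n) = ctrace (F N ^+ n).

Lemma same_traces_horner M N h : same_traces M N -> 'X %| h ->
  ctrace (endo_horner h (F M)) = ctrace (endo_horner h (F N)).
Proof.
move=> tMN /dvdpP [u ->]; rewrite -[u]coefK poly_def mulr_suml !endo_horner_sum !ctrace_sum.
apply: eq_bigr => i _; rewrite -scalerAl -exprSr !endo_hornerZ !ctraceZ !endo_hornerXn.
by rewrite tMN.
Qed.

(** In characteristic [0] the trace of the isotypic projector detects whether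
    [S] occurs. *)
Lemma same_traces_simple M N S (x : mor S M) : separates_simples -> same_traces M N ->
  simple_object S -> x <> 0 -> exists y : mor S N, y <> 0.
Proof.
move=> sep tMN Ss x0; have [p [c dS]] := dataP Ss.
have [B bp] := C_add.2 M N; have [i [j [q [q' [qi q'j _ _ _]]]]] := bp.
have [h [ph Xh hT]] := isotypic_poly B sep Ss dS.
have [|k [kE k0]] := isotypic_trace (M := M) Ss dS ph.
  move=> T y Ts nST y0; apply: (hT T (i ∘ y)) => // e; apply: y0.
  by rewrite -[y]comp1m -qi -compA e compm0.
have [|l [lE l0]] := isotypic_trace (M := N) Ss dS ph.
  move=> T y Ts nST y0; apply: (hT T (j ∘ y)) => // e; apply: y0.
  by rewrite -[y]comp1m -q'j -compA e compm0.
apply: NNPP => ny; have {}l0 : l = 0%N.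
  by apply: l0.2 => y; apply: NNPP => y0; apply: ny; exists y.
apply: x0; apply: k0.1; apply/eqP; rewrite -((pcharf0P K).1 K0).
have := same_traces_horner tMN Xh; rewrite kE lE l0 mul0r => /eqP.
by rewrite mulf_eq0 (negPf (trace_data_rank_neq0 K0 dS)) orbF.
Qed.

Lemma biproduct_isomorphic S M N B B' : biproduct S M B -> biproduct S N B' ->
  isomorphic M N -> isomorphic B B'.
Proof.
move=> [i [j [p [q [pi qj pj qi ijE]]]]] [i' [j' [p' [q' [pi' qj' pj' qi' ijE']]]]] [f].
exists; exists (i' ∘ p + j' ∘ (f ∘ q)) (i ∘ p' + j ∘ (bwd f ∘ q')).
  rewrite compDl !compDr -!compA (reassoc pi') (reassoc pj') (reassoc qi') (reassoc qj').
  by rewrite !comp0m !compm0 addr0 add0r !comp1m (reassoc (bwdK f)) comp1m.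
rewrite compDl !compDr -!compA (reassoc pi) (reassoc pj) (reassoc qi) (reassoc qj).
by rewrite !comp0m !compm0 addr0 add0r !comp1m (reassoc (fwdK f)) comp1m.
Qed.

Lemma same_traces_summand S M N B B' : biproduct S M B -> biproduct S N B' ->
  same_traces B B' -> same_traces M N.
Proof.
move=> bp bp' t n n0; have := t n n0; rewrite !(taut_exp F).
by rewrite (ctrace_biproduct _ _ bp) (ctrace_biproduct _ _ bp') => /addrI.
Qed.

(** A simple summand of one object is a summand of the other; remove it from
    both and go on with the complements, whose traces still agree. *)
Lemma same_traces_isomorphic M N : separates_simples -> same_traces M N -> isomorphic M N.
Proof.
move=> sep; have [w _] := C_int M.
have := wedderburn_length (w := w); move: (_.+1) => n.
elim: n M N {w} => [|n IHn] M N Mn tMN; first by exfalso; apply: (Mn (fun => 0)) => -[].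
have tNM : same_traces N M by move=> k k0; rewrite tMN.
have [M0|M0] := classic (idm M = 0).
  have N0 : idm N = 0.
    apply: NNPP => N0; have [S [i [p [Ss pi]]]] := simple_summand (dec N) N0.
    have i0 : i <> 0 by move=> e; apply: Ss.1; rewrite -pi e compm0.
    have [y []] := same_traces_simple sep tNM Ss i0.
    by rewrite -[y]comp1m M0 comp0m.
  by exists; exists 0 0; rewrite compm0 ?M0 ?N0.
have [S [i [p [Ss pi]]]] := simple_summand (dec M) M0.
have i0 : i <> 0 by move=> e; apply: Ss.1; rewrite -pi e compm0.
have [j j0] := same_traces_simple sep tMN Ss i0.
have [q qj] := simple_mono C_add C_ss C_psab Ss j0.
have [M' bpM] := complement_biproduct C_psab pi.
have [N' bpN] := complement_biproduct C_psab qj.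
apply: (biproduct_isomorphic bpM bpN); apply: IHn.
  exact: length_summand bpM Ss.1 Mn.
exact: same_traces_summand bpM bpN tMN.
Qed.

End Equivalences.

(** * The equivalences *)

Section Main.
Variables (K : fieldType) (C : rigid_category K).
Hypotheses (K0 : [pchar K] =i pred0) (C_ss : semisimple_category C).
Hypotheses (C_psab : pseudo_abelian C) (C_int : integral_type C).
Variable F : tensor_aut C.
Local Notation U := (one_obj C).
Implicit Types M N S T : C.

Let C_add := rcat_additive C.
Let dataP := trace_dataP K0 C_ss C_psab C_int F.
Let schur' := schur_iso C_add C_ss C_psab.
Let dec := decomposable_all C_ss C_psab C_int.

(** The differential equation gives [a_n] from the series and the [a_i] with
    [0 < i < n], as the constant term is [1]. *)
Lemma exp_series_inj (a b : nat -> K) : exp_series a =1 exp_series b ->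
  forall n, (0 < n)%N -> a n = b n.
Proof.
move=> e; elim/ltn_ind => n IH n0; pose N := n.+1.
have := exp_series_ode K0 a (ltnSn n); have := exp_series_ode K0 b (ltnSn n).
have -> : \poly_(i < N) exp_series a i = \poly_(i < N) exp_series b i.
  by apply/polyP => i; rewrite !coef_poly e.
move=> -> /esym.
have c0 (c : nat -> K) : (trunc N c * \poly_(i < N) exp_series b i)`_n
    = \sum_(i < n) (if (i : nat) == 0%N then 0 else c i) * exp_series b (n - i)%N + c n.
  rewrite coefM big_ord_recr /= subnn !coef_poly ltnSn (gtn_eqF n0) ltn0Sn.
  rewrite exp_series0 mulr1; congr (_ + _).
  apply: eq_bigr => i _; rewrite !coef_poly.
  by rewrite (ltn_trans (ltn_ord i) (ltnSn n)) ltnS leq_subr.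
rewrite !c0 (eq_bigr (fun i : 'I_n => (if (i : nat) == 0%N then 0 else b i) * exp_series b (n - i)%N)).
  by move/addrI.
by move=> i _; case: posnP => // i0; rewrite IH.
Qed.

Lemma zeta_same_traces M N : zeta F M =1 zeta F N -> same_traces F M N.
Proof. exact: exp_series_inj. Qed.

Lemma same_traces_zeta M N : same_traces F M N -> zeta F M =1 zeta F N.
Proof.
move=> t n; rewrite /zeta /series_exp.
have -> // : \poly_(i < n.+1) (if i == 0%N then 0 else ctrace (F M ^+ i) / i%:R)
   = \poly_(i < n.+1) (if i == 0%N then 0 else ctrace (F N ^+ i) / i%:R).
apply/polyP => i; rewrite !coef_poly; case: (i < n.+1)%N => //.
by case: posnP => // i0; rewrite t.
Qed.

(** The sum of [k] copies of [1]. *)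
Lemma unit_power k : exists M, (forall n, ctrace (F M ^+ n) = k%:R) /\
  ((0 < k)%N -> exists x : mor U M, x <> 0).
Proof.
elim: k => [|k [M [tM _]]].
  have [Z hZ] := C_add.1; exists Z; split=> // n.
  by apply: ctrace_zero; apply: (hZ Z).1.
have [B bp] := C_add.2 U M; exists B; split=> [n|_].
  rewrite taut_exp (ctrace_biproduct _ _ bp) -!taut_exp tM taut_one expr1n.
  by rewrite [X in X + _](ctrace_one C) -natr1 addrC.
have [i [j [p [q [pi _ _ _ _]]]]] := bp; exists i => i0.
by case: (one_simple C_ss) => []; rewrite -pi i0 compm0.
Qed.

(** If [F = 1] on the simple object [S] then [Z(S, t) = (1 - t) ^ (-c)]. For
    [c > 0] this is the zeta function of the sum of [c] copies of [1]; for [c < 0],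
    [S] plus [- c] copies of [1] would have the zeta function of [0]. *)
Lemma zeta_fixes_only_one :
  (forall M N, zeta F M =1 zeta F N -> isomorphic M N) -> fixes_only_one F.
Proof.
move=> hiv S Ss FS; have [p [c D]] := dataP Ss.
have [_ _ c0 _ _] := D.
have tS n : ctrace (F S ^+ n) = c%:~R.
  have -> : F S ^+ n = idm S by rewrite FS -[idm S]/(1 : endo S) expr1n.
  by rewrite (trace_data_rank K0 D) (trace_data_id Ss D FS) size_XsubC mulr1.
case: c {D} c0 tS => k k0 tS.
  have [M [tM xM]] := unit_power k.
  have [i] : isomorphic M S by apply/hiv/same_traces_zeta => n _; rewrite tM tS.
  have [x x0] : exists x : mor U M, x <> 0 by apply: xM; rewrite lt0n.
  apply/isomorphic_sym/(schur' (f := i ∘ x) (one_simple C_ss) Ss) => e; apply: x0.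
  by apply: (iso_mono (i := i)); rewrite e compm0.
have [M [tM _]] := unit_power k.+1; have [B bp] := C_add.2 S M.
have [Z hZ] := C_add.1.
have [f] : isomorphic B Z.
  apply/hiv/same_traces_zeta => n _.
  rewrite taut_exp (ctrace_biproduct _ _ bp) -!taut_exp tM tS.
  rewrite ctrace_zero; last exact: (hZ Z).1.
  by rewrite NegzE mulrNz addNr.
have [i [j [p' [q [pi _ _ _ _]]]]] := bp.
case: Ss.1; rewrite -pi -[i]comp1m -(bwdK f) ((hZ B).2 f).
by rewrite compm0 comp0m compm0.
Qed.

Lemma min_poly_unique S p c (q : {poly K}) : trace_data F S p c ->
  is_min_poly (F S) q -> q = p.
Proof.
move=> [pi pm _ pS _] [qm q0 qmin]; apply/eqP; rewrite eq_sym -eqp_monic //.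
have pq : p %| q by apply/pS.
rewrite -dvdp_size_eqp // eqn_leq (dvdp_leq (monic_neq0 qm) pq) /=.
by apply: qmin; [exact: monic_neq0|apply/pS].
Qed.

Lemma trace_data_min_poly S p c : trace_data F S p c -> is_min_poly (F S) p.
Proof.
move=> [pi pm _ pS _]; split=> // [|q q0 /pS]; first by apply/pS.
exact: dvdp_leq.
Qed.

(** As [F] is invertible, reversing a minimal polynomial loses nothing. *)
Lemma inv_min_poly_separates :
  separates_simples F <->
  forall S T, simple_object S -> simple_object T ->
    (exists P : {poly K}, is_inv_min_poly (F S) P /\ is_inv_min_poly (F T) P) ->
    isomorphic S T.
Proof.
split=> [sep S T Ss Ts [P [[q [qS ->]] [q' [qT e]]]]|hiii S T p cS cT Ss Ts dS dT].
  have [p [c dS]] := dataP Ss; have [p' [c' dT]] := dataP Ts.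
  have pp : p = p'.
    rewrite (min_poly_unique dS qS) (min_poly_unique dT qT) in e.
    by rewrite -(reverse_reverse (trace_data_coef0 Ss dS)) e (reverse_reverse (trace_data_coef0 Ts dT)).
  by rewrite -pp in dT; apply: (sep S T p c c').
apply: hiii => //; exists (reverse_poly p).
by split; exists p; split=> //; [exact: trace_data_min_poly dS|exact: trace_data_min_poly dT].
Qed.

Lemma separating_poly S p c (l : seq C) : separates_simples F -> simple_object S ->
  trace_data F S p c -> (forall T, List.In T l -> simple_object T /\ ~ isomorphic S T) ->
  exists h, p %| h - 1 /\ forall T, List.In T l -> endo_horner h (F T) = 0.
Proof.
move=> sep Ss dS; elim: l => [|T l IHl] hl.
  by exists 1; rewrite subrr dvdp0.
have [|h [ph hT]] := IHl; first by move=> T' T'l; apply: hl; right.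
have [Ts nST] := hl T (or_introl erefl).
have [q [cT dT]] := dataP Ts.
have [h' /andP [ph' qh']] := crt_idempotent (trace_data_coprime sep Ss Ts dS dT nST).
exists (h * h'); split.
  have -> : h * h' - 1 = h * (h' - 1) + (h - 1) by ring.
  by rewrite dvdp_addr // dvdp_mull.
move=> T' [<-|T'l]; last by rewrite endo_hornerM hT // mul0r.
by have [_ _ _ pT _] := dT; rewrite endo_hornerM (pT h').2 // mulr0.
Qed.

(** A central endomorphism acts on the [S]-isotypic part of [M] through the
    centre of [End(S)], which is [K[F S]]; the polynomials obtained for the
    various [S] are glued by interpolation. *)
Lemma fixes_only_one_tate M : fixes_only_one F -> generates_center (F M).
Proof.
move=> hi g; split=> [gc|[h ->]]; last exact: horner_central.
have sep := fixes_only_one_separates K0 C_ss C_psab C_int hi.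
have [s [sS sE]] := simple_detect (dec M).
suff [q qE] : exists q, forall S (x : mor S M), List.In S s ->
    (g : mor M M) ∘ x = (endo_horner q (F M) : mor M M) ∘ x.
  by exists q; apply: sE.
elim: s sS {sE} => [|S l IHl] sS; first by exists 0.
have Ss : simple_object S by apply: sS; left.
have [|q qE] := IHl; first by move=> T Tl; apply: sS; right.
have [[T [Tl [i]]]|nT] := classic (exists T, List.In T l /\ isomorphic S T).
  exists q => T' x [T'E|]; last exact: qE.
  case: T' / T'E x => x.
  have := congr1 (fun y => y ∘ i) (qE T (x ∘ bwd i) Tl).
  by rewrite -!compA bwdK compm1.
have [x0|/not_all_ex_not [x x0]] := classic (forall x : mor S M, x = 0).
  exists q => T' x [T'E|]; last exact: qE.
  by case: T' / T'E x => x; rewrite (x0 x) !compm0.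
have [pr prx] := simple_mono C_add C_ss C_psab Ss x0.
pose gS : endo S := pr ∘ ((g : mor M M) ∘ x).
have gxE (y : mor S M) : (g : mor M M) ∘ y = y ∘ gS.
  have gy : (g : mor M M) ∘ (y ∘ pr) = (y ∘ pr) ∘ (g : mor M M) := gc (y ∘ pr).
  by rewrite /gS !compA -gy -!compA prx compm1.
have gSc : central gS.
  move=> f; change (gS ∘ f = f ∘ gS).
  by rewrite {1}/gS -!compA (gxE (x ∘ f)) -!compA (reassoc prx) comp1m.
have [q1 q1E] := ((simple_multiplicity K0 C_ss C_psab C_int hi Ss).2 gS).1 gSc.
have [p [c dS]] := dataP Ss.
have [h [ph hT]] : exists h, p %| h - 1 /\ forall T, List.In T l -> endo_horner h (F T) = 0.
  apply: (separating_poly sep Ss dS) => T Tl; split; first by apply: sS; right.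
  by move=> ST; apply: nT; exists T; split=> //; apply: isomorphic_sym.
have hS : endo_horner h (F S) = 1.
  have [_ _ _ pS _] := dS; have := (pS _).2 ph; rewrite endo_hornerB endo_horner1.
  by move/eqP; rewrite subr_eq0 => /eqP.
exists (q + h * (q1 - q)) => T y [TE|Tl].
  case: T / TE y => y; rewrite gxE (taut_horner_nat F).
  by rewrite endo_hornerD endo_hornerM hS mul1r endo_hornerB addrC subrK -q1E.
rewrite (qE T y Tl) !(taut_horner_nat F) endo_hornerD endo_hornerM (hT T Tl).
by rewrite mul0r addr0.
Qed.

(** Were a fixed simple [S] not [1], the projector of [S ⊕ 1] onto [S] would be
    central, but [F = 1] on [S ⊕ 1], so [K[F]] consists of scalars. *)
Lemma tate_fixes_only_one : (forall M, generates_center (F M)) -> fixes_only_one F.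
Proof.
move=> hv S Ss FS; apply: NNPP => nSU.
have hom0 (f : mor S U) : f = 0.
  by apply: NNPP => f0; apply: nSU; apply: schur' f0 => //; apply: one_simple.
have hom0' (f : mor U S) : f = 0.
  apply: NNPP => f0; apply: nSU; apply: isomorphic_sym; apply: schur' f0 => //.
  exact: one_simple.
have [B bp] := C_add.2 S U; have [i [j [p [q [pi qj pj qi ijE]]]]] := bp.
have FB : F B = 1.
  change (F B = idm B); rewrite -[LHS]compm1 -{1}ijE compDr !compA !(taut_nat F).
  by rewrite FS taut_one !compm1.
have ec : central (i ∘ p : endo B).
  move=> x; change ((i ∘ p) ∘ x = x ∘ (i ∘ p)).
  have e1 : p ∘ (x ∘ j) = 0 := hom0' _.
  have e2 : q ∘ (x ∘ i) = 0 := hom0 _.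
  transitivity (i ∘ (p ∘ (x ∘ (i ∘ p)))).
    rewrite -[x in LHS]compm1 -ijE !compDr -!compA.
    by rewrite (compA x j) (compA p (x ∘ j)) e1 comp0m compm0 addr0.
  rewrite -[RHS]comp1m -ijE compDl -!compA (compA x i) (compA q (x ∘ i)) e2.
  by rewrite comp0m compm0 addr0 -!compA.
have [h hE] := (hv B (i ∘ p)).1 ec.
have {}hE : i ∘ p = (\sum_(k < size h) h`_k) *: idm B.
  rewrite [LHS]hE /endo_horner FB scaler_suml; apply: eq_bigr => k _.
  by rewrite expr1n.
move: hE; set c := (\sum_(_ < _) _) => hE.
have c0 : c = 0.
  apply/eqP; have := congr1 (fun x => q ∘ x ∘ j) hE.
  rewrite compZr compm1 compZl qj -!compA pj compm0 compm0 => /esym/eqP.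
  rewrite scaler_eq0 => /orP [//|/eqP U0].
  by case: (one_simple C_ss) => [] [].
apply: Ss.1; have := congr1 (fun x => p ∘ x ∘ i) hE.
by rewrite c0 scale0r compm0 comp0m -!compA pi compm1 pi.
Qed.

End Main.

Theorem theorem6p4 (K : fieldType) (K_char0 : [pchar K] =i pred0)
    (C : rigid_category K) (C_ss : semisimple_category C)
    (C_psab : pseudo_abelian C) (C_int : integral_type C) (F : tensor_aut C) :
  [<-> forall S : C, simple_object S -> F S = idm S ->
         isomorphic S (one_obj C);
       forall M : C, exists d : nat,
         has_dim (mor (one_obj C) M) d /\ ord_at_one (zeta F M) (- d%:Z);
       forall S T : C, simple_object S -> simple_object T ->
         (exists P : {poly K},
            is_inv_min_poly (F S) P /\ is_inv_min_poly (F T) P) ->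
         isomorphic S T;
       forall M N : C, zeta F M =1 zeta F N -> isomorphic M N;
       forall M : C, generates_center (F M)] /\
  ((forall S : C, simple_object S -> F S = idm S -> isomorphic S (one_obj C)) ->
   forall S : C, simple_object S ->
     (exists m : int, has_multiplicity S m /\ `|m| = 1) /\
     generates_center (F S)).
Proof.
have sepE := inv_min_poly_separates K_char0 C_ss C_psab C_int F.
split; last by move=> hi S; apply: simple_multiplicity.
tfae.
- move=> hi M; have [d [P [Q [dd z e]]]] := zeta_order_hom K_char0 C_ss C_psab C_int M hi.
  by exists d; rewrite -e; split=> //; apply: zeta_fraction_ord.
- move=> hii; apply/sepE; apply: fixes_only_one_separates => //.
  exact: order_fixes_only_one hii.
- move=> hiii M N zMN; apply: same_traces_isomorphic => //; first exact/sepE.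
  exact: zeta_same_traces.
- move=> hiv M; apply: fixes_only_one_tate => //.
  exact: zeta_fixes_only_one hiv.
- exact: tate_fixes_only_one.
Qed.
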